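(* Let $A>0$, $\alpha>0$, $2\alpha+3\beta\ge0$, $\gamma>1$ and $\delta>1$. Let the initial data $(\rho_0,u_0)$ satisfy $\rho_0\ge0$ and $\big(\rho_0^{\frac{\gamma-1}{2}},\rho_0^{\frac{\delta-1}{2}},u_0\big)\in H^3(\mathbb{R}^3)$. If $(\rho_0,u_0)$ has a non-empty hyperbolic singularity set $V$, then the regular solution $(\rho,u)$ of the Cauchy problem described in the context, with maximal existence time $T_m$, blows up in finite time, i.e. $T_m<+\infty$.
   Context: The Cauchy problem is: find $\rho\ge0$ and $u=(u^{(1)},u^{(2)},u^{(3)})^\top$ on $[0,T]\times\mathbb{R}^3$ with $$\rho_t+\mathrm{div}(\rho u)=0,\qquad (\rho u)_t+\mathrm{div}(\rho u\otimes u)+\nabla P=\mathrm{div}\,\mathbb{T},$$ $P=A\rho^\gamma$, $\mathbb{T}=\alpha\rho^\delta\big(\nabla u+(\nabla u)^\top\big)+\beta\rho^\delta\,\mathrm{div}u\,\mathbb{I}_3$, $(\rho,u)|_{t=0}=(\rho_0,u_0)$, and $\rho(t,x)\to0$ as $|x|\to\infty$ for $t\ge0$. A pair $(\rho,u)$ is here called a regular solution on $[0,T]\times\mathbb{R}^3$ if it satisfies this problem in the sense of distributions and: (A) $\rho\ge0$, $\rho^{\frac{\delta-1}{2}}\in C([0,T];H^3)$, $\rho^{\frac{\gamma-1}{2}}\in C([0,T];H^3)$; (B) $u\in C([0,T];H^{s'})\cap L^\infty([0,T];H^3)$ for every $s'\in[2,3)$, and $\rho^{\frac{\delta-1}{2}}\nabla^4u\in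 L^2([0,T];L^2)$; (C) $u_t+u\cdot\nabla u=0$ wherever $\rho(t,x)=0$. For such initial data it is known that a unique regular solution exists on $[0,T_*]\times\mathbb{R}^3$ for some $T_*>0$; the maximal existence time $T_m\in(0,+\infty]$ is the supremum of all $T>0$ for which a regular solution exists on $[0,T]\times\mathbb{R}^3$. Hyperbolic singularity set: a non-empty open set $V\subset\mathbb{R}^3$ is a hyperbolic singularity set of $(\rho_0,u_0)$ if $\rho_0(x)=0$ for all $x\in V$ and $\mathrm{Sp}(\nabla u_0(x))\cap\mathbb{R}^-\ne\emptyset$ for all $x\in V$, where $\mathrm{Sp}(\nabla u_0(x))$ is the spectrum of the matrix $\nabla u_0(x)$ and $\mathbb{R}^-=(-\infty,0)$. *)

(* Defs.v *)
From HB Require Import structures.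
From mathcomp Require Import all_boot all_order all_algebra.
From mathcomp Require Import all_classical all_reals all_analysis.

Set Implicit Arguments.
Unset Strict Implicit.
Unset Printing Implicit Defensive.

Import Order.TTheory GRing.Theory Num.Theory.
Import numFieldNormedType.Exports.

Local Open Scope classical_set_scope.
Local Open Scope ring_scope.

(* Points of R^3 are row vectors.  The library puts Lebesgue measure on R and on
   products, so every integral over R^3 is taken over R * R * R and transported
   by [vec3]. *)
Definition vec3 (R : realType) (p : R * R * R) : 'rV[R]_3 :=
  \row_(i < 3) [:: p.1.1; p.1.2; p.2]`_i.

Lemma sigma_finite_product_measure d1 d2 (T1 : measurableType d1)
    (T2 : measurableType d2) (R : realType)
    (m1 : {sigma_finite_measure set T1 -> \bar R})
    (m2 : {sigma_finite_measure set T2 -> \bar R}) :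
  sigma_finite setT (m1 \x m2)%E.
Proof.
have /sigma_finiteP[F [TF ndF Foo]] := sigma_finiteT m1.
have /sigma_finiteP[G [TG ndG Goo]] := sigma_finiteT m2.
exists (fun n => F n `*` G n).
  rewrite -setXTT TF TG predeqE => -[x y]; split.
    move=> [/= [n _ Fnx] [k _ Gky]]; exists (maxn n k) => //; split.
    - by move: x Fnx; exact/subsetPset/ndF/leq_maxl.
    - by move: y Gky; exact/subsetPset/ndG/leq_maxr.
  by move=> [n _ []/= ? ?]; split; exists n.
move=> k; have [? ?] := Foo k; have [? ?] := Goo k.
split; first exact: measurableX.
by rewrite product_measure1E// lte_mul_pinfty// ge0_fin_numE.
Qed.

(* Each product gets a name of its own because the sigma-finite instance that
   the library declares on [m1 \x m2] is not found by inference. *)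
Definition leb2 (R : realType) := (@lebesgue_measure R \x @lebesgue_measure R)%E.
Arguments leb2 : clear implicits.
HB.instance Definition _ (R : realType) := Measure.on (leb2 R).
HB.instance Definition _ (R : realType) :=
  Measure_isSigmaFinite.Build _ _ _ (leb2 R)
    (sigma_finite_product_measure (@lebesgue_measure R) (@lebesgue_measure R)).

Definition leb3 (R : realType) := (leb2 R \x @lebesgue_measure R)%E.
Arguments leb3 : clear implicits.
HB.instance Definition _ (R : realType) := Measure.on (leb3 R).
HB.instance Definition _ (R : realType) :=
  Measure_isSigmaFinite.Build _ _ _ (leb3 R)
    (sigma_finite_product_measure (leb2 R) (@lebesgue_measure R)).

Definition leb_tx (R : realType) := (@lebesgue_measure R \x leb3 R)%E.
Arguments leb_tx : clear implicits.
HB.instance Definition _ (R : realType) := Measure.on (leb_tx R).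
HB.instance Definition _ (R : realType) :=
  Measure_isSigmaFinite.Build _ _ _ (leb_tx R)
    (sigma_finite_product_measure (@lebesgue_measure R) (leb3 R)).

Definition int3 (R : realType) (f : 'rV[R]_3 -> R) : R :=
  Rintegral (leb3 R) setT (f \o @vec3 R).

Definition int_tx (R : realType) (T : R) (F : R -> 'rV[R]_3 -> R) : R :=
  Rintegral (leb_tx R) (`]0, T[ `*` setT) (fun z => F z.1 (vec3 z.2)).

Definition evec (R : realType) (i : 'I_3) : 'rV[R]_3 := delta_mx 0 i.

Definition enorm (R : realType) (x : 'rV[R]_3) : R :=
  Num.sqrt (\sum_(i < 3) x 0 i ^+ 2).

Definition iter_deriv (R : realType) (V : normedModType R) (l : seq V) (f : V -> R) :
    V -> R :=
  foldr (fun v g => 'D_v g) f l.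

Definition C1 (R : realType) (V : normedModType R) (f : V -> R) : Prop :=
  continuous f /\
  (forall v, (forall x, derivable f x v) /\ continuous ('D_v f)).

Definition smooth (R : realType) (V : normedModType R) (f : V -> R) : Prop :=
  forall l : seq V, C1 (iter_deriv l f).

Definition test_function (R : realType) (V : normedModType R) (U : set V)
    (phi : V -> R) : Prop :=
  smooth phi /\
  exists K : set V, [/\ compact K, K `<=` U & forall x, ~ K x -> phi x = 0].

(* The matrix (d_j u_i)_(i, j). *)
Definition grad (R : realType) (u : 'rV[R]_3 -> 'rV[R]_3) (x : 'rV[R]_3) :
    'M[R]_3 :=
  \matrix_(i, j) 'D_(evec R j) (fun y => u y 0 i) x.

Definition divergence (R : realType) (u : 'rV[R]_3 -> 'rV[R]_3) (x : 'rV[R]_3) : R :=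
  \tr (grad u x).

(* Sobolev spaces H^s(R^3), s >= 0: weak derivatives in L^2 up to order
   k = floor s and, if s is not an integer, finite Slobodeckij seminorms of
   exponent s - k of the derivatives of order k.  A list l of coordinate indices
   stands for the derivative d_(l_1) ... d_(l_m). *)
Definition L2 (R : realType) (f : 'rV[R]_3 -> R) : Prop :=
  (f \o @vec3 R) \in Lfun (leb3 R) 2%:E.

Definition L2norm (R : realType) (f : 'rV[R]_3 -> R) : \bar R :=
  ('N[leb3 R]_2%:E [EFin \o (f \o @vec3 R)])%E.

Definition is_weak_deriv (R : realType) (l : seq 'I_3) (f g : 'rV[R]_3 -> R) :
    Prop :=
  L2 g /\
  forall phi, test_function setT phi ->
    int3 (fun x => f x * iter_deriv (map (@evec R) l) phi x) =
    (-1) ^+ size l * int3 (fun x => g x * phi x).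

(* A chosen representative; weak derivatives are unique almost everywhere. *)
Definition weak_deriv (R : realType) (l : seq 'I_3) (f : 'rV[R]_3 -> R) :
    'rV[R]_3 -> R :=
  xget (fun=> 0) [set g | is_weak_deriv l f g].

Definition slobodeckij (R : realType) (theta : R) (g : 'rV[R]_3 -> R) : \bar R :=
  (\int[leb3 R \x leb3 R]_z
    ((g (vec3 z.1) - g (vec3 z.2)) ^+ 2 /
     enorm (vec3 z.1 - vec3 z.2) `^ (3 + 2 * theta))%:E)%E.

Definition Hnorm (R : realType) (s : R) (f : 'rV[R]_3 -> R) : \bar R :=
  let k := Num.truncn s in
  ((\sum_(m < k.+1) \sum_(l : m.-tuple 'I_3) L2norm (weak_deriv l f) `^ 2
    + (if s == k%:R then 0
       else \sum_(l : k.-tuple 'I_3) slobodeckij (s - k%:R) (weak_deriv l f)))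
   `^ (2^-1))%E.

(* [Hnorm] is meaningful only when all the weak derivatives exist. *)
Definition Hspace (R : realType) (s : R) (f : 'rV[R]_3 -> R) : Prop :=
  [/\ L2 f,
      forall l : seq 'I_3, (size l <= Num.truncn s)%N ->
        exists g, is_weak_deriv l f g &
      (Hnorm s f < +oo)%E].

(* By the embedding of H^s into C^1 for s > 5/2, the elements of H^3(R^3) are
   represented by C^1 functions; this is what gives a meaning to pointwise
   conditions such as rho0 x = 0 and to grad u0 x. *)
Definition H3 (R : realType) (f : 'rV[R]_3 -> R) : Prop := Hspace 3 f /\ C1 f.

Definition CtH (R : realType) (T s : R) (f : R -> 'rV[R]_3 -> R) : Prop :=
  forall t, t \in `[0, T] ->
    Hspace s (f t) /\
    Hnorm s (f r \- f t) @[r --> within `[0, T] (nbhs t)] --> 0%E.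

Definition LinftyH3 (R : realType) (T : R) (f : R -> 'rV[R]_3 -> R) : Prop :=
  exists M : R, {ae @lebesgue_measure R, forall t, t \in `[0, T] ->
    Hspace 3 (f t) /\ (Hnorm 3 (f t) <= M%:E)%E}.

(* psi * d_j h belongs to L^2([0,T]; L^2), for psi(t) of class C^1 and h(t) in
   L^2: the product of psi with the distribution d_j h is
   phi |-> - \int h d_j (psi phi). *)
Definition L2_weighted_deriv (R : realType) (T : R) (j : 'I_3)
    (psi h : R -> 'rV[R]_3 -> R) : Prop :=
  exists g : R -> 'rV[R]_3 -> R,
    (fun z => g z.1 (vec3 z.2)) \in Lfun (leb_tx R) 2%:E /\
    {ae @lebesgue_measure R, forall t, t \in `[0, T] ->
      forall phi, test_function setT phi ->
        int3 (fun x => h t x * 'D_(evec R j) (psi t \* phi) x) =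
        - int3 (fun x => g t x * phi x)}.

Definition slab (R : realType) (T : R) : set (R * 'rV[R]_3) :=
  [set z | 0 < z.1 < T].

Definition Dt (R : realType) (phi : R * 'rV[R]_3 -> R) (t : R) (x : 'rV[R]_3) : R :=
  'D_((1, 0) : R * 'rV[R]_3) phi (t, x).

Definition Dx (R : realType) (j : 'I_3) (phi : R * 'rV[R]_3 -> R) (t : R)
    (x : 'rV[R]_3) : R :=
  'D_((0, evec R j) : R * 'rV[R]_3) phi (t, x).

(* g is locally integrable on (0,T) x R^3 and is the distributional time
   derivative of f. *)
Definition weak_time_deriv (R : realType) (T : R) (f g : R -> 'rV[R]_3 -> R) :
    Prop :=
  (forall K : set (R * 'rV[R]_3), compact K -> K `<=` slab T ->
     (leb_tx R).-integrable [set z | K (z.1, vec3 z.2)]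
       (fun z => (g z.1 (vec3 z.2))%:E)) /\
  (forall phi, test_function (slab T) phi ->
     int_tx T (fun t x => f t x * Dt phi t x) =
     - int_tx T (fun t x => g t x * phi (t, x))).

Definition stress (R : realType) (alpha beta delta : R)
    (rho : 'rV[R]_3 -> R) (u : 'rV[R]_3 -> 'rV[R]_3) (x : 'rV[R]_3) : 'M[R]_3 :=
  (alpha * rho x `^ delta) *: (grad u x + (grad u x)^T)
  + (beta * rho x `^ delta * divergence u x) *: 1%:M.

Definition continuity_eq (R : realType) (T : R)
    (rho : R -> 'rV[R]_3 -> R) (u : R -> 'rV[R]_3 -> 'rV[R]_3) : Prop :=
  forall phi, test_function (slab T) phi ->
    int_tx T (fun t x => rho t x * Dt phi t x
      + \sum_(j < 3) rho t x * u t x 0 j * Dx j phi t x) = 0.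

Definition momentum_eq (R : realType) (A alpha beta gamma delta T : R)
    (rho : R -> 'rV[R]_3 -> R) (u : R -> 'rV[R]_3 -> 'rV[R]_3) : Prop :=
  forall i : 'I_3, forall phi, test_function (slab T) phi ->
    int_tx T (fun t x => rho t x * u t x 0 i * Dt phi t x
      + \sum_(j < 3) rho t x * u t x 0 i * u t x 0 j * Dx j phi t x
      + A * rho t x `^ gamma * Dx i phi t x
      - \sum_(j < 3) stress alpha beta delta (rho t) (u t) x i j * Dx j phi t x)
    = 0.

(* u_t + u . grad u = 0 wherever rho = 0.  As u_t is a distributional
   derivative, this is an equality of locally integrable functions. *)
Definition vacuum_transport (R : realType) (T : R)
    (rho : R -> 'rV[R]_3 -> R) (u : R -> 'rV[R]_3 -> 'rV[R]_3) : Prop :=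
  exists ut : R -> 'rV[R]_3 -> 'rV[R]_3,
    (forall i, weak_time_deriv T (fun t x => u t x 0 i) (fun t x => ut t x 0 i)) /\
    {ae leb_tx R, forall z, 0 < z.1 < T -> rho z.1 (vec3 z.2) = 0 ->
      forall i, ut z.1 (vec3 z.2) 0 i
        + \sum_(j < 3) u z.1 (vec3 z.2) 0 j * grad (u z.1) (vec3 z.2) i j = 0}.

Definition vanishes_at_infinity (R : realType) (f : 'rV[R]_3 -> R) : Prop :=
  forall e, 0 < e -> exists M, forall x, M < enorm x -> `|f x| < e.

Record regular_solution (R : realType) (A alpha beta gamma delta : R)
    (rho0 : 'rV[R]_3 -> R) (u0 : 'rV[R]_3 -> 'rV[R]_3) (T : R)
    (rho : R -> 'rV[R]_3 -> R) (u : R -> 'rV[R]_3 -> 'rV[R]_3) : Prop := {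
  rs_continuity : continuity_eq T rho u;
  rs_momentum : momentum_eq A alpha beta gamma delta T rho u;
  rs_initial_rho : forall x, rho 0 x = rho0 x;
  rs_initial_u : forall x, u 0 x = u0 x;
  rs_far_field : forall t, t \in `[0, T] -> vanishes_at_infinity (rho t);

  rs_rho_ge0 : forall t x, t \in `[0, T] -> 0 <= rho t x;
  rs_delta : CtH T 3 (fun t x => rho t x `^ ((delta - 1) / 2));
  rs_gamma : CtH T 3 (fun t x => rho t x `^ ((gamma - 1) / 2));

  rs_u_Hs : forall (i : 'I_3) (s : R), 2 <= s < 3 -> CtH T s (fun t x => u t x 0 i);
  rs_u_Linfty : forall i : 'I_3, LinftyH3 T (fun t x => u t x 0 i);
  rs_D4u : forall (i j : 'I_3) (l : 3.-tuple 'I_3),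
    L2_weighted_deriv T j (fun t x => rho t x `^ ((delta - 1) / 2))
      (fun t => weak_deriv l (fun x => u t x 0 i));

  rs_vacuum : vacuum_transport T rho u;

  (* C^1 representatives, as in [H3] *)
  rs_rep_delta : forall t, t \in `[0, T] -> C1 (fun x => rho t x `^ ((delta - 1) / 2));
  rs_rep_gamma : forall t, t \in `[0, T] -> C1 (fun x => rho t x `^ ((gamma - 1) / 2));
  rs_rep_u : forall t (i : 'I_3), t \in `[0, T] -> C1 (fun x => u t x 0 i)
}.

Definition max_existence_time (R : realType) (A alpha beta gamma delta : R)
    (rho0 : 'rV[R]_3 -> R) (u0 : 'rV[R]_3 -> 'rV[R]_3) : \bar R :=
  ereal_sup [set T%:E | T in [set T : R | 0 < T /\
    exists rho u, regular_solution A alpha beta gamma delta rho0 u0 T rho u]].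

Definition hyperbolic_singularity_set (R : realType)
    (rho0 : 'rV[R]_3 -> R) (u0 : 'rV[R]_3 -> 'rV[R]_3) (V : set 'rV[R]_3) : Prop :=
  [/\ open V, V !=set0, forall x, V x -> rho0 x = 0 &
      forall x, V x -> exists2 lambda : R, lambda < 0 &
        eigenvalue (grad u0 x) lambda].

(* Main.v *)
Require Import Defs.
From mathcomp Require Import all_boot all_order all_algebra.
From mathcomp Require Import all_classical all_reals all_analysis.
From mathcomp Require Import measurable_realfun.
From mathcomp Require Import ring lra.
Import Order.TTheory GRing.Theory Num.Theory.
Import numFieldNormedType.Exports.
Local Open Scope classical_set_scope.
Local Open Scope ring_scope.
Set Implicit Arguments.
Unset Strict Implicit.
Unset Printing Implicit Defensive.

(** Write lam < 0 for an eigenvalue of the gradient of u0 at a point x0 of the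
vacuum set V, and t* = -1/lam. If a regular solution existed on [0, T] with
t* < T, then for every x in V the vacuum would persist around the straight line
t |-> x + t u0(x), and the velocity would keep the value u0(x) along it:
u(t, x + t u0(x)) = u0(x) for 0 <= t < T. At time t* this is absurd: in the
direction of an eigenvector v the map x |-> x + t* u0(x) has derivative
v + t* lam v = 0 at x0, so it brings the points x0 + h v and x0 together to
order o(h), whereas the velocities that they carry differ by h lam v + o(h), and
u(t*, .) is Lipschitz. Hence no regular solution lives beyond t*.
[flow_collapse] is this contradiction, [regular_rest] the transport along lines.

Regularity. The pointwise statements rest on the embedding of H^2(R^3) into
bounded functions ([sobolev]): a function f is bounded at x by pairing f with
the Laplacian of the truncated kernel (|y - x|^2 + e)^(-1/2), which is, up to a
negative factor, an approximate identity plus a bounded remainder. Applied to differences of two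
times it makes u and rho^((delta-1)/2) continuous in time uniformly in space
([CtH_unif]); applied to first derivatives it makes u uniformly Lipschitz in x
([solution_lipschitz]).

Persistence of vacuum. Let w(t, z) = u(t, x0 + t c + z) - c be the velocity seen
from the line, with c = u0(x0). As long as |w(t, 0)| stays below a small m, the
Lipschitz bound gives z.w >= -K |z|^2 outside a small ball, so mass does not
enter the shrinking tube exp(2Kt) |z|^2 < r^2. Testing the continuity equation
with a cutoff of this tube shows that rho = 0 almost everywhere in its core
([vacuum_tube]).

Transport. In that core u solves u_t + u.grad u = 0. Testing this with a cutoff
that follows the line, and letting it become thin, gives
|w(b, 0) - w(a, 0)| <= L (b - a) max |w(., 0)| ([transport_estimate]); since
w(0, 0) = 0, the velocity w(., 0) vanishes as long as vacuum persists. The two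
facts feed each other and a continuation argument ([bootstrap]) closes the loop
on the whole of [0, T[ ([rest_along_line]). *)

(** * Smooth functions on a normed space *)

(** [smooth] quantifies over lists of directions; this recursion on the order of
differentiation is what the closure properties below are proved by. *)
Fixpoint Ck (R : realType) (V : normedModType R) (n : nat) (f : V -> R) : Prop :=
  if n is m.+1 then C1 f /\ (forall v, Ck m ('D_v f)) else continuous f.

Lemma smooth_Ck (R : realType) (V : normedModType R) (f : V -> R) :
  (forall n, Ck n f) -> smooth f.
Proof.
move=> fC l; elim/last_ind: l f fC => [|l v IH] f fC.
  by have [] := fC 1%N.
rewrite /iter_deriv foldr_rcons -/(iter_deriv l _); apply: IH => n.
by have [_] := fC n.+1; exact.
Qed.

Lemma smooth_C1 (R : realType) (V : normedModType R) (f : V -> R) :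
  smooth f -> C1 f.
Proof. by move=> /(_ [::]). Qed.

Lemma smooth_derive (R : realType) (V : normedModType R) (f : V -> R) v :
  smooth f -> smooth ('D_v f).
Proof.
by move=> fS l; have := fS (rcons l v); rewrite /iter_deriv foldr_rcons.
Qed.

Lemma smooth_continuous (R : realType) (V : normedModType R) (f : V -> R) :
  smooth f -> continuous f.
Proof. by move=> /smooth_C1[]. Qed.

Lemma smoothCk (R : realType) (V : normedModType R) (f : V -> R) n :
  smooth f -> Ck n f.
Proof.
elim: n f => [|n IH] f fS; first exact: smooth_continuous.
by split; [exact: smooth_C1|move=> v; apply/IH/smooth_derive].
Qed.

Lemma Ck_cont (R : realType) (V : normedModType R) n (f : V -> R) :
  Ck n f -> continuous f.
Proof. by case: n => // n [] []. Qed.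

Lemma is_derive_fun (R : realType) (V : normedModType R) (f df : V -> R) v :
  (forall x, is_derive x v f (df x)) -> 'D_v f = df.
Proof. by move=> h; apply/funext => x; have /@derive_val := h x. Qed.

Lemma C1_is_derive (R : realType) (V : normedModType R) (f : V -> R) :
  C1 f -> forall x v, is_derive x v f ('D_v f x).
Proof. by move=> [_ fd] x v; apply: derivableP; case: (fd v). Qed.

Lemma C1_intro (R : realType) (V : normedModType R) (f : V -> R)
    (df : V -> V -> R) :
  continuous f -> (forall v x, is_derive x v f (df v x)) ->
  (forall v, continuous (df v)) -> C1 f.
Proof.
move=> fc fd dc; split=> // v; split; first by move=> x; have [] := fd v x.
by rewrite (is_derive_fun (fd v)).
Qed.

Lemma Ck_intro (R : realType) (V : normedModType R) (f : V -> R)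
    (df : V -> V -> R) n :
  continuous f -> (forall v x, is_derive x v f (df v x)) ->
  (forall v, Ck n (df v)) -> Ck n.+1 f.
Proof.
move=> fc fd dc; split; last by move=> v; rewrite (is_derive_fun (fd v)).
by apply: (C1_intro fc fd) => v; exact: Ck_cont (dc v).
Qed.

Lemma CkW (R : realType) (V : normedModType R) n (f : V -> R) :
  Ck n.+1 f -> Ck n f.
Proof.
elim: n f => [|n IH] f [fC dC]; first by case: fC.
by split=> // v; apply/IH/dC.
Qed.

Lemma Ck_cst (R : realType) (V : normedModType R) (c : R) n :
  Ck n (fun _ : V => c).
Proof.
elim: n c => [|n IH] c; first by move=> x; exact: cvg_cst.
have d0 (v : V) : Ck n (fun _ : V => 0 : R) by exact: IH.
by apply: (Ck_intro _ _ d0) => x; exact: cvg_cst.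
Qed.

Lemma is_deriveD_fun (R : realType) (V : normedModType R) (f g : V -> R) x v df dg :
  is_derive x v f df -> is_derive x v g dg ->
  is_derive x v (fun y => f y + g y) (df + dg).
Proof. exact: is_deriveD. Qed.

Lemma is_deriveB_fun (R : realType) (V : normedModType R) (f g : V -> R) x v df dg :
  is_derive x v f df -> is_derive x v g dg ->
  is_derive x v (fun y => f y - g y) (df - dg).
Proof. exact: is_deriveB. Qed.

Lemma is_deriveM_fun (R : realType) (V : normedModType R) (f g : V -> R) x v df dg :
  is_derive x v f df -> is_derive x v g dg ->
  is_derive x v (fun y => f y * g y) (df * g x + f x * dg).
Proof.
move=> hf hg; have := is_deriveM hf hg.
by rewrite addrC [g x *: df]mulrC.
Qed.

Lemma CkD (R : realType) (V : normedModType R) n (f g : V -> R) :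
  Ck n f -> Ck n g -> Ck n (fun x => f x + g x).
Proof.
elim: n f g => [|n IH] f g hf hg; first by move=> x; apply: cvgD; [exact: hf|exact: hg].
apply: (@Ck_intro _ _ _ (fun v x => 'D_v f x + 'D_v g x)) => [x|v x|v].
- by apply: cvgD; [exact: (Ck_cont hf)|exact: (Ck_cont hg)].
- by apply: is_deriveD_fun; apply: C1_is_derive; [case: hf|case: hg].
- by apply: IH; [exact: hf.2|exact: hg.2].
Qed.

Lemma CkM (R : realType) (V : normedModType R) n (f g : V -> R) :
  Ck n f -> Ck n g -> Ck n (fun x => f x * g x).
Proof.
elim: n f g => [|n IH] f g hf hg; first by move=> x; apply: cvgM; [exact: hf|exact: hg].
apply: (@Ck_intro _ _ _ (fun v x => 'D_v f x * g x + f x * 'D_v g x)) => [x|v x|v].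
- by apply: cvgM; [exact: (Ck_cont hf)|exact: (Ck_cont hg)].
- by apply: is_deriveM_fun; apply: C1_is_derive; [case: hf|case: hg].
- have [[_ hf'] [_ hg']] := (hf, hg).
  by apply: CkD; apply: IH; by [exact: hf'|exact: hg'|exact: CkW].
Qed.

Lemma is_derive_comp1 (R : realType) (V : normedModType R) (h : R -> R) dh
    (f : V -> R) x v df :
  is_derive (f x) 1 h dh -> is_derive x v f df ->
  is_derive x v (fun y => h (f y)) (dh * df).
Proof.
move=> hh [fd fe].
pose g := fun t : R => f (t *: v + x).
have g0 : is_derive (0 : R) 1 g df.
  split; first by have /derivable1P := fd.
  rewrite -fe /derive.
  suff -> : (fun t : R => t^-1 *: (g (t *: 1 + 0) - g 0)) =
      (fun t : R => t^-1 *: (f (t *: v + x) - f x)) by [].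
  by apply/funext => t; rewrite /g scale0r add0r addr0 [t *: 1]mulr1.
have hh' : is_derive (g 0) 1 h dh by rewrite /g scale0r add0r.
have hg : is_derive (0 : R) 1 (h \o g) (dh * df) by exact: (@is_derive1_comp _ h g 0 dh df hh' g0).
split; first by apply/derivable1P; have [] := hg.
have <- := @derive_val _ _ _ _ _ _ _ hg.
rewrite /derive.
suff -> : (fun t : R => t^-1 *: ((h \o g) (t *: 1 + 0) - (h \o g) 0)) =
    (fun t : R => t^-1 *: (h (f (t *: v + x)) - h (f x))) by [].
by apply/funext => t; rewrite /= /g scale0r add0r addr0 [t *: 1]mulr1.
Qed.

Lemma is_derive1_cont (R : realType) (h : R -> R) (s dh : R) :
  is_derive s 1 h dh -> {for s, continuous h}.
Proof. by move=> [hd _]; apply: differentiable_continuous; apply/derivable1_diffP. Qed.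

(** A family of functions of one variable, indexed by [I] and closed under
derivation on [D], is made of functions of class C^infinity on [D]; composing
with it preserves smoothness. *)
Lemma Ck_comp (R : realType) (V : normedModType R) (I : Type) (H : I -> R -> R)
    (next : I -> I) (D : set R) (f : V -> R) n :
  (forall i s, D s -> is_derive s 1 (H i) (H (next i) s)) ->
  (forall x, D (f x)) -> Ck n f -> forall i, Ck n (fun x => H i (f x)).
Proof.
move=> hH fD; have hc : continuous f -> forall i, continuous (fun x => H i (f x)).
  move=> fc i x; apply: (@continuous_comp _ _ _ f (H i)); first exact: fc.
  by apply: is_derive1_cont; exact: hH.
elim: n => [|n IH] fC i; first exact: hc.
apply: (@Ck_intro _ _ _ (fun v x => H (next i) (f x) * 'D_v f x)) => [|v x|v].
- exact/hc/(Ck_cont fC).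
- by apply: is_derive_comp1; [exact: hH|apply: C1_is_derive; case: fC].
- by apply: CkM; [apply: IH; exact: CkW|exact: fC.2].
Qed.

Lemma is_derive_lin (R : realType) (V : normedModType R) (l : V -> R) :
  (forall a x y, l (a *: x + y) = a * l x + l y) ->
  forall x v, is_derive x v l (l v).
Proof.
move=> ll x v.
have e : (fun h : R => h^-1 *: (l (h *: v + x) - l x)) @ 0^' --> l v.
  apply: cvg_near_cst; near=> h.
  rewrite ll addrK [_ *: _]mulrA mulVf ?mul1r//.
  by near: h; exact: nbhs_dnbhs_neq.
split; first by apply/cvg_ex; exists (l v).
by apply/cvg_lim.
Unshelve. all: by end_near. Qed.

Lemma Ck_lin (R : realType) (V : normedModType R) (l : V -> R) n :
  (forall a x y, l (a *: x + y) = a * l x + l y) -> continuous l -> Ck n l.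
Proof.
move=> ll lc; case: n => // n.
by apply: (@Ck_intro _ _ _ (fun v _ => l v)) => // [v x|v];
  [exact: is_derive_lin|exact: Ck_cst].
Qed.

Lemma smooth_cst (R : realType) (V : normedModType R) (c : R) :
  smooth (fun _ : V => c).
Proof. by apply: smooth_Ck => n; exact: Ck_cst. Qed.

Lemma smoothD (R : realType) (V : normedModType R) (f g : V -> R) :
  smooth f -> smooth g -> smooth (fun x => f x + g x).
Proof. by move=> hf hg; apply: smooth_Ck => n; apply: CkD; exact: smoothCk. Qed.

Lemma smoothM (R : realType) (V : normedModType R) (f g : V -> R) :
  smooth f -> smooth g -> smooth (fun x => f x * g x).
Proof. by move=> hf hg; apply: smooth_Ck => n; apply: CkM; exact: smoothCk. Qed.

Lemma smoothN (R : realType) (V : normedModType R) (f : V -> R) :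
  smooth f -> smooth (fun x => - f x).
Proof.
move=> hf; have -> : (fun x => - f x) = (fun x => -1 * f x).
  by apply/funext => x; rewrite mulN1r.
exact: (smoothM (f := fun=> -1) (@smooth_cst _ _ _) hf).
Qed.

Lemma smoothB (R : realType) (V : normedModType R) (f g : V -> R) :
  smooth f -> smooth g -> smooth (fun x => f x - g x).
Proof. by move=> hf /smoothN; exact: smoothD. Qed.

Lemma smooth_sum (R : realType) (V : normedModType R) (I : Type) (r : seq I)
    (f : I -> V -> R) :
  (forall i, smooth (f i)) -> smooth (fun x => \sum_(i <- r) f i x).
Proof.
move=> hf; elim: r => [|i r IH].
  by under eq_fun do rewrite big_nil; exact: smooth_cst.
by under eq_fun do rewrite big_cons; apply: smoothD.
Qed.

Lemma smooth_comp (R : realType) (V : normedModType R) (I : Type) (H : I -> R -> R)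
    (next : I -> I) (D : set R) (f : V -> R) i :
  (forall i s, D s -> is_derive s 1 (H i) (H (next i) s)) ->
  (forall x, D (f x)) -> smooth f -> smooth (fun x => H i (f x)).
Proof.
by move=> hH fD hf; apply: smooth_Ck => n; apply: (Ck_comp hH) => //; exact: smoothCk.
Qed.

Lemma smooth_lin (R : realType) (V : normedModType R) (l : V -> R) :
  (forall a x y, l (a *: x + y) = a * l x + l y) -> continuous l -> smooth l.
Proof. by move=> ll lc; apply: smooth_Ck => n; exact: Ck_lin. Qed.

Lemma smooth_powR (R : realType) (V : normedModType R) (f : V -> R) a :
  smooth f -> (forall x, 0 < f x) -> smooth (fun x => f x `^ a).
Proof.
move=> hf f0.
pose H (p : R * R) (s : R) := p.1 * s `^ p.2.
pose next (p : R * R) := (p.1 * p.2, p.2 - 1).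
have := @smooth_comp _ _ _ H next [set s | 0 < s] f (1, a).
rewrite /H/=; under eq_fun do rewrite mul1r; apply => // -[c b] s s0 /=.
have hb : is_derive s 1 (fun t : R => t `^ b) (b * s `^ (b - 1)) by exact: is_derive1_powR.
have := is_deriveM_fun (is_derive_cst c s 1) hb.
by rewrite mul0r add0r mulrA.
Qed.

(** * Smooth cutoff functions *)

(** The functions p(1/s) exp(-1/s) for s > 0, extended by 0, with p a
polynomial: a family closed under derivation that contains the standard
non-analytic smooth function. *)
Definition flat (R : realType) (p : {poly R}) (s : R) : R :=
  if 0 < s then p.[s^-1] * expR (- s^-1) else 0.

Definition flat_next (R : realType) (p : {poly R}) : {poly R} :=
  'X^2 * (p - p^`()).

(** The inequality exp y >= (y/(k+1))^(k+1) at y = 1/s beats the power s^(-k) and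
leaves one factor s. *)
Lemma flat_monomial (R : realType) (k : nat) (s : R) : 0 < s ->
  s^-1 ^+ k * expR (- s^-1) <= k.+1%:R ^+ k.+1 * s.
Proof.
move=> s0; set y := s^-1; have y0 : 0 < y by rewrite invr_gt0.
have e : (y / k.+1%:R) ^+ k.+1 <= expR y.
  have -> : expR y = expR (y / k.+1%:R) ^+ k.+1.
    by rewrite -expRM_natr divfK.
  rewrite lerXn2r ?nnegrE ?divr_ge0 ?expR_ge0 ?ltW//.
  by rewrite (lt_le_trans _ (expR_ge1Dx _))// ltrDr.
rewrite expRN ler_pdivrMr ?expR_gt0//.
rewrite -(invrK s) -/y -mulrA -ler_pdivrMl ?exprn_gt0// ler_pdivlMl//.
apply: le_trans e.
by rewrite expr_div_n (exprS y) mulrCA [leRHS]mulrC.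
Qed.

Lemma flat_le (R : realType) (p : {poly R}) :
  exists C : R, 0 <= C /\ forall s : R, `|flat p s| <= C * `|s|.
Proof.
exists (\sum_(i < size p) `|p`_i| * (i.+1%:R ^+ i.+1)); split.
  by apply: sumr_ge0 => i _; rewrite mulr_ge0// exprn_ge0.
move=> s; rewrite /flat; case: ltP => s0; last first.
  by rewrite normr0 mulr_ge0// sumr_ge0// => i _; rewrite mulr_ge0// exprn_ge0.
rewrite (gtr0_norm s0) horner_coef !mulr_suml (le_trans (ler_norm_sum _ _ _))//.
apply: ler_sum => i _; rewrite -!mulrA normrM ler_wpM2l//.
rewrite ger0_norm ?flat_monomial//.
by rewrite mulr_ge0 ?expR_ge0// exprn_ge0// invr_ge0 ltW.
Qed.

(** Only s = 0 needs an argument: there the difference quotient of [flat p] is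
[flat ('X * p)], which tends to 0 by [flat_le]. *)
Lemma is_derive_flat (R : realType) (p : {poly R}) (s : R) :
  is_derive s 1 (flat p) (flat (flat_next p) s).
Proof.
have [s0|s0|s0] := ltrgtP s 0.
- have -> : flat (flat_next p) s = 0 by rewrite /flat ltNge (ltW s0).
  apply: (@near_eq_is_derive _ _ _ (cst 0)).
  near=> t; rewrite /flat ltNge (ltW _)//; near: t; exact: lt_nbhsl.
- apply: (@near_eq_is_derive _ _ _ (fun t : R => p.[t^-1] * expR (- t^-1))).
    by near=> t; rewrite /flat ifT//; near: t; exact: lt_nbhsr.
  have hi : is_derive s 1 (fun t : R => t^-1) (- (s ^- 2)).
    have := is_deriveV (lt0r_neq0 s0) (is_derive_id s 1).
    by rewrite [_ *: _]mulr1.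
  have hp : is_derive s 1 (fun t : R => p.[t^-1]) (p^`().[s^-1] * - (s ^- 2)).
    exact: (is_derive_comp1 (f := fun t : R => t^-1) (is_derive_poly p s^-1) hi).
  have he : is_derive s 1 (fun t : R => expR (- t^-1)) (expR (- s^-1) * - - (s ^- 2)).
    have hn : is_derive s 1 (fun t : R => - t^-1) (- - (s ^- 2)) by exact: is_deriveN.
    exact: (is_derive_comp1 (f := fun t : R => - t^-1) (is_derive_expR (- s^-1)) hn).
  apply: (is_derive_eq (is_deriveM_fun hp he)).
  rewrite /flat s0 /flat_next hornerM hornerXn hornerD hornerN exprVn; ring.
- have f0 : flat (flat_next p) 0 = 0 by rewrite /flat ltxx.
  rewrite s0 f0.
  have e : (fun h : R => h^-1 *: (flat p (h *: 1 + 0) - flat p 0)) @ 0^' --> (0 : R).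
    have -> : (fun h : R => h^-1 *: (flat p (h *: 1 + 0) - flat p 0)) =
        (fun h : R => flat ('X * p) h).
      apply/funext => h; rewrite addr0 [h *: 1]mulr1 /flat ltxx subr0.
      by case: ifP => // _; rewrite ?scaler0// hornerM hornerX [_ *: _]mulrA.
    have [C [C0 hC]] := flat_le ('X * p).
    apply/norm_cvg0P; apply: (@squeeze_cvgr _ _ _ _ (cst 0) (fun h : R => C * `|h|)).
    + by near=> h; rewrite normr_ge0 hC.
    + exact: cvg_cst.
    + rewrite -[X in _ --> X](mulr0 C); apply: cvgM; first exact: cvg_cst.
      rewrite -[X in _ --> X](@normr0 _ R); apply: cvg_norm; exact: cvg_within.
  split; first by apply/cvg_ex; exists 0.
  by apply/cvg_lim.
Unshelve. all: by end_near. Qed.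

Lemma smooth_flat (R : realType) (V : normedModType R) (f : V -> R) p :
  smooth f -> smooth (fun x => flat p (f x)).
Proof.
by apply: (@smooth_comp _ _ _ (@flat R) (@flat_next R) setT) => // i s _; exact: is_derive_flat.
Qed.

Lemma flat1_gt0 (R : realType) (s : R) : 0 < s -> 0 < flat 1 s.
Proof. by move=> s0; rewrite /flat s0 hornerC mul1r expR_gt0. Qed.

Lemma flat_npos (R : realType) p (s : R) : s <= 0 -> flat p s = 0.
Proof. by move=> s0; rewrite /flat ltNge s0. Qed.

Lemma flat1_ge0 (R : realType) (s : R) : 0 <= flat 1 s.
Proof. by case: (leP s 0) => s0; [rewrite flat_npos|exact/ltW/flat1_gt0]. Qed.

Lemma flat1_le1 (R : realType) (s : R) : flat 1 s <= 1.
Proof.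
rewrite /flat; case: ifPn => // s0; rewrite hornerC mul1r -expR0 ler_expR oppr_le0.
by rewrite invr_ge0 ltW.
Qed.

Definition dflat (R : realType) (s : R) : R := flat (flat_next 1) s.

Lemma is_derive_flat1 (R : realType) (s : R) : is_derive s 1 (flat 1) (dflat s).
Proof. exact: is_derive_flat. Qed.

Lemma dflat_gt0 (R : realType) (s : R) : 0 < s -> 0 < dflat s.
Proof.
move=> s0; rewrite /dflat /flat s0 /flat_next derivC subr0 mulr1 hornerXn.
by rewrite mulr_gt0 ?expR_gt0// exprn_gt0// invr_gt0.
Qed.

Lemma dflat_ge0 (R : realType) (s : R) : 0 <= dflat s.
Proof. by case: (leP s 0) => s0; [rewrite /dflat flat_npos|exact/ltW/dflat_gt0]. Qed.

(** The two terms of the denominator never vanish together. The exponent -1 is a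
real power so that [smooth_powR] applies. *)
Definition step (R : realType) (s : R) : R :=
  flat 1 s * (flat 1 s + flat 1 (1 - s)) `^ (-1).

Definition dstep (R : realType) (s : R) : R := 'D_1 (@step R) s.

Lemma step_den_gt0 (R : realType) (s : R) : 0 < flat 1 s + flat 1 (1 - s).
Proof.
have [s0|s0] := ltP 0 s; first by rewrite ltr_wpDr ?flat1_ge0 ?flat1_gt0.
by rewrite ltr_wpDl ?flat1_ge0 ?flat1_gt0// subr_gt0 (le_lt_trans s0).
Qed.

Lemma stepE (R : realType) (s : R) :
  step s = flat 1 s / (flat 1 s + flat 1 (1 - s)).
Proof. by rewrite /step powR_inv1// ltW// step_den_gt0. Qed.

Lemma step_ge0 (R : realType) (s : R) : 0 <= step s.
Proof. by rewrite mulr_ge0 ?flat1_ge0 ?powR_ge0. Qed.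

Lemma step_le1 (R : realType) (s : R) : step s <= 1.
Proof. by rewrite stepE ler_pdivrMr ?step_den_gt0// mul1r lerDl flat1_ge0. Qed.

Lemma step0 (R : realType) (s : R) : s <= 0 -> step s = 0.
Proof. by move=> s0; rewrite /step flat_npos// mul0r. Qed.

Lemma step1 (R : realType) (s : R) : 1 <= s -> step s = 1.
Proof.
move=> s1; rewrite stepE (@flat_npos _ _ (1 - s)) ?subr_le0// addr0 divff// gt_eqF//.
by rewrite flat1_gt0// (lt_le_trans _ s1).
Qed.

Lemma smooth_step (R : realType) (V : normedModType R) (f : V -> R) :
  smooth f -> smooth (fun x => step (f x)).
Proof.
move=> hf; apply: smoothM; first exact: smooth_flat.
apply: smooth_powR => [|x]; last exact: step_den_gt0.
apply: smoothD; first exact: smooth_flat.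
apply: smooth_flat; apply: smoothB => //; exact: smooth_cst.
Qed.

Lemma smooth_id (R : realType) : smooth (fun x : R => x).
Proof. by apply: smooth_lin => // x. Qed.

Lemma is_derive_step (R : realType) (s : R) : is_derive s 1 (@step R) (dstep s).
Proof. by apply: C1_is_derive; apply: smooth_C1; exact: (smooth_step (@smooth_id R)). Qed.

Lemma continuous_dstep (R : realType) : continuous (@dstep R).
Proof.
have h := smooth_continuous (smooth_derive (1 : R) (smooth_step (@smooth_id R))).
exact: h.
Qed.

(** In this form the sign of the derivative and its support can be read off. *)
Lemma dstepE (R : realType) (s : R) : dstep s =
  (dflat s * flat 1 (1 - s) + flat 1 s * dflat (1 - s)) *
  (flat 1 s + flat 1 (1 - s)) `^ (- 2).
Proof.
have h1 := is_derive_flat1 s.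
have h2 : is_derive s 1 (fun s : R => flat 1 (1 - s)) (dflat (1 - s) * (0 - 1)).
  have hb : is_derive s 1 (fun s : R => 1 - s) (0 - 1).
    exact: (is_deriveB_fun (is_derive_cst (1 : R) s 1) (is_derive_id s 1)).
  exact: (is_derive_comp1 (f := fun t : R => 1 - t) (is_derive_flat1 (1 - s)) hb).
have h3 := is_derive_comp1 (f := fun t : R => flat 1 t + flat 1 (1 - t))
    (is_derive1_powR (-1) (step_den_gt0 s)) (is_deriveD_fun h1 h2).
have := @derive_val _ _ _ _ _ _ _ (is_deriveM_fun h1 h3).
rewrite -/(@step R) -/(dstep s) => ->.
have -> : (-1 - 1 : R) = - 2 by lra.
set d := flat 1 s + flat 1 (1 - s).
have d0 : 0 < d := step_den_gt0 s.
have -> : d `^ (-1) = d * d `^ (-2).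
  rewrite [d `^ (- 2)]powRN powR_mulrn ?(ltW d0)// powR_inv1 ?(ltW d0)// expr2 invfM mulrA.
  by rewrite divff ?gt_eqF// mul1r.
rewrite /d; ring.
Qed.

Lemma dstep_ge0 (R : realType) (s : R) : 0 <= dstep s.
Proof.
by rewrite dstepE mulr_ge0 ?powR_ge0// addr_ge0// mulr_ge0 ?flat1_ge0 ?dflat_ge0.
Qed.

Lemma dstep_out (R : realType) (s : R) : ~~ (0 < s < 1) -> dstep s = 0.
Proof.
rewrite dstepE negb_and -!leNgt => /orP[s0|s1].
  by rewrite /dflat !(flat_npos _ s0) !mul0r addr0 mul0r.
have s1' : 1 - s <= 0 by rewrite subr_le0.
by rewrite /dflat !(flat_npos _ s1') !mulr0 addr0 mul0r.
Qed.

Lemma step_homo (R : realType) : {homo @step R : s t / s <= t}.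
Proof.
move=> s t; rewrite le_eqVlt => /predU1P[->//|st].
rewrite -subr_ge0.
have [||c _ ->] := @MVT _ (@step R) (@dstep R) s t st.
- by move=> x _; exact: is_derive_step.
- by apply: continuous_subspaceT => x; apply: is_derive1_cont; exact: is_derive_step.
- by rewrite mulr_ge0 ?dstep_ge0// subr_ge0 ltW.
Qed.

Lemma dstep_bounded (R : realType) : exists2 C : R, 0 < C & forall s, dstep s <= C.
Proof.
have [||c _ hc] := @EVT_max _ (@dstep R) 0 1; [exact: ler01| |].
  exact/continuous_subspaceT/continuous_dstep.
exists (dstep c + 1); first by rewrite ltr_wpDl// dstep_ge0.
move=> s; have [s01|/dstep_out->] := boolP (0 < s < 1); last first.
  by rewrite addr_ge0// dstep_ge0.
rewrite (le_trans (hc s _)) ?lerDl// in_itv/=.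
by move: s01 => /andP[/ltW-> /ltW->].
Qed.

(** * Measurability and translation invariance on the products of the line *)

(** Measurability is stated on the alias [measurableTypeR], which carries the Borel
sets, and on its products. *)
Notation E1 R := (measurableTypeR R).
Notation E2 R := (E1 R * E1 R)%type.
Notation E3 R := (E2 R * E1 R)%type.
Notation E4 R := (E1 R * E3 R)%type.

Lemma frac_approx (R : realType) (n : nat) (s : R) :
  `|(Num.floor (s * n.+1%:R))%:~R / n.+1%:R - s| <= n.+1%:R^-1.
Proof.
have n0 : 0 < n.+1%:R :> R by [].
rewrite -[X in _ - X](mulfK (lt0r_neq0 n0)) -mulrBl normrM [`|n.+1%:R^-1|]gtr0_norm ?invr_gt0//.
rewrite -[leRHS]mul1r ler_wpM2r ?invr_ge0//.
have h1 := floor_le_tmp (s * n.+1%:R); have h2 := floorD1_gt (s * n.+1%:R).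
rewrite intrD in h2.
by rewrite distrC ger0_norm ?subr_ge0// lerBlDl ltW.
Qed.

Lemma frac_cvg (R : realType) (s : R) :
  (Num.floor (s * n.+1%:R))%:~R / n.+1%:R @[n --> \oo] --> s.
Proof.
apply/cvgrPdist_le => e e0; near=> n.
rewrite distrC (le_trans (frac_approx _ _))// -[leRHS]invrK lef_pV2 ?posrE ?invr_gt0//.
near: n; exists (Num.truncn e^-1) => // m /= hm.
by rewrite (le_trans (ltW (truncnS_gt _)))// ler_nat ltnS.
Unshelve. all: by end_near. Qed.

(** Freezing the second variable on a fine grid gives countably many measurable
pieces, and continuity in that variable makes these functions converge. *)
Lemma caratheodory_measurable d (T : measurableType d) (R : realType)
    (f : T -> R -> R) :
  (forall s, measurable_fun setT (fun p => f p s)) ->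
  (forall p, continuous (f p)) ->
  measurable_fun setT (fun z : T * E1 R => f z.1 z.2).
Proof.
move=> mf cf.
pose q (n : nat) (s : R) : R := (Num.floor (s * n.+1%:R))%:~R / n.+1%:R.
apply: (@measurable_fun_cvg _ _ _ setT (fun n (z : T * E1 R) => f z.1 (q n z.2))).
  move=> n _ Y mY; rewrite setTI.
  have -> : (fun z : T * E1 R => f z.1 (q n z.2)) @^-1` Y =
      \bigcup_(k : int) ([set p | Y (f p (k%:~R / n.+1%:R))] `*`
        [set s | Num.floor (s * n.+1%:R) = k]).
    rewrite predeqE => -[p s]; split.
      by move=> /= h; exists (Num.floor (s * n.+1%:R)).
    by move=> [k _ [/= h1 h2]]; rewrite /q h2.
  apply: countable_bigcupT_measurable => [|k]; first exact: countableP.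
  apply: measurableX; first by rewrite -[X in measurable X]setTI; exact: mf.
  have -> : [set s : R | Num.floor (s * n.+1%:R) = k] =
      `[k%:~R / n.+1%:R, (k + 1)%:~R / n.+1%:R[%classic.
    apply/seteqP; split => s /=; rewrite in_itv/= ler_pdivrMr// ltr_pdivlMr//.
      by move=> <-; rewrite floor_le_tmp floorD1_gt.
    by move=> ?; apply: floor_def.
  exact: measurable_itv.
move=> [p s] _ /=; by apply: continuous_cvg; [exact: cf|exact: frac_cvg].
Qed.

Lemma continuous_pair2 (R : realType) (U V : topologicalType) (f : U * V -> R) u :
  continuous f -> continuous (fun v => f (u, v)).
Proof.
move=> cf v; apply: (@continuous_comp _ _ _ (fun v => (u, v)) f); last exact: cf.
by apply: cvg_pair; [exact: cvg_cst|exact: cvg_id].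
Qed.

Lemma continuous_pair1 (R : realType) (U V : topologicalType) (f : U * V -> R) v :
  continuous f -> continuous (fun u => f (u, v)).
Proof.
move=> cf u; apply: (@continuous_comp _ _ _ (fun u => (u, v)) f); last exact: cf.
by apply: cvg_pair; [exact: cvg_id|exact: cvg_cst].
Qed.

Lemma measurable_cont2 (R : realType) (f : R * R -> R) :
  continuous f -> measurable_fun (setT : set (E2 R)) f.
Proof.
move=> cf; have h : measurable_fun setT (fun z : E2 R => f (z.1, z.2)).
  apply: (@caratheodory_measurable _ _ R (fun p s => f (p, s))).
    by move=> s; apply: continuous_measurable_fun; exact: continuous_pair1.
  by move=> p; exact: continuous_pair2.
by move: h; rewrite (_ : (fun z => f (z.1, z.2)) = f)//; apply/funext => -[].
Qed.

Lemma measurable_cont3 (R : realType) (f : R * R * R -> R) :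
  continuous f -> measurable_fun (setT : set (E3 R)) f.
Proof.
move=> cf; have h : measurable_fun setT (fun z : E3 R => f (z.1, z.2)).
  apply: (@caratheodory_measurable _ _ R (fun p s => f (p, s))).
    by move=> s; apply: measurable_cont2; exact: continuous_pair1.
  by move=> p; exact: continuous_pair2.
by move: h; rewrite (_ : (fun z => f (z.1, z.2)) = f)//; apply/funext => -[].
Qed.

Lemma measurable_cont4 (R : realType) (f : R * (R * R * R) -> R) :
  continuous f -> measurable_fun (setT : set (E4 R)) f.
Proof.
move=> cf; have h : measurable_fun setT (fun z : E3 R * E1 R => f (z.2, z.1)).
  apply: (@caratheodory_measurable _ _ R (fun p s => f (s, p))).
    by move=> s; apply: measurable_cont3; exact: continuous_pair2.
  by move=> p; exact: continuous_pair1.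
have := measurableT_comp h (@measurable_swap _ _ (E1 R) (E3 R)).
by rewrite (_ : _ \o _ = f)//; apply/funext => -[].
Qed.

Definition mpres d (T : measurableType d) (R : realType)
    (mu : set T -> \bar R) (phi : T -> T) : Prop :=
  measurable_fun setT phi /\
  forall A, measurable A -> mu (phi @^-1` A) = mu A.

Lemma mpres_shift (R : realType) (a : R) :
  mpres (@lebesgue_measure R) (fun x : measurableTypeR R => x + a).
Proof.
have mphi : measurable_fun setT (fun x : measurableTypeR R => (x + a : measurableTypeR R)).
  by apply: continuous_measurable_fun => x; apply: cvgD; [exact: cvg_id|exact: cvg_cst].
split=> // A mA; apply/esym.
apply: (@lebesgue_measure_unique _ (pushforward (@lebesgue_measure R)
  (fun x : measurableTypeR R => (x + a : measurableTypeR R)))) => //= _ [[b c]] _ <-.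
rewrite /pushforward.
have -> : (fun x : R => x + a) @^-1` `]b, c]%classic = `]b - a, c - a]%classic.
  by apply/seteqP; split => x /=; rewrite !in_itv/= ltrBlDr lerBrDr.
rewrite !lebesgue_measure_itv/= !lte_fin ltrD2r.
by case: ifP => // _; rewrite -!EFinB; congr EFin; ring.
Qed.

Lemma mpres_prod d1 d2 (T1 : measurableType d1) (T2 : measurableType d2)
    (R : realType) (m1 : {sigma_finite_measure set T1 -> \bar R})
    (m2 : {sigma_finite_measure set T2 -> \bar R}) phi1 phi2 :
  mpres m1 phi1 -> mpres m2 phi2 ->
  mpres (m1 \x m2)%E (fun z => (phi1 z.1, phi2 z.2)).
Proof.
move=> [mphi1 h1] [mphi2 h2].
have mphi : measurable_fun setT (fun z : T1 * T2 => (phi1 z.1, phi2 z.2)).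
  by apply: measurable_fun_pair; exact: measurableT_comp.
split=> // A mA; apply/esym.
apply: (@product_measure_unique _ _ _ _ _ m1 m2 (pushforward (m1 \x m2)%E
  (fun z : T1 * T2 => (phi1 z.1, phi2 z.2)))) => //= B C mB mC.
rewrite /pushforward.
have -> : (fun z : T1 * T2 => (phi1 z.1, phi2 z.2)) @^-1` (B `*` C) =
  (phi1 @^-1` B) `*` (phi2 @^-1` C) by [].
rewrite product_measure1E.
- by congr (_ * _)%E; [exact: h1|exact: h2].
- by rewrite -(setTI (phi1 @^-1` B)); exact: mphi1.
- by rewrite -(setTI (phi2 @^-1` C)); exact: mphi2.
Qed.

Lemma mpres_shift2 (R : realType) (a : R * R) :
  mpres (leb2 R) (fun z : R * R => z + a).
Proof.
by case: a => a b; have h := mpres_prod (mpres_shift a) (mpres_shift b); exact: h.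
Qed.

Lemma mpres_shift3 (R : realType) (a : R * R * R) :
  mpres (leb3 R) (fun z : R * R * R => z + a).
Proof.
case: a => a b; have h := mpres_prod (m1 := leb2 R) (mpres_shift2 a) (mpres_shift b).
exact: h.
Qed.

Lemma mpres_shift4 (R : realType) (a : R * (R * R * R)) :
  mpres (leb_tx R) (fun z : R * (R * R * R) => z + a).
Proof.
case: a => a b; have h := mpres_prod (m2 := leb3 R) (mpres_shift a) (mpres_shift3 b).
exact: h.
Qed.

Lemma ge0_integral_mpres d (T : measurableType d) (R : realType)
    (mu : {measure set T -> \bar R}) phi (f : T -> \bar R) :
  mpres mu phi -> measurable_fun setT f -> (forall x, 0 <= f x)%E ->
  (\int[mu]_x f (phi x) = \int[mu]_x f x)%E.
Proof.
move=> [mphi h] mf f0.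
have := @ge0_integral_pushforward _ _ _ _ _ phi mphi mu setT f measurableT mf (fun y _ => f0 y).
rewrite preimage_setT => <-.
by apply: eq_measure_integral => A mA _; exact: h.
Qed.

Lemma integral_mpres d (T : measurableType d) (R : realType)
    (mu : {measure set T -> \bar R}) phi (f : T -> \bar R) :
  mpres mu phi -> measurable_fun setT f ->
  (\int[mu]_x f (phi x) = \int[mu]_x f x)%E.
Proof.
move=> mphi mf; rewrite [LHS]integralE [RHS]integralE.
have e1 : ((fun x => f (phi x))^\+ = fun x => f^\+ (phi x))%E := funepos_comp f phi.
have e2 : ((fun x => f (phi x))^\- = fun x => f^\- (phi x))%E := funeneg_comp f phi.
rewrite e1 e2 !ge0_integral_mpres//; first exact: measurable_funeneg.
exact: measurable_funepos.
Qed.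

Lemma Rintegral_mpres d (T : measurableType d) (R : realType)
    (mu : {measure set T -> \bar R}) phi (f : T -> R) :
  mpres mu phi -> measurable_fun setT f ->
  Rintegral mu setT (fun x => f (phi x)) = Rintegral mu setT f.
Proof.
move=> mphi mf; rewrite /Rintegral; congr fine.
by rewrite (integral_mpres mphi (f := EFin \o f))//; exact/measurable_EFinP.
Qed.

Lemma integrable_bounded d (T : measurableType d) (R : realType)
    (mu : {measure set T -> \bar R}) (B : set T) (C : R) (f : T -> R) :
  measurable B -> (mu B < +oo)%E -> measurable_fun setT f ->
  (forall x, `|f x| <= C) -> (forall x, ~ B x -> f x = 0) ->
  mu.-integrable setT (EFin \o f).
Proof.
move=> mB Bfin mf fC f0.
have -> : EFin \o f = ((EFin \o f) \_ B)%E.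
  by apply/funext => x; rewrite patchE; case: ifPn => //; rewrite notin_setE => /f0/= ->.
apply/(integrable_mkcond _ mB).1; apply: measurable_bounded_integrable => //.
  exact: measurable_funS mf.
by exists C; split; [exact: num_real|move=> x xC y _ /=; exact: le_trans (fC y) (ltW xC)].
Qed.

Lemma Rintegral_support d (T : measurableType d) (R : realType)
    (mu : {measure set T -> \bar R}) (D : set T) (f : T -> R) :
  (forall x, ~ D x -> f x = 0) -> Rintegral mu D f = Rintegral mu setT f.
Proof.
move=> f0; rewrite Rintegral_mkcond; apply: eq_Rintegral => x _.
by rewrite patchE; case: ifPn => //; rewrite notin_setE => /f0.
Qed.

(** Translation invariance makes the integral of every difference quotient
vanish; the integral of the derivative vanishes in the limit. *)
Lemma Rintegral_derive0 d (T : measurableType d) (R : realType)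
    (mu : {measure set T -> \bar R}) (phi : nat -> T -> T) (B : set T) (C : R)
    (f g : T -> R) :
  (forall n, mpres mu (phi n)) -> measurable B -> (mu B < +oo)%E ->
  mu.-integrable setT (EFin \o f) ->
  (forall n x, `|n.+1%:R * (f (phi n x) - f x)| <= C * \1_B x) ->
  (forall x, n.+1%:R * (f (phi n x) - f x) @[n --> \oo] --> g x) ->
  mu.-integrable setT (EFin \o g) /\ Rintegral mu setT g = 0.
Proof.
move=> mphi mB Bfin fi hC hg.
have mf : measurable_fun setT f by apply/measurable_EFinP; have /integrableP[] := fi.
pose h n x := n.+1%:R * (f (phi n x) - f x).
have mfp n : measurable_fun setT (fun x => f (phi n x)).
  by apply: measurableT_comp => //; have [] := mphi n.
have mh n : measurable_fun setT (h n).
  by apply: measurable_funM => //; exact: measurable_funB.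
have mg : measurable_fun setT g.
  by apply: (@measurable_fun_cvg _ _ _ setT h) => // x _; exact: hg.
have hz n : Rintegral mu setT (h n) = 0.
  have fpi : mu.-integrable setT (EFin \o (fun x => f (phi n x))).
    apply/integrableP; split; first exact/measurable_EFinP.
    have /integrableP[_] := fi.
    rewrite -(ge0_integral_mpres (mphi n) (f := fun x => `|(f x)%:E|%E))//.
    by apply: measurableT_comp => //; exact/measurable_EFinP.
  rewrite /h RintegralZl//; last first.
    by have := integrableB measurableT fpi fi; apply.
  by rewrite RintegralB// (Rintegral_mpres (mphi n) mf) subrr mulr0.
have ig : mu.-integrable setT (EFin \o (fun x => C * \1_B x)).
  apply: (@integrable_bounded _ _ _ mu B `|C|) => //.
  - by apply: measurable_funM => //; exact: measurable_indic.
  - move=> x; rewrite normrM indicE; case: (_ \in _); rewrite ?normr1 ?mulr1//.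
    by rewrite normr0 mulr0.
  - by move=> x nB; rewrite indicE memNset// mulr0.
have hgE (x : T) : (h n x)%:E @[n --> \oo] --> (g x)%:E by apply: cvg_EFin; [exact: nearW|exact: hg].
have [gi _ cv] := @dominated_convergence _ _ _ mu setT measurableT
    (fun n x => (h n x)%:E) (EFin \o g) (EFin \o (fun x => C * \1_B x))
    (fun n => (measurable_EFinP _ _).2 (mh n)) ((measurable_EFinP _ _).2 mg)
    (aeW mu (fun x _ => hgE x)) ig
    (aeW mu (fun x n _ => hC n x)).
split=> //.
have e0 : ([sequence \int[mu]_(x in setT) (h n x)%:E]_n = fun=> 0)%E.
  apply/funext => n /=; have := hz n; rewrite /Rintegral => hf.
  have hi : mu.-integrable setT (EFin \o h n).
    apply: le_integrable ig => //; first exact/measurable_EFinP.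
    move=> x _; rewrite /= lee_fin (le_trans (hC n x))// ler_norm.
    by [].
  by rewrite -(fineK (integrable_fin_num measurableT hi)) hf.
move: cv; rewrite e0 => cv.
have := cvg_unique _ cv (@cvg_cst _ _ _ _ _).
by rewrite /Rintegral => ->.
Qed.

(** * Functions with compact support on space and space-time *)

Definition vec4 (R : realType) (z : R * (R * R * R)) : R * 'rV[R]_3 := (z.1, vec3 z.2).

Definition unvec (R : realType) (v : 'rV[R]_3) : R * R * R := (v 0 0, v 0 1, v 0 2%:R).

Definition int4 (R : realType) (F : R * 'rV[R]_3 -> R) : R :=
  Rintegral (leb_tx R) setT (F \o @vec4 R).

Lemma vec3_unvec (R : realType) (v : 'rV[R]_3) : vec3 (unvec v) = v.
Proof.
apply/rowP => i; rewrite mxE /unvec/=.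
by case: i => -[|[|[|//]]] ?; congr (v 0 _); apply/val_inj.
Qed.

Lemma vec3D (R : realType) (p q : R * R * R) : vec3 (p + q) = vec3 p + vec3 q.
Proof. by apply/rowP => i; rewrite !mxE/=; case: i => -[|[|[|//]]] ?. Qed.

Lemma le_coord (R : realType) (x : 'rV[R]_3) i : `|x 0 i| <= `|x|.
Proof.
rewrite [leRHS]/Num.norm/= mx_normrE.
exact: (le_bigmax _ (fun ij : 'I_1 * 'I_3 => `|x ij.1 ij.2|) (0, i)).
Qed.

Lemma norm_le_coord (R : realType) (x : 'rV[R]_3) c : 0 <= c ->
  (forall i, `|x 0 i| <= c) -> `|x| <= c.
Proof.
move=> c0 h; rewrite [leLHS]/Num.norm/= mx_normrE.
by apply: bigmax_le => // -[i j] _ /=; rewrite ord1.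
Qed.

Lemma continuous_vec3 (R : realType) : continuous (@vec3 R).
Proof.
move=> p.
have c1 : (fun q : R * R * R => q.1.1) @ p --> p.1.1.
  by apply: (@cvg_comp _ _ _ fst fst); [exact: cvg_fst|exact: cvg_fst].
have c2 : (fun q : R * R * R => q.1.2) @ p --> p.1.2.
  by apply: (@cvg_comp _ _ _ fst snd); [exact: cvg_fst|exact: cvg_snd].
have c3 : (fun q : R * R * R => q.2) @ p --> p.2 by exact: cvg_snd.
apply/cvgrPdist_le => e e0.
have n1 := (cvgrPdist_le _ _).1 c1 e e0.
have n2 := (cvgrPdist_le _ _).1 c2 e e0.
have n3 := (cvgrPdist_le _ _).1 c3 e e0.
near=> q; apply: norm_le_coord; first exact: ltW.
move=> i; rewrite !mxE; case: i => -[|[|[|//]]] ? /=.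
- by near: q; exact: n1.
- by near: q; exact: n2.
- by near: q; exact: n3.
Unshelve. all: by end_near. Qed.

Lemma continuous_vec4 (R : realType) : continuous (@vec4 R).
Proof.
move=> z.
suff h : (fun z : R * (R * R * R) => (z.1, vec3 z.2)) @ z --> (z.1, vec3 z.2) by exact: h.
apply: (@cvg_pair _ _ _ (nbhs z) (nbhs z.1) (nbhs (vec3 z.2)) _ _ _
  (fun z => z.1) (fun z => vec3 z.2)); first exact: cvg_fst.
apply: (@cvg_comp _ _ _ snd (@vec3 R)); [exact: cvg_snd|exact: continuous_vec3].
Qed.

Lemma measurable_vec3 (R : realType) (F : 'rV[R]_3 -> R) :
  continuous F -> measurable_fun (setT : set (E3 R)) (F \o @vec3 R).
Proof.
move=> cF; apply: measurable_cont3 => p.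
by apply: continuous_comp; [exact: continuous_vec3|exact: cF].
Qed.

Lemma measurable_vec4 (R : realType) (F : R * 'rV[R]_3 -> R) :
  continuous F -> measurable_fun (setT : set (E4 R)) (F \o @vec4 R).
Proof.
move=> cF; apply: measurable_cont4 => p.
by apply: continuous_comp; [exact: continuous_vec4|exact: cF].
Qed.

Definition cball3 (R : realType) (M : R) : set (E3 R) := [set p | `|vec3 p| <= M].

(** A product, so that its measure is the product of those of the factors; by
[cball4P] it is a ball for the norm of R * R^3. *)
Definition cball4 (R : realType) (M : R) : set (E4 R) :=
  `[- M, M]%classic `*` cball3 M.

Lemma measurable_sublevel d (T : measurableType d) (R : realType) (f : T -> R) M :
  measurable_fun setT f -> measurable [set x | f x <= M].
Proof.
move=> mf; have := mf measurableT `]-oo, M]%classic (measurable_itv _).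
by rewrite setTI; congr measurable; apply/seteqP; split => x /=; rewrite in_itv.
Qed.

Lemma measurable_cball3 (R : realType) (M : R) : measurable (cball3 M).
Proof.
apply: measurable_sublevel.
exact: (measurable_vec3 (F := fun x => `|x|) (@norm_continuous _ _)).
Qed.

Lemma measurable_cball4 (R : realType) (M : R) : measurable (cball4 M).
Proof. by apply: measurableX; [exact: measurable_itv|exact: measurable_cball3]. Qed.

Lemma cball4P (R : realType) (M : R) (z : E4 R) :
  cball4 M z <-> `|vec4 z| <= M.
Proof.
rewrite prod_normE ge_max; case: z => t p; rewrite /cball4 /cball3 /=; split.
  by move=> [/=]; rewrite in_itv/= -ler_norml => -> ->.
by move=> /andP[h1 h2]; split => //=; rewrite in_itv/= -ler_norml.
Qed.

Lemma leb3_cube (R : realType) (a b c : interval R) :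
  leb3 R ([set` a] `*` [set` b] `*` [set` c]) =
  (@lebesgue_measure R [set` a] * @lebesgue_measure R [set` b] * @lebesgue_measure R [set` c])%E.
Proof.
have m (i : interval R) : measurable ([set` i] : set R) by exact: measurable_itv i.
rewrite [LHS](@product_measure1E _ _ _ _ _ (leb2 R) (@lebesgue_measure R))//.
  by rewrite [X in (X * _)%E](@product_measure1E _ _ _ _ _ (@lebesgue_measure R) (@lebesgue_measure R)).
exact: measurableX.
Qed.

Lemma leb_itv_fin (R : realType) (M : R) : (@lebesgue_measure R `[(- M)%R, M]%classic < +oo)%E.
Proof. by rewrite lebesgue_measure_itv/=; case: ifP => // _; rewrite ltry. Qed.

Lemma cball3_fin (R : realType) (M : R) : (leb3 R (cball3 M) < +oo)%E.
Proof.
pose I := `[- M, M]%R.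
apply: (@le_lt_trans _ _ (leb3 R ([set` I] `*` [set` I] `*` [set` I]))).
  apply: le_measure; rewrite ?inE; [exact: measurable_cball3| |].
    by do 2 (apply: measurableX; last exact: measurable_itv); exact: measurable_itv.
  move=> [[a b] c]; rewrite /cball3/= => h.
  have hi i := le_trans (le_coord (vec3 (a, b, c)) i) h.
  move: (hi 0) (hi 1) (hi 2%:R); rewrite !mxE/= !ler_norml => h1 h2 h3.
  by split; [split|]; rewrite /= in_itv.
rewrite leb3_cube; apply: lte_mul_pinfty => //; last exact: leb_itv_fin.
  by rewrite mule_ge0.
rewrite ge0_fin_numE ?mule_ge0//.
apply: lte_mul_pinfty => //; last exact: leb_itv_fin.
by rewrite ge0_fin_numE//; exact: leb_itv_fin.
Qed.

Lemma cball4_fin (R : realType) (M : R) : (leb_tx R (cball4 M) < +oo)%E.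
Proof.
rewrite [ltLHS](@product_measure1E _ _ _ _ _ (@lebesgue_measure R) (leb3 R)); last 2 first.
- exact: measurable_itv.
- exact: measurable_cball3.
apply: lte_mul_pinfty => //; last exact: cball3_fin.
by rewrite ge0_fin_numE//; exact: leb_itv_fin.
Qed.

Lemma continuous_mul (R : realType) (V : topologicalType) (f g : V -> R) :
  continuous f -> continuous g -> continuous (fun x => f x * g x).
Proof. by move=> cf cg x; apply: cvgM; [exact: cf|exact: cg]. Qed.

Lemma continuous_add (R : realType) (V : topologicalType) (f g : V -> R) :
  continuous f -> continuous g -> continuous (fun x => f x + g x).
Proof. by move=> cf cg x; apply: cvgD; [exact: cf|exact: cg]. Qed.

Lemma compact_norm_bound (R : realType) (V : normedModType R) (K : set V) :
  compact K -> exists M : R, forall x, M < `|x| -> ~ K x.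
Proof.
move=> /compact_bounded[M [_ hM]]; exists (M + 1) => x xM Kx.
have M1 : M < M + 1 by rewrite ltrDl.
by have /= := hM (M + 1) M1 x Kx; rewrite leNgt xM.
Qed.

Lemma cont_supp_bounded (R : realType) (V : normedModType R) (K : set V) (F : V -> R) :
  compact K -> continuous F -> (forall x, ~ K x -> F x = 0) ->
  exists2 C : R, 0 <= C & forall x, `|F x| <= C.
Proof.
move=> cK cF F0.
have : compact (F @` K) by apply: continuous_compact => //; exact: continuous_subspaceT.
move=> /compact_bounded[M [_ hM]].
exists (`|M| + 1); first by rewrite addr_ge0.
move=> x; have [Kx|/F0->] := pselect (K x); last by rewrite normr0 addr_ge0.
by apply: (hM _ _ (F x)); [rewrite ltr_pwDr// ler_norm|exists x].
Qed.

Lemma integrable3_bounded (R : realType) (F : 'rV[R]_3 -> R) (C M : R) :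
  measurable_fun (setT : set (E3 R)) (F \o @vec3 R) -> (forall x, `|F x| <= C) ->
  (forall x, M < `|x| -> F x = 0) ->
  (leb3 R).-integrable setT (EFin \o (F \o @vec3 R)).
Proof.
move=> mF FC F0; apply: (integrable_bounded (measurable_cball3 M) (cball3_fin M) mF (C := C)).
  by move=> x; exact: FC.
by move=> x /negP; rewrite -ltNge => /F0.
Qed.

Lemma integrable4_bounded (R : realType) (F : R * 'rV[R]_3 -> R) (C M : R) :
  measurable_fun (setT : set (E4 R)) (F \o @vec4 R) -> (forall x, `|F x| <= C) ->
  (forall x, M < `|x| -> F x = 0) ->
  (leb_tx R).-integrable setT (EFin \o (F \o @vec4 R)).
Proof.
move=> mF FC F0; apply: (integrable_bounded (measurable_cball4 M) (cball4_fin M) mF (C := C)).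
  by move=> x; exact: FC.
by move=> x /cball4P/negP; rewrite -ltNge => /F0.
Qed.

Lemma integrable3 (R : realType) (F : 'rV[R]_3 -> R) (K : set 'rV[R]_3) :
  compact K -> continuous F -> (forall x, ~ K x -> F x = 0) ->
  (leb3 R).-integrable setT (EFin \o (F \o @vec3 R)).
Proof.
move=> cK cF F0; have [C _ hC] := cont_supp_bounded cK cF F0.
have [M hM] := compact_norm_bound cK.
by apply: (integrable3_bounded (C := C) (M := M)) => //;
  [exact: measurable_vec3|move=> x /hM/F0].
Qed.

Lemma integrable4 (R : realType) (F : R * 'rV[R]_3 -> R) (K : set (R * 'rV[R]_3)) :
  compact K -> continuous F -> (forall x, ~ K x -> F x = 0) ->
  (leb_tx R).-integrable setT (EFin \o (F \o @vec4 R)).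
Proof.
move=> cK cF F0; have [C _ hC] := cont_supp_bounded cK cF F0.
have [M hM] := compact_norm_bound cK.
by apply: (integrable4_bounded (C := C) (M := M)) => //;
  [exact: measurable_vec4|move=> x /hM/F0].
Qed.

Lemma derive_off_compact (R : realType) (V : normedModType R) (K : set V)
    (F : V -> R) v x :
  compact K -> (forall x, ~ K x -> F x = 0) -> ~ K x -> is_derive x v F 0.
Proof.
move=> cK F0 nKx.
apply: (@near_eq_is_derive _ _ _ (cst 0)).
have oK : open (~` K) by apply: closed_openC; apply: compact_closed => //; exact: norm_hausdorff.
by have := open_nbhs_nbhs (conj oK nKx); apply: filterS => y /F0.
Qed.

Lemma test_functionD (R : realType) (V : normedModType R) (U : set V) (phi : V -> R) v :
  test_function U phi -> test_function U ('D_v phi).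
Proof.
move=> [sphi [K [cK KU phi0]]]; split; first exact: smooth_derive.
exists K; split=> // x nKx.
by have /@derive_val := derive_off_compact v cK phi0 nKx.
Qed.

(** * Difference quotients and integration by parts *)

Lemma is_derive_line (R : realType) (V : normedModType R) (F : V -> R) x v (t : R) df :
  is_derive (x + t *: v) v F df -> is_derive t 1 (fun s : R => F (x + s *: v)) df.
Proof.
move=> [Fd Fe].
have e : (fun h : R => h^-1 *: (F (x + (h *: (1 : R) + t) *: v) - F (x + t *: v))) =
    (fun h : R => h^-1 *: (F (h *: v + (x + t *: v)) - F (x + t *: v))).
  by apply/funext => h; rewrite [h *: 1]mulr1 scalerDl addrCA.
by split; [rewrite /derivable e|rewrite /derive e].
Qed.

Lemma lip_dir (R : realType) (V : normedModType R) (F : V -> R) v C :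
  (forall x, derivable F x v) -> (forall x, `|'D_v F x| <= C) ->
  forall x (h : R), `|F (x + h *: v) - F x| <= C * `|h|.
Proof.
move=> Fd FC.
have pos x (h : R) : 0 < h -> `|F (x + h *: v) - F x| <= C * h.
  move=> h0.
  have d (t : R) : is_derive t 1 (fun s : R => F (x + s *: v)) ('D_v F (x + t *: v)).
    by apply: is_derive_line; exact: derivableP.
  have [|c _] := @MVT _ (fun s : R => F (x + s *: v)) (fun t => 'D_v F (x + t *: v)) 0 h h0
      (fun t _ => d t).
  - by apply: continuous_subspaceT => t; apply: is_derive1_cont; exact: d.
  - rewrite scale0r addr0 subr0 => ->.
    by rewrite normrM (gtr0_norm h0) ler_wpM2r// ltW.
move=> x h; have [h0|h0|->] := ltrgtP h 0; last 2 first.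
- by rewrite (gtr0_norm h0); exact: pos.
- by rewrite scale0r addr0 subrr normr0 mulr0.
have := pos (x + h *: v) (- h); rewrite oppr_gt0 => /(_ h0).
by rewrite scaleNr addrK distrC (ltr0_norm h0).
Qed.

Lemma cvg_invS (R : realType) : (n.+1%:R^-1 : R) @[n --> \oo] --> 0^'.
Proof.
move=> A [e /= e0 hA].
suff h : \forall n \near \oo, A ((n.+1%:R : R)^-1) by exact: h.
near=> n; apply: hA => /=; last by rewrite invr_neq0.
rewrite sub0r normrN gtr0_norm ?invr_gt0// -[ltRHS]invrK ltf_pV2 ?posrE ?invr_gt0//.
near: n; exists (Num.truncn e^-1) => // m /= hm.
by rewrite (lt_le_trans (truncnS_gt _))// ler_nat ltnS.
Unshelve. all: by end_near. Qed.

Lemma diff_quot_cvg (R : realType) (V : normedModType R) (F : V -> R) x v :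
  derivable F x v ->
  n.+1%:R * (F (x + n.+1%:R^-1 *: v) - F x) @[n --> \oo] --> 'D_v F x.
Proof.
move=> Fd.
have := cvg_comp _ _ (@cvg_invS R) Fd; apply: cvg_trans.
by apply: near_eq_cvg; apply: nearW => n; rewrite /= invrK [x + _]addrC.
Qed.

Lemma int3_derive0 (R : realType) (F : 'rV[R]_3 -> R) v (C M : R) :
  measurable_fun (setT : set (E3 R)) (F \o @vec3 R) -> (forall x, derivable F x v) ->
  (forall x, `|F x| <= C) -> (forall x, `|'D_v F x| <= C) ->
  (forall x, M < `|x| -> F x = 0) ->
  (leb3 R).-integrable setT (EFin \o ('D_v F \o @vec3 R)) /\ int3 ('D_v F) = 0.
Proof.
move=> mF Fd FC dFC F0.
pose B := cball3 (M + `|v|).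
have C0 : 0 <= C by apply: le_trans (FC 0).
apply: (@Rintegral_derive0 _ _ _ (leb3 R)
  (fun n p => p + unvec (n.+1%:R^-1 *: v)) B C (F \o @vec3 R)).
- by move=> n; exact: mpres_shift3.
- exact: measurable_cball3.
- exact: cball3_fin.
- exact: (integrable3_bounded (C := C) (M := M)).
- move=> n p /=; rewrite vec3D vec3_unvec normrM.
  have [pB|pB] := leP `|vec3 p| (M + `|v|).
    rewrite indicE mem_set// mulr1 (le_trans (ler_wpM2l _ (lip_dir Fd dFC _ _)))//.
    by rewrite mulrCA -normrM divff// normr1 mulr1.
  rewrite indicE memNset; last by apply/negP; rewrite -ltNge.
  rewrite mulr0 !F0 ?subrr ?normr0 ?mulr0//.
    by apply: le_lt_trans pB; rewrite lerDl.
  rewrite -(ltrD2r `|v|) (lt_le_trans pB)//.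
  rewrite -[X in `|X| <= _](addrK (n.+1%:R^-1 *: v)) (le_trans (ler_normB _ _))// lerD2l.
  rewrite normrZ -[leRHS]mul1r ler_wpM2r// gtr0_norm ?invr_gt0// invf_le1//.
  by rewrite ler1n.
- move=> p /=; have := diff_quot_cvg (Fd (vec3 p)).
  by apply: cvg_trans; apply: near_eq_cvg; apply: nearW => n /=; rewrite vec3D vec3_unvec.
Qed.

Lemma int4_derive0 (R : realType) (F : R * 'rV[R]_3 -> R) v (C M : R) :
  measurable_fun (setT : set (E4 R)) (F \o @vec4 R) -> (forall x, derivable F x v) ->
  (forall x, `|F x| <= C) -> (forall x, `|'D_v F x| <= C) ->
  (forall x, M < `|x| -> F x = 0) ->
  (leb_tx R).-integrable setT (EFin \o ('D_v F \o @vec4 R)) /\ int4 ('D_v F) = 0.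
Proof.
move=> mF Fd FC dFC F0.
pose B := cball4 (M + `|v|).
have C0 : 0 <= C by apply: le_trans (FC 0).
have sh n p : vec4 (p + ((n.+1%:R^-1 *: v).1, unvec (n.+1%:R^-1 *: v).2)) =
    vec4 p + n.+1%:R^-1 *: v.
  by case: p => t p; rewrite /vec4/= vec3D vec3_unvec.
apply: (@Rintegral_derive0 _ _ _ (leb_tx R)
  (fun n p => p + ((n.+1%:R^-1 *: v).1, unvec (n.+1%:R^-1 *: v).2)) B C (F \o @vec4 R)).
- by move=> n; exact: mpres_shift4.
- exact: measurable_cball4.
- exact: cball4_fin.
- exact: (integrable4_bounded (C := C) (M := M)).
- move=> n p; rewrite /= sh normrM.
  have [pB|pB] := leP `|vec4 p| (M + `|v|).
    rewrite indicE mem_set; last exact/cball4P.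
    rewrite mulr1 (le_trans (ler_wpM2l _ (lip_dir Fd dFC _ _)))//.
    by rewrite mulrCA -normrM divff// normr1 mulr1.
  rewrite indicE memNset; last by move=> /cball4P; rewrite leNgt pB.
  rewrite mulr0 !F0 ?subrr ?normr0 ?mulr0//.
    by apply: le_lt_trans pB; rewrite lerDl.
  rewrite -(ltrD2r `|v|) (lt_le_trans pB)//.
  rewrite -[X in `|X| <= _](addrK (n.+1%:R^-1 *: v)) (le_trans (ler_normB _ _))// lerD2l.
  rewrite normrZ -[leRHS]mul1r ler_wpM2r// gtr0_norm ?invr_gt0// invf_le1//.
  by rewrite ler1n.
- move=> p /=; have := diff_quot_cvg (Fd (vec4 p)).
  by apply: cvg_trans; apply: near_eq_cvg; apply: nearW => n; rewrite /= sh.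
Qed.

Lemma int3_parts (R : realType) (f phi : 'rV[R]_3 -> R) v :
  C1 f -> test_function setT phi ->
  int3 (fun x => f x * 'D_v phi x) = - int3 (fun x => 'D_v f x * phi x).
Proof.
move=> fC1 [sphi [K [cK _ phi0]]].
have fc := fC1.1; have dfc := (fC1.2 v).2.
have pc := smooth_continuous sphi; have dpc := smooth_continuous (smooth_derive v sphi).
have dphi0 x : ~ K x -> 'D_v phi x = 0.
  by move=> nKx; have /@derive_val := derive_off_compact v cK phi0 nKx.
have i1 := integrable3 cK (continuous_mul fc dpc) (fun x nK => eq_trans (congr1 _ (dphi0 x nK)) (mulr0 _)).
have i2 := integrable3 cK (continuous_mul dfc pc) (fun x nK => eq_trans (congr1 _ (phi0 x nK)) (mulr0 _)).
pose F x := f x * phi x.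
have Fd x : is_derive x v F ('D_v f x * phi x + f x * 'D_v phi x).
  by apply: is_deriveM_fun; [exact: C1_is_derive|exact: C1_is_derive (smooth_C1 sphi) _ _].
have dF x : 'D_v F x = 'D_v f x * phi x + f x * 'D_v phi x.
  by have /@derive_val := Fd x.
have F0 x : ~ K x -> F x = 0 by move=> nK; rewrite /F phi0// mulr0.
have dF0 x : ~ K x -> 'D_v F x = 0 by move=> nK; rewrite dF phi0// dphi0// !mulr0 addr0.
have [C C0 hC] := cont_supp_bounded cK (continuous_mul fc pc) F0.
have dFc : continuous ('D_v F).
  rewrite (_ : 'D_v F = fun x => 'D_v f x * phi x + f x * 'D_v phi x); last exact/funext.
  exact: (continuous_add (continuous_mul dfc pc) (continuous_mul fc dpc)).
have [D D0 hD] := cont_supp_bounded cK dFc dF0.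
have [M hM] := compact_norm_bound cK.
have := @int3_derive0 _ F v (C + D) M (measurable_vec3 (continuous_mul fc pc)).
case => [x|x|x|x xM|_].
- by have [] := Fd x.
- by rewrite (le_trans (hC x))// lerDl.
- by rewrite (le_trans (hD x))// lerDr.
- by apply: F0; exact: hM.
have -> : int3 ('D_v F) = Rintegral (leb3 R) setT (fun p =>
    'D_v f (vec3 p) * phi (vec3 p) + f (vec3 p) * 'D_v phi (vec3 p)).
  by rewrite /int3; apply: eq_Rintegral => p _; exact: dF.
rewrite /int3 RintegralD// => /eqP; rewrite addrC addr_eq0 => /eqP; exact.
Qed.

(** * Square-integrable functions and a kernel bound *)

Lemma ftc_segment (R : realType) (F f : R -> R) (a b : R) : a < b ->
  (forall x : R, is_derive x 1 F (f x)) -> continuous f ->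
  (\int[@lebesgue_measure R]_(x in `[a, b]) (f x)%:E = (F b - F a)%:E)%E.
Proof.
move=> ab dF cf; rewrite (@continuous_FTC2 _ f F a b ab) ?EFinB//.
- exact: continuous_subspaceT.
- have cF : continuous F by move=> x; apply: is_derive1_cont; exact: dF.
  split=> [x _||]; first by have [] := dF x.
    by apply: cvg_at_right_filter; exact: cF.
  by apply: cvg_at_left_filter; exact: cF.
- by move=> x _; rewrite derive1E; have /@derive_val := dF x.
Qed.

(** The factor in each coordinate of the product that dominates
(|z|^2 + 3e)^(-1); the exponent -1/3 is integrable at 0 uniformly in e, while
(|z|^2 + 3e)^(-1) does not split. *)
Definition root3 (R : realType) (e s : R) : R := (s ^+ 2 + e) `^ (- 3^-1).

Lemma sqrD_gt0 (R : realType) (e s : R) : 0 < e -> 0 < s ^+ 2 + e.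
Proof. by move=> e0; rewrite ltr_wpDl// sqr_ge0. Qed.

Lemma is_derive_sqrD (R : realType) (e s : R) :
  is_derive s 1 (fun t : R => t ^+ 2 + e) (2 * s).
Proof.
have h : is_derive s 1 (fun t : R => t * t + e) (1 * s + s * 1 + 0).
  exact: is_deriveD_fun (is_deriveM_fun (is_derive_id s 1) (is_derive_id s 1)) (is_derive_cst e s 1).
apply: (is_derive_eq h); ring.
Qed.

Lemma smooth_sqrD_powR (R : realType) (e a : R) : 0 < e ->
  smooth (fun s : R => (s ^+ 2 + e) `^ a).
Proof.
move=> e0; apply: smooth_powR => [|s]; last exact: sqrD_gt0.
by apply: smoothD; [apply: smoothM; exact: smooth_id|exact: smooth_cst].
Qed.

Lemma powR_split (R : realType) (x a b : R) : 0 < x -> x `^ (a + b) = x `^ a * x `^ b.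
Proof. by move=> x0; rewrite powRD//; apply/implyP => _; rewrite gt_eqF. Qed.

(** The derivative of 3 s (s^2 + e)^(-1/3) dominates (s^2 + e)^(-1/3), whence a
bound that is uniform in e. *)
Lemma int_root3 (R : realType) (e : R) : 0 < e ->
  (\int[@lebesgue_measure R]_(s in `[(- 2)%R, 2%R]) (root3 e s)%:E <= 12%:E)%E.
Proof.
move=> e0; pose F (s : R) := 3 * (s * root3 e s).
pose f (s : R) := (s ^+ 2 + 3 * e) * (s ^+ 2 + e) `^ (- 3^-1 - 1).
have dF (s : R) : is_derive s 1 F (f s).
  have h1 : is_derive s 1 (root3 e) (- 3^-1 * (s ^+ 2 + e) `^ (- 3^-1 - 1) * (2 * s)).
    exact: (is_derive_comp1 (f := fun t : R => t ^+ 2 + e)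
      (is_derive1_powR _ (sqrD_gt0 s e0)) (is_derive_sqrD e s)).
  have h2 := is_deriveM_fun (is_derive_cst (3 : R) s 1) (is_deriveM_fun (is_derive_id s 1) h1).
  apply: (is_derive_eq h2); rewrite /f.
  have -> : root3 e s = (s ^+ 2 + e) * (s ^+ 2 + e) `^ (- 3^-1 - 1).
    rewrite /root3 [X in _ = X * _](_ : _ = (s ^+ 2 + e) `^ 1) -?powR_split ?sqrD_gt0//.
      by congr (_ `^ _); ring.
    by rewrite powRr1// ltW// sqrD_gt0.
  by field.
have cr : continuous (root3 e) by exact: smooth_continuous (smooth_sqrD_powR _ e0).
have cf : continuous f.
  apply: continuous_mul; last exact: smooth_continuous (smooth_sqrD_powR _ e0).
  by apply: smooth_continuous; apply: smoothD;
    [apply: smoothM; exact: smooth_id|exact: smooth_cst].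
have ab : (- 2 : R) < 2 by lra.
apply: (@le_trans _ _ (\int[@lebesgue_measure R]_(s in `[(- 2)%R, 2%R]) (f s)%:E)%E).
  apply: ge0_le_integral => //=.
  - by move=> s _; rewrite lee_fin powR_ge0.
  - by apply/measurable_EFinP; apply: measurable_funTS; exact: continuous_measurable_fun.
  - by apply/measurable_EFinP; apply: measurable_funTS; exact: continuous_measurable_fun.
  - move=> s _; rewrite lee_fin /root3 /f.
    have -> : (s ^+ 2 + e) `^ (- 3^-1) = (s ^+ 2 + e) * (s ^+ 2 + e) `^ (- 3^-1 - 1).
      rewrite [X in _ = X * _](_ : _ = (s ^+ 2 + e) `^ 1) -?powR_split ?sqrD_gt0//.
        by congr (_ `^ _); ring.
      by rewrite powRr1// ltW// sqrD_gt0.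
    by rewrite ler_wpM2r ?powR_ge0// lerD2l; lra.
rewrite (ftc_segment ab dF cf) lee_fin /F.
have -> : root3 e (- 2) = root3 e 2 by rewrite /root3 sqrrN.
have r1 : root3 e 2 <= 1.
  rewrite /root3 powRN invf_le1 ?powR_gt0 ?sqrD_gt0//.
  rewrite -[leLHS](powRr0 (2 ^+ 2 + e)) ler_powR//.
  by rewrite (le_trans _ (_ : 2 ^+ 2 <= _)) ?lerDl ?(ltW e0)// expr2; lra.
lra.
Qed.

Lemma tonelli_prod d1 d2 (T1 : measurableType d1) (T2 : measurableType d2)
    (R : realType) (m1 : {sigma_finite_measure set T1 -> \bar R})
    (m2 : {sigma_finite_measure set T2 -> \bar R}) (f : T1 -> R) (g : T2 -> R) :
  measurable_fun setT f -> measurable_fun setT g ->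
  (forall x, 0 <= f x) -> (forall y, 0 <= g y) ->
  (\int[m1 \x m2]_z (f z.1 * g z.2)%:E =
   (\int[m1]_x (f x)%:E) * (\int[m2]_y (g y)%:E))%E.
Proof.
move=> mf mg f0 g0.
have mh : measurable_fun setT (fun z : T1 * T2 => (f z.1 * g z.2)%:E).
  apply/measurable_EFinP; apply: measurable_funM.
    exact: (measurableT_comp mf measurable_fst).
  exact: (measurableT_comp mg measurable_snd).
have mge : measurable_fun setT (fun y => (g y)%:E) by exact/measurable_EFinP.
have mfe : measurable_fun setT (fun y => (f y)%:E) by exact/measurable_EFinP.
rewrite (@fubini_tonelli1 _ _ _ _ _ m1 m2 _ mh); last first.
  by move=> z; rewrite lee_fin mulr_ge0.
rewrite /fubini_F -ge0_integralZr//; last 2 first.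
- by move=> x _; rewrite lee_fin.
- by apply: integral_ge0 => y _; rewrite lee_fin.
apply: eq_integral => x _; rewrite -ge0_integralZl//.
  by move=> y _; rewrite lee_fin.
by rewrite lee_fin.
Qed.

Lemma tonelli3 (R : realType) (f : E1 R -> R) :
  measurable_fun setT f -> (forall x, 0 <= f x) ->
  (\int[leb3 R]_p (f p.1.1 * f p.1.2 * f p.2)%:E =
   (\int[@lebesgue_measure R]_x (f x)%:E) * (\int[@lebesgue_measure R]_x (f x)%:E) *
   (\int[@lebesgue_measure R]_x (f x)%:E))%E.
Proof.
move=> mf f0.
have := @tonelli_prod _ _ _ _ _ (@lebesgue_measure R) (@lebesgue_measure R) f f mf mf f0 f0.
move=> <-.
apply: (@tonelli_prod _ _ _ _ _ (leb2 R) (@lebesgue_measure R) (fun z => f z.1 * f z.2) f) => //.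
- apply: measurable_funM.
    exact: (measurableT_comp mf measurable_fst).
  exact: (measurableT_comp mf measurable_snd).
- by move=> z; rewrite mulr_ge0.
Qed.

Definition sqn (R : realType) (z : 'rV[R]_3) : R := \sum_(i < 3) z 0 i ^+ 2.

Lemma sqn_ge0 (R : realType) (z : 'rV[R]_3) : 0 <= sqn z.
Proof. by apply: sumr_ge0 => i _; exact: sqr_ge0. Qed.

Lemma sqn_vec3 (R : realType) (p : R * R * R) :
  sqn (vec3 p) = p.1.1 ^+ 2 + p.1.2 ^+ 2 + p.2 ^+ 2.
Proof. by rewrite /sqn !big_ord_recr big_ord0 /= !mxE/= add0r. Qed.

Lemma norm_sqn (R : realType) (z : 'rV[R]_3) : `|z| ^+ 2 <= sqn z.
Proof.
have h : `|z| <= Num.sqrt (sqn z).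
  apply: norm_le_coord; first exact: sqrtr_ge0.
  move=> i; rewrite -sqrtr_sqr ler_wsqrtr//.
  by rewrite /sqn (bigD1 i)//= lerDl sumr_ge0// => j _; exact: sqr_ge0.
by rewrite -(sqr_sqrtr (sqn_ge0 z)) lerXn2r ?nnegrE ?sqrtr_ge0.
Qed.

Lemma sqn_norm (R : realType) (z : 'rV[R]_3) : sqn z <= 3 * `|z| ^+ 2.
Proof.
rewrite /sqn (@le_trans _ _ (\sum_(i < 3) `|z| ^+ 2))//.
  by apply: ler_sum => i _; rewrite -(real_normK (num_real (z 0 i))) lerXn2r ?nnegrE// le_coord.
by rewrite !big_ord_recr big_ord0 /=; lra.
Qed.

Lemma smooth_coord (R : realType) (i : 'I_3) : smooth (fun y : 'rV[R]_3 => y 0 i).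
Proof.
apply: smooth_lin => [a x y|]; first by rewrite !mxE.
exact: coord_continuous.
Qed.

Lemma smooth_sqnB (R : realType) (x : 'rV[R]_3) : smooth (fun y => sqn (y - x)).
Proof.
apply: smooth_sum => i.
have h : smooth (fun y : 'rV[R]_3 => (y - x) 0 i).
  rewrite (_ : (fun y => _) = fun y : 'rV[R]_3 => y 0 i + - x 0 i).
    by apply: smoothD; [exact: smooth_coord|exact: smooth_cst].
  by apply/funext => y; rewrite !mxE.
exact: smoothM.
Qed.

(** Since abc <= (a + b + c)^3 for positive a, b, c, the kernel is dominated by a
product of functions of one variable. *)
Lemma root3_prod (R : realType) (e : R) (p : R * R * R) : 0 < e ->
  (sqn (vec3 p) + 3 * e) `^ (-1) <= root3 e p.1.1 * root3 e p.1.2 * root3 e p.2.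
Proof.
move=> e0; rewrite /root3 sqn_vec3.
set a := p.1.1 ^+ 2 + e; set b := p.1.2 ^+ 2 + e; set c := p.2 ^+ 2 + e.
have a0 : 0 < a by exact: sqrD_gt0.
have b0 : 0 < b by exact: sqrD_gt0.
have c0 : 0 < c by exact: sqrD_gt0.
have -> : p.1.1 ^+ 2 + p.1.2 ^+ 2 + p.2 ^+ 2 + 3 * e = a + b + c by rewrite /a /b /c; ring.
clearbody a b c.
rewrite -!powRM ?mulr_ge0 ?(ltW a0) ?(ltW b0) ?(ltW c0)//.
rewrite !powRN powRr1 ?addr_ge0 ?(ltW a0) ?(ltW b0) ?(ltW c0)//.
have s0 : 0 < a + b + c by rewrite !addr_gt0.
rewrite lef_pV2 ?posrE ?powR_gt0 ?mulr_gt0//.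
have -> : a + b + c = ((a + b + c) ^+ 3) `^ (3^-1).
  by rewrite -powR_mulrn ?(ltW s0)// -powRrM divff// powRr1// ltW.
apply: ge0_ler_powR; rewrite ?nnegrE ?invr_ge0 ?mulr_ge0 ?exprn_ge0 ?(ltW a0) ?(ltW b0) ?(ltW c0) ?(ltW s0)//.
rewrite exprS expr2 mulrA.
apply: ler_pM; rewrite ?mulr_ge0 ?(ltW a0) ?(ltW b0) ?(ltW c0)//; last by lra.
by apply: ler_pM; rewrite ?(ltW a0) ?(ltW b0)//; lra.
Qed.

Lemma continuous_subr (R : realType) (V : normedModType R) (x : V) :
  continuous (fun y => y - x).
Proof. by move=> y; apply: cvgB; [exact: cvg_id|exact: cvg_cst]. Qed.

Lemma le_integral_set d (T : measurableType d) (R : realType)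
    (mu : {measure set T -> \bar R}) (B : set T) (f g : T -> R) :
  measurable B -> measurable_fun setT f -> measurable_fun setT g ->
  (forall x, 0 <= f x) -> (forall x, 0 <= g x) -> (forall x, B x -> f x <= g x) ->
  (\int[mu]_(x in B) (f x)%:E <= \int[mu]_x (g x)%:E)%E.
Proof.
move=> mB mf mg f0 g0 fg.
apply: (@le_trans _ _ (\int[mu]_(x in B) (g x)%:E)%E).
  apply: ge0_le_integral => //.
  - by move=> x _; rewrite lee_fin.
  - by apply/measurable_EFinP; exact: measurable_funTS.
  - by apply/measurable_EFinP; exact: measurable_funTS.
apply: ge0_subset_integral => //; first exact/measurable_EFinP.
by move=> x _; rewrite lee_fin.
Qed.

Lemma kernel_sq_integral (R : realType) (e : R) (x : 'rV[R]_3) : 0 < e ->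
  (\int[leb3 R]_(p in [set p : E3 R | (`|vec3 p - x| <= 2)%R])
     ((sqn (vec3 p - x) + 3 * e) `^ (-1))%:E <= (12 ^+ 3)%:E)%E.
Proof.
move=> e0.
pose a (s : E1 R) : R := root3 e s * \1_(`[(- 2)%R, 2%R]%classic : set R) s.
have mr : measurable_fun setT (root3 e : E1 R -> R).
  by apply: continuous_measurable_fun; exact: smooth_continuous (smooth_sqrD_powR _ e0).
have ma : measurable_fun setT a.
  by apply: measurable_funM => //; apply: measurable_indic; exact: measurable_itv.
have a0 s : 0 <= a s by rewrite mulr_ge0 ?powR_ge0.
have ia : (\int[@lebesgue_measure R]_s (a s)%:E <= 12%:E)%E.
  apply: le_trans (int_root3 e0).
  rewrite [leRHS]integral_mkcond le_eqVlt; apply/orP; left; apply/eqP; apply: eq_integral => s _.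
  by rewrite patchE /a indicE; case: ifPn => sI; rewrite ?mulr1 ?mulr0.
have := @ge0_integral_mpres _ _ _ (leb3 R) _
  (fun p : E3 R => (a p.1.1 * a p.1.2 * a p.2)%:E) (mpres_shift3 (unvec (- x))).
rewrite tonelli3// => h.
apply: (@le_trans _ _ (\int[@lebesgue_measure R]_s (a s)%:E *
  \int[@lebesgue_measure R]_s (a s)%:E * \int[@lebesgue_measure R]_s (a s)%:E)%E); last first.
  have -> : 12 ^+ 3 = 12 * 12 * 12 :> R by rewrite !exprS expr0 mulr1 mulrA.
  have i0 : (0 <= \int[@lebesgue_measure R]_s (a s)%:E)%E.
    by apply: integral_ge0 => s _; rewrite lee_fin.
  rewrite !EFinM; apply: lee_pmul => //; first by rewrite mule_ge0.
  exact: lee_pmul.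
have mP : measurable_fun setT (fun p : E3 R => (a p.1.1 * a p.1.2 * a p.2)%:E).
  apply/measurable_EFinP; apply: measurable_funM; last exact: (measurableT_comp ma measurable_snd).
  apply: measurable_funM.
    exact: (measurableT_comp ma (measurableT_comp measurable_fst measurable_fst)).
  exact: (measurableT_comp ma (measurableT_comp measurable_snd measurable_fst)).
have hP (p : E3 R) : (0 <= (a p.1.1 * a p.1.2 * a p.2)%:E)%E.
  by rewrite lee_fin mulr_ge0 ?a0// mulr_ge0 ?a0.
rewrite -(h mP hP).
have mB : measurable [set p : E3 R | `|vec3 p - x| <= 2].
  apply: (@measurable_sublevel _ _ _ ((fun y => `|y - x|) \o @vec3 R)).
  apply: measurable_vec3 => y; apply: continuous_comp; last exact: norm_continuous.
  exact: continuous_subr.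
have [mphi _] := mpres_shift3 (unvec (- x)).
apply: (@le_integral_set _ _ _ (leb3 R) [set p : E3 R | `|vec3 p - x| <= 2]
  (fun p => (sqn (vec3 p - x) + 3 * e) `^ (-1))
  (fun p => a (p + unvec (- x)).1.1 * a (p + unvec (- x)).1.2 * a (p + unvec (- x)).2)) => //.
- apply: (@measurable_vec3 _ (fun y => (sqn (y - x) + 3 * e) `^ (-1))).
  apply: smooth_continuous; apply: smooth_powR => [|y].
    by apply: smoothD; [exact: smooth_sqnB|exact: smooth_cst].
  by rewrite ltr_wpDl ?sqn_ge0// mulr_gt0.
- by apply/measurable_EFinP; exact: (measurableT_comp mP mphi).
- by move=> p; rewrite powR_ge0.
- by move=> p; have := hP (p + unvec (- x)); rewrite lee_fin.
move=> p pB.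
have e1 : vec3 p - x = vec3 (p + unvec (- x)) by rewrite vec3D vec3_unvec.
rewrite e1 (le_trans (root3_prod _ e0))//.
have c i : vec3 (p + unvec (- x)) 0 i \in `[(- 2)%R, 2%R].
  rewrite in_itv/= -ler_norml (le_trans (le_coord _ _))// -e1; exact: pB.
have := (c 0, c 1, c 2%:R); rewrite !mxE/= => -[[c1 c2] c3].
by rewrite /a !indicE !mem_set//= !mulr1.
Qed.

Lemma L2_measurable (R : realType) (g : 'rV[R]_3 -> R) : L2 g ->
  measurable_fun (setT : set (E3 R)) (g \o @vec3 R).
Proof. by move=> /sub_Lfun_mfun/set_mem. Qed.

Lemma L2_fin (R : realType) (g : 'rV[R]_3 -> R) : L2 g -> (L2norm g < +oo)%E.
Proof. by move=> /sub_Lfun_finLfun/set_mem. Qed.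

Lemma L2norm_ge0 (R : realType) (g : 'rV[R]_3 -> R) : (0 <= L2norm g)%E.
Proof. exact: Lnorm_ge0. Qed.

Lemma L2norm_le (R : realType) (g : 'rV[R]_3 -> R) (I : R) : 0 <= I ->
  (\int[leb3 R]_p (g (vec3 p) ^+ 2)%:E <= I%:E)%E -> (L2norm g <= (I `^ 2^-1)%:E)%E.
Proof.
move=> I0 h; rewrite /L2norm unlock /=.
have -> : (\int[leb3 R]_p (`|(g (vec3 p))%:E| `^ 2) = \int[leb3 R]_p (g (vec3 p) ^+ 2)%:E)%E.
  by apply: eq_integral => p _; rewrite abse_EFin poweR_EFin powR_mulrn// real_normK ?num_real.
rewrite -poweR_EFin gt0_ler_poweR// in_itv/= ?lee_fin ?I0 ?leey//.
by rewrite integral_ge0// => p _; rewrite lee_fin sqr_ge0.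
Qed.

Lemma L2_pairing (R : realType) (g phi : 'rV[R]_3 -> R) :
  L2 g -> measurable_fun (setT : set (E3 R)) (phi \o @vec3 R) -> (L2norm phi < +oo)%E ->
  (leb3 R).-integrable setT (EFin \o ((fun x => g x * phi x) \o @vec3 R)) /\
  (`|int3 (fun x => g x * phi x)|%:E <= L2norm g * L2norm phi)%E.
Proof.
move=> hg mphi fphi; have mg := L2_measurable hg.
have hh := @hoelder _ _ _ (leb3 R) _ _ 2 2 mg mphi (ltr0n _ 2) (ltr0n _ 2).
have e2 : 2^-1 + 2^-1 = 1 :> R by lra.
have := hh e2; rewrite Lnorm1 => {}hh.
have mgp : measurable_fun (setT : set (E3 R)) ((fun x => g x * phi x) \o @vec3 R).
  exact: measurable_funM.
have ig : (leb3 R).-integrable setT (EFin \o ((fun x => g x * phi x) \o @vec3 R)).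
  apply/integrableP; split; first exact/measurable_EFinP.
  apply: (le_lt_trans hh); apply: lte_mul_pinfty; [exact: L2norm_ge0| |exact: fphi].
  by rewrite ge0_fin_numE ?L2_fin//; exact: L2norm_ge0.
split=> //; apply: le_trans hh.
by rewrite EFin_normr_Rintegral//; apply: le_abse_integral => //; exact/measurable_EFinP.
Qed.

(** * The embedding of H^2 into bounded functions *)

Definition ddstep (R : realType) (s : R) : R := 'D_1 (@dstep R) s.

Lemma is_derive_dstep (R : realType) (s : R) : is_derive s 1 (@dstep R) (ddstep s).
Proof.
have h := smooth_derive (1 : R) (smooth_step (@smooth_id R)).
exact: (C1_is_derive (smooth_C1 h) s 1).
Qed.

Lemma continuous_ddstep (R : realType) : continuous (@ddstep R).
Proof.
have h := smooth_continuous (smooth_derive (1 : R) (smooth_derive (1 : R) (smooth_step (@smooth_id R)))).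
exact: h.
Qed.

Lemma dstep_off (R : realType) (s : R) : ~ `[0, 1]%classic s -> dstep s = 0.
Proof.
move=> h; apply: dstep_out; apply/negP => /andP[s0 s1]; apply: h => /=.
by rewrite in_itv/= (ltW s0) (ltW s1).
Qed.

Lemma ddstep_off (R : realType) (s : R) : ~ `[0, 1]%classic s -> ddstep s = 0.
Proof.
move=> h; have := derive_off_compact (1 : R) (@segment_compact R 0 1) (@dstep_off R) h.
by move=> /@derive_val.
Qed.

Lemma is_derive_cutoff (R : realType) (s : R) :
  is_derive s 1 (fun t : R => (4 - t) / 3) (- 3^-1).
Proof.
have h : is_derive s 1 (fun t : R => (4 - t) / 3) ((0 - 1) * 3^-1 + (4 - s) * 0).
  exact: (is_deriveM_fun (is_deriveB_fun (is_derive_cst (4 : R) s 1) (is_derive_id s 1))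
    (is_derive_cst (3^-1 : R) s 1)).
by apply: (is_derive_eq h); ring.
Qed.

Definition cutoff (R : realType) (s : R) : R := step ((4 - s) / 3).
Definition cutoff1 (R : realType) (s : R) : R := dstep ((4 - s) / 3) * - 3^-1.
Definition cutoff2 (R : realType) (s : R) : R := ddstep ((4 - s) / 3) * - 3^-1 * - 3^-1.

Lemma is_derive_cutoff0 (R : realType) (s : R) : is_derive s 1 (@cutoff R) (cutoff1 s).
Proof. exact: (is_derive_comp1 (f := fun t : R => (4 - t) / 3) (is_derive_step _) (is_derive_cutoff s)). Qed.

Lemma is_derive_cutoff1 (R : realType) (s : R) : is_derive s 1 (@cutoff1 R) (cutoff2 s).
Proof.
have h := is_derive_comp1 (f := fun t : R => (4 - t) / 3) (is_derive_dstep _) (is_derive_cutoff s).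
have h2 := is_deriveM_fun h (is_derive_cst (- 3^-1 : R) s 1).
by apply: (is_derive_eq h2); rewrite /cutoff2 /cst; ring.
Qed.

Lemma cutoff_ge0 (R : realType) (s : R) : 0 <= cutoff s.
Proof. exact: step_ge0. Qed.

Lemma cutoff_le1 (R : realType) (s : R) : cutoff s <= 1.
Proof. exact: step_le1. Qed.

Lemma cutoff_in (R : realType) (s : R) : s <= 1 -> cutoff s = 1.
Proof. by move=> h; apply: step1; lra. Qed.

Lemma cutoff_out (R : realType) (s : R) : 4 <= s -> cutoff s = 0.
Proof. by move=> h; apply: step0; lra. Qed.

Lemma cutoff12_off (R : realType) (s : R) : ~~ (1 <= s <= 4) ->
  cutoff1 s = 0 /\ cutoff2 s = 0.
Proof.
move=> h; have h' : ~ `[0, 1]%classic ((4 - s) / 3).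
  by rewrite /= in_itv/= => /andP[h1 h2]; move/negP : h; apply; apply/andP; lra.
by rewrite /cutoff1 /cutoff2 dstep_off// ddstep_off// !mul0r.
Qed.

(** The kernel (|z|^2 + e)^(-1/2) as a function of s = |z|^2, with its first and
second derivatives [npow1] and [npow2]; [npow5] is the power -5/2 that occurs in
its Laplacian. *)
Definition npow (R : realType) (e : R) (s : R) : R := (s + e) `^ (- 2^-1).
Definition npow1 (R : realType) (e : R) (s : R) : R := - 2^-1 * (s + e) `^ (- 2^-1 - 1).
Definition npow5 (R : realType) (e : R) (s : R) : R := (s + e) `^ (- 2^-1 - 1 - 1).
Definition npow2 (R : realType) (e : R) (s : R) : R := - 2^-1 * (- 2^-1 - 1) * npow5 e s.

Lemma is_derive_addr (R : realType) (e s : R) : is_derive s 1 (fun t : R => t + e) 1.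
Proof.
have h := is_deriveD_fun (is_derive_id s 1) (is_derive_cst e s 1).
by apply: (is_derive_eq h); rewrite addr0.
Qed.

Lemma is_derive_npow (R : realType) (e s : R) : 0 < s + e ->
  is_derive s 1 (npow e) (npow1 e s).
Proof.
move=> se0.
have h := is_derive_comp1 (f := fun t : R => t + e) (is_derive1_powR (- 2^-1) se0) (is_derive_addr e s).
by apply: (is_derive_eq h); rewrite mulr1.
Qed.

Lemma is_derive_npow1 (R : realType) (e s : R) : 0 < s + e ->
  is_derive s 1 (npow1 e) (npow2 e s).
Proof.
move=> se0.
have h := is_derive_comp1 (f := fun t : R => t + e) (is_derive1_powR (- 2^-1 - 1) se0) (is_derive_addr e s).
have h2 := is_deriveM_fun (is_derive_cst (- 2^-1 : R) s 1) h.
by apply: (is_derive_eq h2); rewrite /npow2 /npow5 /cst; ring.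
Qed.

Lemma npow1E (R : realType) (e s : R) : 0 < s + e ->
  npow1 e s = - 2^-1 * ((s + e) * npow5 e s).
Proof.
move=> se0; rewrite /npow1 /npow5; congr (_ * _).
rewrite -{2}[s + e]powRr1 ?(ltW se0)// -powR_split//; congr (_ `^ _); ring.
Qed.

Lemma npow_le1 (R : realType) (a : R) (s : R) : 1 <= s -> 0 <= a -> s `^ (- a) <= 1.
Proof.
move=> s1 a0; rewrite powRN invf_le1 ?powR_gt0 ?(lt_le_trans _ s1)//.
by rewrite -(powRr0 s) ler_powR.
Qed.

Lemma is_derive_coordB (R : realType) (x y v : 'rV[R]_3) i :
  is_derive y v (fun y : 'rV[R]_3 => (y - x) 0 i) (v 0 i).
Proof.
have hl : is_derive y v (fun y : 'rV[R]_3 => y 0 i) (v 0 i).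
  by apply: (@is_derive_lin _ _ (fun y : 'rV[R]_3 => y 0 i)) => a u w; rewrite !mxE.
have h := is_deriveD_fun hl (is_derive_cst (- x 0 i : R) y v).
rewrite (_ : (fun y => _) = fun y : 'rV[R]_3 => y 0 i + - x 0 i); last first.
  by apply/funext => z; rewrite !mxE.
by apply: (is_derive_eq h); rewrite addr0.
Qed.

Lemma is_derive_sqnB (R : realType) (x y : 'rV[R]_3) j :
  is_derive y (evec R j) (fun y => sqn (y - x)) (2 * (y - x) 0 j).
Proof.
have hc (i : 'I_3) : is_derive y (evec R j) (fun y : 'rV[R]_3 => (y - x) 0 i) ((i == j)%:R).
  by apply: (is_derive_eq (is_derive_coordB x y (evec R j) i)); rewrite /evec !mxE eqxx.
have hs : is_derive y (evec R j) (fun y => sqn (y - x))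
   (\sum_(i < 3) ((i == j)%:R * (y - x) 0 i + (y - x) 0 i * (i == j)%:R)).
  rewrite (_ : (fun y => _) = \sum_(i < 3) (fun y : 'rV[R]_3 => (y - x) 0 i * (y - x) 0 i)); last first.
    by apply/funext => z; rewrite fct_sumE.
  by apply: is_derive_sum => i; exact: is_deriveM_fun.
apply: (is_derive_eq hs).
rewrite (bigD1 j)//= eqxx big1 ?addr0 ?mul1r ?mulr1; last first.
  by move=> i /negbTE ->; rewrite mul0r mulr0 addr0.
by ring.
Qed.

Lemma radial_laplacian (R : realType) (H H1 H2 : R -> R) (x : 'rV[R]_3) :
  (forall s : R, 0 <= s -> is_derive s 1 H (H1 s)) ->
  (forall s : R, 0 <= s -> is_derive s 1 H1 (H2 s)) ->
  let F := fun y => H (sqn (y - x)) in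
  forall y, \sum_(j < 3) 'D_(evec R j) ('D_(evec R j) F) y =
    6 * H1 (sqn (y - x)) + 4 * sqn (y - x) * H2 (sqn (y - x)).
Proof.
move=> dH dH1 F y.
have d1 j : 'D_(evec R j) F = fun y => H1 (sqn (y - x)) * (2 * (y - x) 0 j).
  apply: is_derive_fun => z.
  exact: (is_derive_comp1 (f := fun y => sqn (y - x)) (dH _ (sqn_ge0 _)) (is_derive_sqnB x z j)).
have hc (j : 'I_3) z : is_derive z (evec R j) (fun y : 'rV[R]_3 => (y - x) 0 j) 1.
  by apply: (is_derive_eq (is_derive_coordB x z (evec R j) j)); rewrite /evec !mxE !eqxx.
have d2 (j : 'I_3) : 'D_(evec R j) ('D_(evec R j) F) y =
    2 * H1 (sqn (y - x)) + 4 * (y - x) 0 j ^+ 2 * H2 (sqn (y - x)).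
  rewrite d1.
  have h1 := is_derive_comp1 (f := fun y => sqn (y - x)) (dH1 _ (sqn_ge0 _)) (is_derive_sqnB x y j).
  have h2 := is_deriveM_fun (is_derive_cst (2 : R) y (evec R j)) (hc j y).
  have := @derive_val _ _ _ _ _ _ _ (is_deriveM_fun h1 h2) => ->; ring.
under eq_bigr do rewrite d2.
rewrite big_split/= -!mulr_suml -mulr_sumr -/(sqn (y - x)).
have -> : \sum_(i < 3) (2 : R) = 6 by rewrite !big_ord_recr big_ord0 /=; ring.
by [].
Qed.

Lemma le_integral_supp d (T : measurableType d) (R : realType)
    (mu : {measure set T -> \bar R}) (B : set T) (f g : T -> R) :
  measurable B -> measurable_fun setT f -> measurable_fun setT g ->
  (forall x, 0 <= f x) -> (forall x, ~ B x -> f x = 0) -> (forall x, B x -> f x <= g x) ->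
  (\int[mu]_x (f x)%:E <= \int[mu]_(x in B) (g x)%:E)%E.
Proof.
move=> mB mf mg f0 fB fg.
have -> : (\int[mu]_x (f x)%:E = \int[mu]_(x in B) (f x)%:E)%E.
  rewrite [RHS]integral_mkcond; apply: eq_integral => x _.
  by rewrite patchE; case: ifPn => //; rewrite notin_setE => /fB ->.
apply: ge0_le_integral => //.
- by move=> x _; rewrite lee_fin.
- by apply/measurable_EFinP; exact: measurable_funTS.
- by apply/measurable_EFinP; exact: measurable_funTS.
Qed.

Lemma cball3E (R : realType) (M : R) : 0 <= M ->
  cball3 M = [set` `[- M, M]%R] `*` [set` `[- M, M]%R] `*` [set` `[- M, M]%R].
Proof.
move=> M0; apply/seteqP; split => [[[a b] c]|[[a b] c]]; rewrite /cball3/=.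
  move=> h; have hi i := le_trans (le_coord (vec3 (a, b, c)) i) h.
  move: (hi 0) (hi 1) (hi 2%:R); rewrite !mxE/= !ler_norml => h1 h2 h3.
  by split; [split|]; rewrite /= in_itv.
move=> [[/=]]; rewrite !in_itv/= -!ler_norml => h1 h2 h3.
by apply: norm_le_coord => // i; rewrite mxE; case: i => -[|[|[|//]]] ?.
Qed.

Lemma leb3_cball3 (R : realType) (M : R) : 0 < M ->
  leb3 R (cball3 M) = (8 * M ^+ 3)%:E.
Proof.
move=> M0; rewrite cball3E ?(ltW M0)// leb3_cube lebesgue_measure_itv/=.
have h : (- M < M) by lra.
by rewrite lte_fin h -!EFinD -!EFinM; congr EFin; ring.
Qed.

Definition cballx (R : realType) (x : 'rV[R]_3) (M : R) : set (E3 R) :=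
  [set p | `|vec3 p - x| <= M].

Lemma cballxE (R : realType) (x : 'rV[R]_3) (M : R) :
  cballx x M = (fun p : E3 R => p + unvec (- x)) @^-1` (cball3 M).
Proof. by apply/seteqP; split => p; rewrite /cballx /cball3/= vec3D vec3_unvec. Qed.

Lemma measurable_cballx (R : realType) (x : 'rV[R]_3) (M : R) : measurable (cballx x M).
Proof.
have [mphi _] := mpres_shift3 (unvec (- x)).
rewrite cballxE -[X in measurable X]setTI; apply: mphi => //; exact: measurable_cball3.
Qed.

Lemma leb3_cballx (R : realType) (x : 'rV[R]_3) (M : R) : 0 < M ->
  leb3 R (cballx x M) = (8 * M ^+ 3)%:E.
Proof.
move=> M0; have [_ h] := mpres_shift3 (unvec (- x)).
have <- := leb3_cball3 M0.
by rewrite cballxE; apply: h; exact: measurable_cball3.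
Qed.

Lemma compact_ball3 (R : realType) (M : R) : compact [set y : 'rV[R]_3 | `|y| <= M].
Proof.
apply: bounded_closed_compact.
  by exists M; split; [exact: num_real|move=> r Mr y /= yM; rewrite (le_trans yM)// ltW].
have h : closed ((fun y : 'rV[R]_3 => `|y|) @^-1` [set r : R | r <= M]).
  apply: closed_comp => [y _|]; [exact: norm_continuous|exact: closed_le].
exact: h.
Qed.

(** A truncated and regularised Newtonian potential centred at [x]. *)
Definition green (R : realType) (e : R) (x y : 'rV[R]_3) : R :=
  cutoff (sqn (y - x)) * npow e (sqn (y - x)).

Definition peak (R : realType) (e : R) (x y : 'rV[R]_3) : R :=
  3 * e * (cutoff (sqn (y - x)) * npow5 e (sqn (y - x))).

Definition shell (R : realType) (e : R) (x y : 'rV[R]_3) : R :=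
  \sum_(j < 3) 'D_(evec R j) ('D_(evec R j) (green e x)) y + peak e x y.

(** What is left of the Laplacian of [green] once its singular part is removed:
every term contains a derivative of the cutoff, hence lives on 1 <= s <= 4. *)
Definition shell1 (R : realType) (e s : R) : R :=
  6 * (cutoff1 s * npow e s) + 4 * s * (cutoff2 s * npow e s) +
  8 * s * (cutoff1 s * npow1 e s).

Lemma smooth_sqnD_powR (R : realType) (e a : R) (x : 'rV[R]_3) : 0 < e ->
  smooth (fun y => (sqn (y - x) + e) `^ a).
Proof.
move=> e0; apply: smooth_powR => [|y]; last by rewrite ltr_wpDl ?sqn_ge0.
by apply: smoothD; [exact: smooth_sqnB|exact: smooth_cst].
Qed.

Lemma smooth_cutoff (R : realType) (x : 'rV[R]_3) : smooth (fun y => cutoff (sqn (y - x))).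
Proof.
apply: smooth_step; apply: smoothM; last exact: smooth_cst.
by apply: smoothB; [exact: smooth_cst|exact: smooth_sqnB].
Qed.

Lemma smooth_green (R : realType) (e : R) (x : 'rV[R]_3) : 0 < e -> smooth (green e x).
Proof. by move=> e0; apply: smoothM; [exact: smooth_cutoff|exact: smooth_sqnD_powR]. Qed.

Lemma smooth_peak (R : realType) (e : R) (x : 'rV[R]_3) : 0 < e -> smooth (peak e x).
Proof.
move=> e0; apply: smoothM; first exact: smooth_cst.
by apply: smoothM; [exact: smooth_cutoff|exact: smooth_sqnD_powR].
Qed.

Lemma smooth_shell (R : realType) (e : R) (x : 'rV[R]_3) : 0 < e -> smooth (shell e x).
Proof.
move=> e0; apply: smoothD; last exact: smooth_peak.
by apply: smooth_sum => j; do 2 apply: smooth_derive; exact: smooth_green.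
Qed.

Lemma norm_sub_gt (R : realType) (x y : 'rV[R]_3) : `|x| + 2 < `|y| -> 2 < `|y - x|.
Proof.
move=> h; rewrite -(ltrD2l `|x|) (lt_le_trans h)// -[X in `|X| <= _](subrK x).
by rewrite addrC (le_trans (ler_normD _ _)).
Qed.

Lemma sqn_gt4 (R : realType) (z : 'rV[R]_3) : 2 < `|z| -> 4 < sqn z.
Proof. by move=> h; apply: (lt_le_trans _ (norm_sqn z)); rewrite expr2; nra. Qed.

Lemma cutoff_far (R : realType) (z : 'rV[R]_3) : 2 < `|z| -> cutoff (sqn z) = 0.
Proof. by move=> /sqn_gt4/ltW; exact: cutoff_out. Qed.

Lemma test_ball (R : realType) (x : 'rV[R]_3) (f : 'rV[R]_3 -> R) :
  smooth f -> (forall y, 2 < `|y - x| -> f y = 0) -> test_function setT f.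
Proof.
move=> sf f0; split=> //; exists [set y | `|y| <= `|x| + 2]; split=> //.
  exact: compact_ball3.
by move=> y /negP; rewrite -ltNge => /norm_sub_gt/f0.
Qed.

Lemma green_far (R : realType) (e : R) (x y : 'rV[R]_3) : 2 < `|y - x| -> green e x y = 0.
Proof. by move=> h; rewrite /green cutoff_far// mul0r. Qed.

Lemma peak_far (R : realType) (e : R) (x y : 'rV[R]_3) : 2 < `|y - x| -> peak e x y = 0.
Proof. by move=> h; rewrite /peak cutoff_far// mul0r mulr0. Qed.

(** The Laplacian of (|z|^2 + e)^(-1/2) is -3e (|z|^2 + e)^(-5/2), so that
[peak] concentrates at [x] as e tends to 0, while what the cutoff adds stays
bounded and away from [x]. *)
Lemma shellE (R : realType) (e : R) (x y : 'rV[R]_3) : 0 < e ->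
  shell e x y = shell1 e (sqn (y - x)).
Proof.
move=> e0; rewrite /shell.
have se (s : R) : 0 <= s -> 0 < s + e by move=> s0; rewrite ltr_wpDl.
have d1 (s : R) : 0 <= s -> is_derive s 1 (fun s => cutoff s * npow e s)
    (cutoff1 s * npow e s + cutoff s * npow1 e s).
  by move=> s0; apply: is_deriveM_fun; [exact: is_derive_cutoff0|exact/is_derive_npow/se].
have d2 (s : R) : 0 <= s -> is_derive s 1 (fun s => cutoff1 s * npow e s + cutoff s * npow1 e s)
    (cutoff2 s * npow e s + cutoff1 s * npow1 e s +
      (cutoff1 s * npow1 e s + cutoff s * npow2 e s)).
  move=> s0; apply: is_deriveD_fun; apply: is_deriveM_fun.
  - exact: is_derive_cutoff1.
  - exact/is_derive_npow/se.
  - exact: is_derive_cutoff0.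
  - exact/is_derive_npow1/se.
have := radial_laplacian x d1 d2 y.
rewrite /green => ->; rewrite /peak /shell1.
have q0 := sqn_ge0 (y - x); move: (sqn (y - x)) q0 => q q0.
rewrite !(npow1E (se q q0)) /npow2; by field.
Qed.

Lemma shell1_bounded (R : realType) : exists2 C : R, 0 <= C &
  forall e s, 0 < e -> `|shell1 e s| <= C.
Proof.
have [D1 D10 h1] := cont_supp_bounded (@segment_compact R 0 1) (@continuous_dstep R) (@dstep_off R).
have [D2 D20 h2] := cont_supp_bounded (@segment_compact R 0 1) (@continuous_ddstep R) (@ddstep_off R).
exists (6 * D1 + 16 * D2 + 32 * D1); first by rewrite !addr_ge0// mulr_ge0.
move=> e s e0; have [s14|/cutoff12_off[c1 c2]] := boolP (1 <= s <= 4); last first.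
  by rewrite /shell1 c1 c2 !mul0r !mulr0 !addr0 normr0 !addr_ge0// mulr_ge0.
case/andP : s14 => s1 s4.
have se1 : 1 <= s + e by lra.
have n0 : `|npow e s| <= 1.
  by rewrite ger0_norm ?powR_ge0// npow_le1// invr_ge0.
have n1 : `|npow1 e s| <= 1.
  rewrite normrM normrN (@ger0_norm _ 2^-1) ?invr_ge0//.
  rewrite (@ger0_norm _ (_ `^ _)) ?powR_ge0//.
  have : (s + e) `^ (- 2^-1 - 1) <= 1 by rewrite -opprD npow_le1// addr_ge0// invr_ge0.
  by have := powR_ge0 (s + e) (- 2^-1 - 1); lra.
have c1 : `|cutoff1 s| <= D1.
  rewrite normrM normrN (@ger0_norm _ 3^-1) ?invr_ge0//.
  by have := h1 ((4 - s) / 3); have := normr_ge0 (dstep ((4 - s) / 3)); lra.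
have c2 : `|cutoff2 s| <= D2.
  rewrite !normrM normrN (@ger0_norm _ 3^-1) ?invr_ge0//.
  by have := h2 ((4 - s) / 3); have := normr_ge0 (ddstep ((4 - s) / 3)); lra.
have t1 : `|cutoff1 s * npow e s| <= D1 by rewrite normrM -[D1]mulr1 ler_pM.
have t2 : `|cutoff2 s * npow e s| <= D2 by rewrite normrM -[D2]mulr1 ler_pM.
have t3 : `|cutoff1 s * npow1 e s| <= D1 by rewrite normrM -[D1]mulr1 ler_pM.
rewrite /shell1 (le_trans (ler_normD _ _))// lerD//.
  rewrite (le_trans (ler_normD _ _))// lerD//.
    by rewrite normrM ger0_norm// ler_wpM2l.
  rewrite normrM; apply: ler_pM => //.
  by rewrite ger0_norm ?mulr_ge0 ?(le_trans _ s1)//; lra.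
rewrite normrM; apply: ler_pM => //.
by rewrite ger0_norm ?mulr_ge0 ?(le_trans _ s1)//; lra.
Qed.

Lemma shell_far (R : realType) (e : R) (x y : 'rV[R]_3) : 0 < e ->
  2 < `|y - x| -> shell e x y = 0.
Proof.
move=> e0 h; rewrite shellE// /shell1.
have [|-> ->] := @cutoff12_off R (sqn (y - x)).
  by rewrite negb_and -!ltNge sqn_gt4// orbT.
by rewrite !mul0r !mulr0 !addr0.
Qed.

Lemma L2norm_green (R : realType) (e : R) (x : 'rV[R]_3) : 0 < e ->
  (L2norm (green e x) <= ((12 ^+ 3) `^ 2^-1)%:E)%E.
Proof.
move=> e0; apply: (@L2norm_le _ (green e x) (12 ^+ 3)); first exact: exprn_ge0.
have e30 : 0 < e / 3 by rewrite divr_gt0.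
have := kernel_sq_integral x e30; have -> : 3 * (e / 3) = e by field.
apply: le_trans.
apply: (@le_integral_supp _ _ _ (leb3 R) (cballx x 2) (fun p => green e x (vec3 p) ^+ 2)
  (fun p => (sqn (vec3 p - x) + e) `^ (-1))).
- exact: measurable_cballx.
- apply: (@measurable_vec3 _ (fun y => green e x y * green e x y)).
  by apply: continuous_mul; exact: smooth_continuous (smooth_green _ e0).
- exact: (measurable_vec3 (smooth_continuous (smooth_sqnD_powR (-1) x e0))).
- by move=> p; exact: sqr_ge0.
- move=> p /negP; rewrite -ltNge => h; rewrite green_far// expr2 mul0r.
    by [].
- move=> p _; rewrite /green /npow exprMn expr2 -[leRHS]mul1r.
  set q := sqn _; have qe : 0 < q + e by rewrite ltr_wpDl ?sqn_ge0.
  have -> : ((q + e) `^ (- 2^-1)) ^+ 2 = (q + e) `^ (-1).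
    by rewrite expr2 -powR_split//; congr (_ `^ _); by field.
  apply: ler_wpM2r; first exact: powR_ge0.
  by rewrite -[leRHS]mulr1; apply: ler_pM; rewrite ?cutoff_ge0 ?cutoff_le1.
Qed.

Lemma L2norm_shell (R : realType) : exists2 C : R, 0 <= C &
  forall e (x : 'rV[R]_3), 0 < e -> (L2norm (shell e x) <= C%:E)%E.
Proof.
have [C C0 hC] := @shell1_bounded R.
exists ((C ^+ 2 * (8 * 2 ^+ 3)) `^ 2^-1); first exact: powR_ge0.
move=> e x e0; apply: L2norm_le; first by rewrite mulr_ge0 ?sqr_ge0.
apply: (@le_trans _ _ (\int[leb3 R]_(p in cballx x 2) (C ^+ 2)%:E)%E).
  apply: (@le_integral_supp _ _ _ (leb3 R) (cballx x 2) (fun p => shell e x (vec3 p) ^+ 2)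
    (fun p => C ^+ 2)).
  - exact: measurable_cballx.
  - apply: (@measurable_vec3 _ (fun y => shell e x y * shell e x y)).
    by apply: continuous_mul; exact: smooth_continuous (smooth_shell _ e0).
  - exact: measurable_cst.
  - by move=> p; exact: sqr_ge0.
  - move=> p /negP; rewrite -ltNge => h; rewrite shell_far// expr2 mul0r.
      by [].
  - move=> p _; rewrite -[leLHS](real_normK (num_real _)) lerXn2r ?nnegrE// shellE//.
    exact: hC.
rewrite integral_cst; last exact: measurable_cballx.
by rewrite [X in (_ * X)%E](leb3_cballx x)// -EFinM.
Qed.

Lemma peak_ge0 (R : realType) (e : R) (x y : 'rV[R]_3) : 0 < e -> 0 <= peak e x y.
Proof.
move=> e0; apply: mulr_ge0; first by rewrite mulr_ge0// ltW.
by apply: mulr_ge0; [exact: cutoff_ge0|exact: powR_ge0].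
Qed.

(* On the cube of radius h, sqn z + h^2 <= 4 h^2 = (2h)^2. *)
Lemma peak_near (R : realType) (h : R) (x y : 'rV[R]_3) : 0 < h -> h <= 2^-1 ->
  `|y - x| <= h -> 3 / 32 / h ^+ 3 <= peak (h ^+ 2) x y.
Proof.
move=> h0 h1 yx.
have q3 : sqn (y - x) <= 3 * h ^+ 2.
  rewrite (le_trans (sqn_norm _))// ler_wpM2l// lerXn2r ?nnegrE// ltW//.
have q0 := sqn_ge0 (y - x).
have h2 : h ^+ 2 <= 4^-1 by rewrite expr2; nra.
have hh : 0 < h ^+ 2 by rewrite exprn_gt0.
rewrite /peak cutoff_in ?mul1r; last by lra.
have : (2 * h) ^- 5 <= npow5 (h ^+ 2) (sqn (y - x)).
  rewrite /npow5; have -> : - 2^-1 - 1 - 1 = - (2^-1 + 2) :> R by ring.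
  have se : 0 < sqn (y - x) + h ^+ 2 by rewrite ltr_wpDl.
  rewrite powRN lef_pV2 ?posrE ?powR_gt0 ?exprn_gt0 ?mulr_gt0//.
  have -> : (2 * h) ^+ 5 = (4 * h ^+ 2) `^ (2^-1 + 2).
    have -> : 4 * h ^+ 2 = (2 * h) `^ 2 by rewrite powR_mulrn ?mulr_ge0 ?ltW//; ring.
    rewrite -powRrM -powR_mulrn ?mulr_ge0 ?(ltW h0)//; congr (_ `^ _); by field.
  by apply: ge0_ler_powR; rewrite ?nnegrE ?mulr_ge0 ?(ltW se) ?(ltW hh)//; lra.
move=> hn; apply: (@le_trans _ _ (3 * h ^+ 2 * (2 * h) ^- 5)).
  by rewrite le_eqVlt; apply/orP; left; apply/eqP; field; rewrite gt_eqF.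
by rewrite ler_wpM2l// mulr_ge0// ltW.
Qed.

Lemma peak_outside (R : realType) (e r : R) (x y : 'rV[R]_3) : 0 < e -> 0 < r ->
  r < `|y - x| -> peak e x y <= 3 * e * r ^- 5.
Proof.
move=> e0 r0 ry; rewrite /peak ler_wpM2l ?mulr_ge0 ?(ltW e0)//.
rewrite -[leRHS]mul1r; apply: ler_pM; rewrite ?cutoff_ge0 ?powR_ge0 ?cutoff_le1//.
have q2 : r ^+ 2 < sqn (y - x).
  by apply: lt_le_trans (norm_sqn _); rewrite ltrXn2r// ltW.
rewrite /npow5; have -> : - 2^-1 - 1 - 1 = - (2^-1 + 2) :> R by ring.
have se : 0 < sqn (y - x) + e by rewrite ltr_wpDl ?sqn_ge0.
rewrite powRN lef_pV2 ?posrE ?powR_gt0 ?exprn_gt0//.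
have -> : r ^+ 5 = (r ^+ 2) `^ (2^-1 + 2).
  rewrite -!powR_mulrn ?sqr_ge0 ?(ltW r0)// -powRrM; congr (_ `^ _); by field.
by apply: ge0_ler_powR; rewrite ?nnegrE ?sqr_ge0 ?(ltW se)//; lra.
Qed.

Lemma int3Zl (R : realType) (c : R) (f : 'rV[R]_3 -> R) :
  (leb3 R).-integrable setT (EFin \o (f \o @vec3 R)) ->
  int3 (fun x => c * f x) = c * int3 f.
Proof. by move=> hf; rewrite /int3 -RintegralZl. Qed.

Lemma int3D (R : realType) (f g : 'rV[R]_3 -> R) :
  (leb3 R).-integrable setT (EFin \o (f \o @vec3 R)) ->
  (leb3 R).-integrable setT (EFin \o (g \o @vec3 R)) ->
  int3 (fun x => f x + g x) = int3 f + int3 g.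
Proof. by move=> hf hg; rewrite /int3 -RintegralD. Qed.

Lemma integrable3D (R : realType) (f g : 'rV[R]_3 -> R) :
  (leb3 R).-integrable setT (EFin \o (f \o @vec3 R)) ->
  (leb3 R).-integrable setT (EFin \o (g \o @vec3 R)) ->
  (leb3 R).-integrable setT (EFin \o ((fun x => f x + g x) \o @vec3 R)).
Proof. by move=> hf hg; have := integrableD measurableT hf hg; apply. Qed.

Lemma leb3_indic (R : realType) (x : 'rV[R]_3) (M c : R) : 0 < M ->
  (leb3 R).-integrable setT (EFin \o (fun p : E3 R => c * \1_(cballx x M) p)) /\
  Rintegral (leb3 R) setT (fun p : E3 R => c * \1_(cballx x M) p) = c * (8 * M ^+ 3).
Proof.
move=> M0; have mB := measurable_cballx x M; have hB := leb3_cballx x M0.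
have ii : (leb3 R).-integrable setT (EFin \o (\1_(cballx x M) : E3 R -> R)).
  apply: (@integrable_bounded _ _ _ (leb3 R) (cballx x M) 1) => //.
  - by rewrite [ltLHS]hB ltry.
  - by move=> p; rewrite indicE; case: (_ \in _); rewrite ?normr1 ?normr0.
  - by move=> p np; rewrite indicE memNset.
split; first by have := integrableZl measurableT c ii; apply.
rewrite RintegralZl//; congr (_ * _).
rewrite /Rintegral integral_indic// setIT.
by rewrite [X in fine X]hB.
Qed.

Lemma continuous_eps (R : realType) (V : normedModType R) (f : V -> R) x (e : R) :
  continuous f -> 0 < e ->
  exists2 d : R, 0 < d & forall y, `|y - x| < d -> `|f x - f y| <= e.
Proof.
move=> cf e0; have /cvgrPdist_le/(_ e e0) := cf x.
move=> /nbhs_normP[d /= d0 hd]; exists d => // y hy.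
by apply: hd; rewrite /= distrC.
Qed.

Lemma mulr_move2 (R : realType) (a b c d e : R) : a * b * c * d * e = a * c * d * e * b.
Proof. by ring. Qed.

Lemma norm_add3_le (R : realType) (a b c d : R) :
  `|a| <= d -> `|b| <= d -> `|c| <= d -> `|a + b + c| <= 3 * d.
Proof.
by rewrite !ler_norml => /andP[? ?] /andP[? ?] /andP[? ?]; apply/andP; split; lra.
Qed.

Lemma solve_last (R : realType) (a b p : R) : a = b + p -> p = a - b.
Proof. by move=> ->; ring. Qed.

Lemma half_le (R : realType) (m s : R) : `|m - s| <= m / 2 -> m / 2 <= s.
Proof. by rewrite ler_norml => /andP[_]; lra. Qed.

Lemma small_square (R : realType) (D h r t : R) : 0 <= D -> 0 < h -> h <= r ->
  r <= 2^-1 -> h <= t / (D + 1) -> D * h ^+ 2 <= t.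
Proof.
move=> D0 h0 hr r1; rewrite ler_pdivlMr ?ltr_wpDl// => ht.
have : h ^+ 2 <= h by rewrite expr2 ler_piMr ?(ltW h0)//; lra.
by nra.
Qed.

(** By [shellE], f paired with [peak] is f paired with [shell] minus f paired with
the Laplacian of [green]; both move to the L^2 functions g0 and g_j and are
bounded, uniformly in e, by the L^2 norms of [shell] and [green]. As e tends to
0, [peak] concentrates at x with a mass bounded below, so f(x) is bounded too. *)
Lemma sobolev (R : realType) : exists2 C : R, 0 < C &
  forall (f g0 : 'rV[R]_3 -> R) (g : 'I_3 -> 'rV[R]_3 -> R) (N : R),
  continuous f -> L2 g0 -> (forall j, L2 (g j)) ->
  (forall phi, test_function setT phi ->
    int3 (fun x => f x * phi x) = int3 (fun x => g0 x * phi x)) ->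
  (forall j phi, test_function setT phi ->
    int3 (fun x => f x * 'D_(evec R j) ('D_(evec R j) phi) x) =
    int3 (fun x => g j x * phi x)) ->
  (L2norm g0 <= N%:E)%E -> (forall j, L2norm (g j) <= N%:E)%E ->
  forall x, `|f x| <= C * N.
Proof.
have [A A0 hA] := @L2norm_shell R.
pose G : R := (12 ^+ 3) `^ 2^-1.
have G0 : 0 <= G by exact: powR_ge0.
exists (8 / 3 * (A + 3 * G + 1)); first by rewrite mulr_gt0// ltr_wpDl// addr_ge0// mulr_ge0.
move=> f g0 g N cf L0 Lg hf0 hfg hN0 hNg x.
have N0 : 0 <= N by rewrite -lee_fin (le_trans (L2norm_ge0 g0)).
have intc (phi : 'rV[R]_3 -> R) : continuous phi -> (forall y, 2 < `|y - x| -> phi y = 0) ->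
    (leb3 R).-integrable setT (EFin \o ((fun y => f y * phi y) \o @vec3 R)).
  move=> cphi phi0; apply: (@integrable3 _ _ [set y | `|y| <= `|x| + 2]).
  - exact: compact_ball3.
  - exact: continuous_mul.
  - by move=> y /negP; rewrite -ltNge => /norm_sub_gt/phi0 ->; rewrite mulr0.
have pair (h phi : 'rV[R]_3 -> R) (c : R) : L2 h -> (L2norm h <= N%:E)%E -> continuous phi ->
    (L2norm phi <= c%:E)%E -> `|int3 (fun y => h y * phi y)| <= N * c.
  move=> Lh hN cphi hc.
  have [_ hb] := L2_pairing Lh (measurable_vec3 cphi) (le_lt_trans hc (ltry _)).
  rewrite -lee_fin (le_trans hb)// EFinM; apply: lee_pmul => //; exact: L2norm_ge0.
(* the pairing of f with the peak is controlled uniformly in the width of the peak *)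
have upper e : 0 < e -> `|int3 (fun y => f y * peak e x y)| <= (A + 3 * G) * N.
  move=> e0.
  have cg := smooth_continuous (smooth_green x e0).
  have cD j : continuous ('D_(evec R j) ('D_(evec R j) (green e x))).
    by do 2 apply: smooth_continuous (smooth_derive _ _) || apply: smooth_derive;
      exact: smooth_green.
  have cK := @compact_ball3 R (`|x| + 2).
  have tg : test_function setT (green e x).
    by apply: (test_ball (x := x)); [exact: smooth_green|exact: green_far].
  have ts : test_function setT (shell e x).
    by apply: (test_ball (x := x)); [exact: smooth_shell|move=> y; exact: shell_far].
  have D0 j y : 2 < `|y - x| -> 'D_(evec R j) ('D_(evec R j) (green e x)) y = 0.
    move=> hy; have far : \forall z \near y, 2 < `|z - x|.
      have h : continuous (fun z : 'rV[R]_3 => `|z - x|).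
        move=> z; apply: continuous_comp; [exact: continuous_subr|exact: norm_continuous].
      by have := h y; move/cvgr_gt; apply.
    have d0 (F : 'rV[R]_3 -> R) : (forall z, 2 < `|z - x| -> F z = 0) ->
        forall z, 2 < `|z - x| -> 'D_(evec R j) F z = 0.
      move=> F0 z hz; have hc : is_derive z (evec R j) F 0.
        apply: (@near_eq_is_derive _ _ _ (cst 0)).
        have h : continuous (fun z : 'rV[R]_3 => `|z - x|).
          move=> w; apply: continuous_comp; [exact: continuous_subr|exact: norm_continuous].
        by have := h z; move/cvgr_gt => /(_ _ hz); apply: filterS => w /F0.
      by have /@derive_val := hc.
    by apply: (d0) hy; apply: d0; exact: green_far.
  have iD j := intc _ (cD j) (D0 j).
  have ip := intc _ (smooth_continuous (smooth_peak x e0)) (@peak_far R e x).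
  have es : int3 (fun y => f y * shell e x y) =
      (int3 (fun y => f y * 'D_(evec R 0) ('D_(evec R 0) (green e x)) y) +
       int3 (fun y => f y * 'D_(evec R 1) ('D_(evec R 1) (green e x)) y) +
       int3 (fun y => f y * 'D_(evec R 2%:R) ('D_(evec R 2%:R) (green e x)) y)) +
       int3 (fun y => f y * peak e x y).
    rewrite -int3D// -int3D//; last exact: integrable3D.
    rewrite -int3D//; last exact: integrable3D (integrable3D (iD 0) (iD 1)) (iD 2%:R).
    congr int3; apply/funext => y; rewrite /shell !big_ord_recr big_ord0/=.
    have -> : widen_ord (leqnSn 2) (widen_ord (leqnSn 1) ord_max) = 0 :> 'I_3 by apply/val_inj.
    have -> : widen_ord (leqnSn 2) ord_max = 1 :> 'I_3 by apply/val_inj.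
    have -> : ord_max = 2%:R :> 'I_3 by apply/val_inj.
    by rewrite add0r !mulrDr.
  have es2 : int3 (fun y => g0 y * shell e x y) =
      (int3 (fun y => g 0 y * green e x y) + int3 (fun y => g 1 y * green e x y) +
       int3 (fun y => g 2%:R y * green e x y)) + int3 (fun y => f y * peak e x y).
    apply: (eq_trans (esym (hf0 _ ts))); apply: (eq_trans es).
    congr (_ + _ + _ + _); [exact: (hfg 0 _ tg)|exact: (hfg 1 _ tg)|exact: (hfg 2%:R _ tg)].
  rewrite (solve_last es2).
  have b0 := pair _ _ _ L0 hN0 (smooth_continuous (smooth_shell x e0)) (hA e x e0).
  have bg j := pair _ _ _ (Lg j) (hNg j) cg (L2norm_green x e0).
  rewrite (le_trans (ler_normB _ _))// [leRHS]mulrDl mulrC lerD//.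
  by apply: (le_trans (norm_add3_le (bg 0) (bg 1) (bg 2%:R))); rewrite -mulrA [N * _]mulrC.
(* If f x is not 0, then f keeps its sign and half its size on a ball of radius r. *)
have [->|fx0] := eqVneq (f x) 0.
  by rewrite normr0 mulr_ge0// mulr_ge0// addr_ge0// addr_ge0// mulr_ge0.
pose s := Num.sg (f x); pose m := `|f x|.
have m0 : 0 < m by rewrite normr_gt0.
have sm : s * f x = m by rewrite /s /m normrEsg.
have s1 : `|s| <= 1 by rewrite /s normr_sg fx0.
have [r [r0 r1 hr]] : exists r : R, [/\ 0 < r, r <= 2^-1 & forall y, `|y - x| <= r -> m / 2 <= s * f y].
  have h : continuous (fun y => s * f y).
    by apply: continuous_mul => //; exact: cst_continuous.
  have m2 : 0 < m / 2 by rewrite divr_gt0.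
  have [d d0 hd] := continuous_eps x h m2.
  exists (Num.min (d / 2) 2^-1); split; first by rewrite lt_min divr_gt0//= invr_gt0.
    by rewrite ge_min lexx orbT.
  move=> y yx; have : `|y - x| < d.
    rewrite (le_lt_trans yx)// gt_min.
    by apply/orP; left; rewrite ltr_pdivrMr// ltr_pMr// ltr1n.
  by move=> /hd; rewrite sm /=; exact: half_le.
have [F F0 hF] : exists2 F : R, 0 <= F & forall y, `|y| <= `|x| + 2 -> `|f y| <= F.
  have : compact (f @` [set y | `|y| <= `|x| + 2]).
    by apply: continuous_compact; [exact: continuous_subspaceT|exact: compact_ball3].
  move=> /compact_bounded[M [_ hM]]; exists (`|M| + 1); first by rewrite addr_ge0.
  by move=> y yx; apply: (hM _ _ (f y)); [rewrite ltr_pwDr// ler_norm|exists y].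
(* With e = h^2: on the cube of radius h the peak is at least 3/32 h^-3, which
   times the volume 8 h^3 and m/2 gives 3/8 m; between the cubes of radii h and r
   the integrand is nonnegative; beyond r the peak is O(h^2). *)
have lower h : 0 < h -> h <= r ->
    3 / 8 * m - 3 * h ^+ 2 * r ^- 5 * F * (8 * 2 ^+ 3) <= `|int3 (fun y => f y * peak (h ^+ 2) x y)|.
  move=> h0 hr'; have h2 : 0 < h ^+ 2 by rewrite exprn_gt0.
  have ip := intc _ (smooth_continuous (smooth_peak x h2)) (@peak_far R (h ^+ 2) x).
  apply: (@le_trans _ _ (s * int3 (fun y => f y * peak (h ^+ 2) x y))); last first.
    by rewrite (le_trans (ler_norm _))// normrM -[leRHS]mul1r ler_wpM2r.
  rewrite -int3Zl//.
  pose c1 := m / 2 * (3 / 32 / h ^+ 3); pose c2 := 3 * h ^+ 2 * r ^- 5 * F.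
  have c20 : 0 <= c2 by rewrite !mulr_ge0 ?invr_ge0 ?exprn_ge0 ?(ltW h0) ?(ltW r0).
  have [i1 e1] := leb3_indic x c1 h0.
  have [i2 e2] := leb3_indic x c2 (ltr0n R 2).
  apply: (@le_trans _ _ (Rintegral (leb3 R) setT
      (fun p : E3 R => c1 * \1_(cballx x h) p - c2 * \1_(cballx x 2) p))).
    rewrite RintegralB// e1 e2 /c2 lerB// le_eqVlt; apply/orP; left; apply/eqP.
    by rewrite /c1; field; rewrite gt_eqF.
  apply: le_Rintegral => //.
  - by have := integrableB measurableT i1 i2; apply.
  - by have := integrableZl measurableT s ip; apply.
  move=> p _ /=; set y := vec3 p.
  have pk0 := peak_ge0 x y h2.
  have [yh|yh] := leP `|y - x| h.
    have yr : `|y - x| <= r := le_trans yh hr'.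
    rewrite !indicE !mem_set//=; last by rewrite /cballx/= -/y (le_trans yr)//; lra.
    rewrite !mulr1 (@le_trans _ _ c1) ?gerBl// mulrA.
    apply: ler_pM; rewrite ?divr_ge0 ?(ltW m0) ?exprn_ge0 ?(ltW h0)//; first exact: hr.
    by apply: peak_near => //; exact: le_trans hr' r1.
  rewrite [X in c1 * X]indicE memNset ?mulr0 ?sub0r; last first.
    by rewrite /cballx /= -/y; apply/negP; rewrite -ltNge.
  have [y2|y2] := leP `|y - x| 2; last first.
    by rewrite peak_far// indicE memNset ?mulr0 ?oppr0// /cballx/= -/y; apply/negP; rewrite -ltNge.
  rewrite indicE mem_set// mulr1 mulrA.
  have [yr|yr] := leP `|y - x| r.
    apply: (@le_trans _ _ 0); first by rewrite oppr_le0.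
    by apply: mulr_ge0 => //; apply: le_trans (hr y yr); rewrite divr_ge0// ltW.
  rewrite lerNl -mulNr (le_trans (ler_norm _))// normrM normrN normrM /c2 [leRHS]mulrC.
  apply: ler_pM => //.
    rewrite -[leRHS]mul1r; apply: ler_pM => //; apply: hF.
    by rewrite -[y](subrK x) (le_trans (ler_normD _ _))// addrC lerD2l.
  by rewrite ger0_norm//; exact: peak_outside.
have : 3 / 8 * m <= (A + 3 * G) * N.
  apply/ler_addgt0Pr => t t0.
  pose D := 3 * r ^- 5 * F * (8 * 2 ^+ 3).
  have D0 : 0 <= D by rewrite !mulr_ge0 ?invr_ge0 ?exprn_ge0 ?(ltW r0).
  pose h := Num.min r (t / (D + 1)).
  have h0 : 0 < h by rewrite lt_min r0 divr_gt0// ltr_wpDl.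
  have hr' : h <= r by rewrite ge_min lexx.
  have ht : D * h ^+ 2 <= t.
    by apply: (small_square D0 h0 hr' r1); rewrite ge_min lexx orbT.
  have := le_trans (lower h h0 hr') (upper (h ^+ 2) (exprn_gt0 _ h0)).
  rewrite (_ : 3 * h ^+ 2 * r ^- 5 * F * (8 * 2 ^+ 3) = D * h ^+ 2).
    by rewrite lerBlDr => /le_trans; apply; rewrite lerD2l.
  by rewrite /D mulr_move2.
rewrite -/m -ler_pdivlMl ?divr_gt0// invf_div => /le_trans; apply.
rewrite -[leRHS]mulrA; apply: ler_wpM2l; first by rewrite divr_ge0.
by rewrite ler_wpM2r// lerDl.
Qed.

(** * Pointwise bounds for the elements of H^s *)

Lemma L2B (R : realType) (f g : 'rV[R]_3 -> R) : L2 f -> L2 g -> L2 (f \- g).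
Proof.
move=> hf hg.
have mf := L2_measurable hf; have mg := L2_measurable hg.
have mg' : measurable_fun (setT : set (E3 R)) (fun p => - (g (vec3 p))).
  by apply: measurableT_comp => //.
have mfg : measurable_fun (setT : set (E3 R)) ((f \- g) \o @vec3 R) by exact: measurable_funB.
rewrite /L2 inE/=; apply/andP; split; rewrite inE//=.
rewrite /finite_norm.
have -> : EFin \o ((f \- g) \o @vec3 R) =
    EFin \o ((f \o @vec3 R) \+ (fun p => - g (vec3 p))) by [].
have one2 : (1 <= 2%:R :> R) by rewrite ler1n.
have hm := @minkowski_EFin _ _ _ (leb3 R) (f \o @vec3 R) (fun p => - g (vec3 p)) _ mf mg' one2.
apply: (le_lt_trans hm); apply: lte_add_pinfty; first exact: L2_fin.
have := oppe_Lnorm (leb3 R) (EFin \o (g \o @vec3 R)) 2%:E.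
rewrite (_ : (\- (EFin \o (g \o @vec3 R)))%E = EFin \o (fun p => - g (vec3 p))) => [->|].
  exact: L2_fin.
by apply/funext => p /=; rewrite EFinN.
Qed.

Lemma test_iter (R : realType) (V : normedModType R) (U : set V) (phi : V -> R) l :
  test_function U phi -> test_function U (iter_deriv l phi).
Proof. by move=> h; elim: l => [//|v l IH] /=; exact: test_functionD. Qed.

Lemma test_L2 (R : realType) (phi : 'rV[R]_3 -> R) : test_function setT phi ->
  measurable_fun (setT : set (E3 R)) (phi \o @vec3 R) /\ (L2norm phi < +oo)%E.
Proof.
move=> [sphi [K [cK _ phi0]]]; have cphi := smooth_continuous sphi.
split; first exact: measurable_vec3.
have [C C0 hC] := cont_supp_bounded cK cphi phi0.
have ip : (leb3 R).-integrable setT (EFin \o ((fun x => phi x * phi x) \o @vec3 R)).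
  by apply: (integrable3 cK) => [|x /phi0 ->]; [exact: continuous_mul|rewrite mul0r].
pose I := int3 (fun x => phi x * phi x).
have I0 : 0 <= I by apply: Rintegral_ge0 => p _; exact: sqr_ge0.
apply: (@le_lt_trans _ _ (I `^ 2^-1)%:E); last exact: ltry.
apply: L2norm_le => //.
by rewrite /I /int3 /Rintegral fineK//; exact: integrable_fin_num.
Qed.

Lemma is_weak_derivB (R : realType) l (f1 f2 g1 g2 : 'rV[R]_3 -> R) :
  L2 f1 -> L2 f2 -> is_weak_deriv l f1 g1 -> is_weak_deriv l f2 g2 ->
  is_weak_deriv l (f1 \- f2) (g1 \- g2).
Proof.
move=> L1 L2' [Lg1 h1] [Lg2 h2]; split; first exact: L2B.
move=> phi tphi.
have lin (a b psi : 'rV[R]_3 -> R) : L2 a -> L2 b -> test_function setT psi ->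
    int3 (fun x => (a \- b) x * psi x) = int3 (fun x => a x * psi x) - int3 (fun x => b x * psi x).
  move=> La Lb /test_L2[mpsi fpsi].
  have [ia _] := L2_pairing La mpsi fpsi; have [ib _] := L2_pairing Lb mpsi fpsi.
  rewrite /int3 -RintegralB//; apply: eq_Rintegral => p _ /=.
  by rewrite mulrBl.
rewrite !lin//; last exact: test_iter.
by rewrite h1// h2// mulrBr.
Qed.

Lemma weak_derivP (R : realType) l (f : 'rV[R]_3 -> R) :
  (exists g, is_weak_deriv l f g) -> is_weak_deriv l f (weak_deriv l f).
Proof. by move=> [g hg]; apply: (@xgetPex _ (fun=> 0) [set g | is_weak_deriv l f g]); exists g. Qed.

Lemma Hnorm_ge (R : realType) (s : R) (f : 'rV[R]_3 -> R) (l : seq 'I_3) :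
  (size l <= Num.truncn s)%N -> (L2norm (weak_deriv l f) <= Hnorm s f)%E.
Proof.
move=> ls; set W := L2norm _.
have W0 : (0 <= W)%E by exact: L2norm_ge0.
have -> : W = ((W `^ 2) `^ 2^-1)%E by rewrite -poweRrM divff// poweRe1.
rewrite /Hnorm; set S := (\sum_(m < _) _)%E; set E := (if _ then _ else _)%E.
have S0 (m : nat) : (0 <= \sum_(l : m.-tuple 'I_3) L2norm (weak_deriv l f) `^ 2)%E.
  by apply: sume_ge0 => l' _; exact: poweR_ge0.
have WS : (W `^ 2 <= S)%E.
  have lt : (size l < (Num.truncn s).+1)%N by rewrite ltnS.
  rewrite /S (bigD1 (Ordinal lt))//= (bigD1 (in_tuple l))//=.
  rewrite -addeA leeDl// adde_ge0//; first by apply: sume_ge0 => *; exact: poweR_ge0.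
  by apply: sume_ge0 => m _; exact: S0.
have E0 : (0 <= E)%E.
  rewrite /E; case: ifP => // _; apply: sume_ge0 => l' _; apply: integral_ge0 => z _.
  by rewrite lee_fin divr_ge0 ?sqr_ge0 ?powR_ge0.
apply: gt0_ler_poweR; rewrite ?in_itv/= ?leey ?poweR_ge0//.
- by rewrite andbT adde_ge0// (le_trans _ WS)// poweR_ge0.
- by rewrite (le_trans WS)// leeDl.
Qed.

Lemma sobolev_H2 (R : realType) : exists2 C : R, 0 < C &
  forall (s : R) (f : 'rV[R]_3 -> R) (N : R), 2 <= s -> continuous f ->
  (forall l : seq 'I_3, (size l <= 2)%N -> exists g, is_weak_deriv l f g) ->
  (Hnorm s f <= N%:E)%E -> forall x, `|f x| <= C * N.
Proof.
have [C C0 hC] := @sobolev R; exists C => // s f N s2 cf wf HN.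
have ts : (2 <= Num.truncn s)%N by rewrite truncn_ge_nat// (le_trans _ s2).
have w0 := weak_derivP (wf [::] isT).
have w2 j := weak_derivP (wf [:: j; j] isT).
apply: (hC f (weak_deriv [::] f) (fun j => weak_deriv [:: j; j] f) N cf).
- by case: w0.
- by move=> j; case: (w2 j).
- by move=> phi tphi; have [_ /(_ phi tphi)] := w0; rewrite expr0 mul1r.
- by move=> j phi tphi; have [_ /(_ phi tphi)] := w2 j; rewrite sqrrN expr1n mul1r.
- by apply: (le_trans _ HN); apply: Hnorm_ge.
- by move=> j; apply: (le_trans _ HN); apply: Hnorm_ge.
Qed.

(** The weak derivatives of the classical derivative D_k f are those of f with one
more index, by integration by parts; three derivatives of f thus bound D_k f. *)
Lemma sobolev_grad (R : realType) : exists2 C : R, 0 < C &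
  forall (f : 'rV[R]_3 -> R) (N : R), C1 f -> Hspace 3 f -> (Hnorm 3 f <= N%:E)%E ->
  forall k x, `|'D_(evec R k) f x| <= C * N.
Proof.
have [C C0 hC] := @sobolev R; exists C => // f N fC [Lf wf _] HN k.
have t3 : Num.truncn (3 : R) = 3%N by rewrite natrK.
have w1 : is_weak_deriv [:: k] f (weak_deriv [:: k] f) by apply/weak_derivP/wf; rewrite t3.
have w3 j : is_weak_deriv [:: k; j; j] f (weak_deriv [:: k; j; j] f).
  by apply/weak_derivP/wf; rewrite t3.
apply: (hC ('D_(evec R k) f) (weak_deriv [:: k] f) (fun j => weak_deriv [:: k; j; j] f) N).
- exact: (fC.2 _).2.
- by case: w1.
- by move=> j; case: (w3 j).
- move=> phi tphi; have [_ /(_ phi tphi)] := w1; rewrite expr1 mulN1r /=.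
  by rewrite (int3_parts _ fC tphi) => /oppr_inj.
- move=> j phi tphi; have [_ /(_ phi tphi)] := w3 j; rewrite exprS sqrrN expr1n mulr1 mulN1r /=.
  have t2 := test_functionD (evec R j) (test_functionD (evec R j) tphi).
  by rewrite (int3_parts _ fC t2) => /oppr_inj.
- by apply: (le_trans _ HN); apply: Hnorm_ge; rewrite t3.
- by move=> j; apply: (le_trans _ HN); apply: Hnorm_ge; rewrite t3.
Qed.

Definition unif_time_cont (R : realType) (V : Type) (F : R -> V -> R) : Prop :=
  forall t e : R, 0 < e -> exists2 d : R, 0 < d &
    forall r : R, `|r - t| < d -> forall x, `|F r x - F t x| <= e.

(** Freezing a solution outside [0, T] makes it a function on the whole of
R * R^3, so that continuity needs no restriction to a strip. *)
Definition clamp (R : realType) (T t : R) : R := Num.max 0 (Num.min t T).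

Lemma clamp_in (R : realType) (T t : R) : 0 <= T -> clamp T t \in `[0, T].
Proof.
by move=> T0; rewrite in_itv/= /clamp le_max lexx/= ge_max T0/= ge_min lexx orbT.
Qed.

Lemma clamp_id (R : realType) (T t : R) : t \in `[0, T] -> clamp T t = t.
Proof. by rewrite in_itv/= /clamp => /andP[t0 tT]; rewrite min_l// max_r. Qed.

Lemma max_lip (R : realType) (a b c : R) :
  `|Num.max c a - Num.max c b| <= `|a - b|.
Proof.
have h1 := ler_norm (a - b); have h2 := ler_norm (b - a); rewrite distrC in h2.
have h3 := normr_ge0 (a - b).
by case: (leP c a) => ?; case: (leP c b) => ?; rewrite ler_norml; apply/andP; split; lra.
Qed.

Lemma nbhs_ereal0_le (R : realType) (c : R) : 0 < c ->
  nbhs (0%E : \bar R) [set y : \bar R | (y <= c%:E)%E].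
Proof.
move=> c0; apply/nbhs_EFin; near=> z; rewrite /= lee_fin ltW//; near: z; exact: lt_nbhsl.
Unshelve. all: by end_near. Qed.

Lemma clamp_lip (R : realType) (T t r : R) : 0 <= T -> `|clamp T r - clamp T t| <= `|r - t|.
Proof.
move=> T0; apply: (le_trans (max_lip _ _ _)); rewrite ![Num.min _ T]minC.
have h1 := ler_norm (r - t); have h2 := ler_norm (t - r); rewrite distrC in h2.
have h3 := normr_ge0 (r - t).
by case: (leP T r) => ?; case: (leP T t) => ?; rewrite ler_norml; apply/andP; split; lra.
Qed.

Lemma continuous_sub (R : realType) (V : topologicalType) (f g : V -> R) :
  continuous f -> continuous g -> continuous (f \- g).
Proof. by move=> cf cg x; apply: cvgB; [exact: cf|exact: cg]. Qed.

(** The pointwise bound of [sobolev_H2] applied to the difference of two times. *)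
Lemma CtH_unif (R : realType) (T s : R) (F : R -> 'rV[R]_3 -> R) : 0 <= T -> 2 <= s ->
  CtH T s F -> (forall t, t \in `[0, T] -> continuous (F t)) ->
  unif_time_cont (fun t => F (clamp T t)).
Proof.
move=> T0 s2 hF cF t e e0.
have ts : (2 <= Num.truncn s)%N by rewrite truncn_ge_nat// (le_trans _ s2).
have [C C0 hC] := @sobolev_H2 R.
have tT := clamp_in t T0; have [[Lt wt _] ct] := hF _ tT.
have eC : 0 < e / C by rewrite divr_gt0.
have near0 : \forall r \near within `[0, T] (nbhs (clamp T t)),
    (Hnorm s (F r \- F (clamp T t))%R <= (e / C)%:E)%E.
  exact: (ct _ (nbhs_ereal0_le eC)).
move: near0 => /nbhs_normP[d /= d0 hd].
exists d => // r rd x.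
have rT := clamp_in r T0; have [[Lr wr _] _] := hF _ rT.
have h1 : (Hnorm s (F (clamp T r) \- F (clamp T t))%R <= (e / C)%:E)%E.
  apply: hd => //=; rewrite distrC; exact: le_lt_trans (clamp_lip _ _ T0) rd.
have := hC s (F (clamp T r) \- F (clamp T t)) (e / C) s2 _ _ h1 x.
rewrite mulrC divfK ?gt_eqF//; apply.
- exact: (continuous_sub (cF _ rT) (cF _ tT)).
- move=> l ll; have l2 := leq_trans ll ts.
  have [g1 hg1] := wr l l2; have [g2 hg2] := wt l l2.
  by exists (g1 \- g2); exact: is_weak_derivB.
Qed.

(** A null set contains no interval. *)
Lemma ae_dense (R : realType) (T : R) (P : R -> Prop) : 0 < T ->
  {ae @lebesgue_measure R, forall t, t \in `[0, T] -> P t} ->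
  forall (t d : R), t \in `[0, T] -> 0 < d ->
  exists r : R, [/\ r \in `[0, T], `|r - t| < d & P r].
Proof.
move=> T0 [N [mN N0 hN]] t d; rewrite in_itv/= => /andP[t0 tT] d0.
apply: contrapT => hn.
pose a := Num.max 0 (t - d); pose b := Num.min T (t + d).
have ab : a < b.
  by rewrite /a /b lt_min !gt_max T0/=; apply/andP; split; [|apply/andP; split]; lra.
have sub : `]a, b[%classic `<=` N.
  move=> r /=; rewrite in_itv/= /a /b gt_max lt_min => /andP[/andP[r0 r1] /andP[r2 r3]].
  apply: hN => /= hr; apply: hn; exists r; split.
  - by rewrite in_itv/= !ltW.
  - by rewrite ltr_norml; apply/andP; split; lra.
  - by apply: hr; rewrite in_itv/= !ltW.
have : (@lebesgue_measure R `]a, b[%classic <= @lebesgue_measure R N)%E.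
  by apply: le_measure => //; rewrite inE//; exact: measurable_itv.
rewrite N0 lebesgue_measure_itv/= lte_fin ab -EFinB lee_fin; lra.
Qed.

Lemma joint_continuous (R : realType) (V : normedModType R) (F : R -> V -> R) :
  (forall t, continuous (F t)) -> unif_time_cont F ->
  continuous (fun z : R * V => F z.1 z.2).
Proof.
move=> cF uF [t x]; apply/cvgrPdist_le => e e0 /=.
have e2 : 0 < e / 2 by rewrite divr_gt0.
have [d d0 hd] := uF t _ e2; have [d' d'0 hd'] := continuous_eps x (cF t) e2.
exists (ball t d, ball x d'); first by split; exact: nbhsx_ballx.
move=> [r y] [/=]; rewrite -!ball_normE /= => h1 h2.
rewrite distrC in h1; rewrite distrC in h2.
have := hd r h1 y; have := hd' y h2; rewrite distrC => k1 k2.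
rewrite distrC -[X in `|X|](subrKA (F t y)) (le_trans (ler_normD _ _))//; lra.
Qed.

(** * Regularity of a solution in time and space *)

Lemma row_sum_evec (R : realType) (x : 'rV[R]_3) :
  x = x 0 0 *: evec R 0 + x 0 1 *: evec R 1 + x 0 2%:R *: evec R 2%:R.
Proof.
apply/rowP => i; rewrite !mxE/=.
case: i => -[|[|[|//]]] ? /=; rewrite ?mulr0 ?mulr1 ?addr0 ?add0r; congr (x 0 _); exact/val_inj.
Qed.

(** Moving along the three axes in turn. *)
Lemma lip_of_partials (R : realType) (f : 'rV[R]_3 -> R) (L : R) :
  C1 f -> (forall j x, `|'D_(evec R j) f x| <= L) ->
  forall x y, `|f x - f y| <= 3 * L * `|x - y|.
Proof.
move=> fC hL x y; pose h := x - y.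
have L0 : 0 <= L by apply: le_trans (hL 0 0).
have st j z (t : R) : `|t| <= `|h| -> `|f (z + t *: evec R j) - f z| <= L * `|h|.
  move=> th; apply: (le_trans (lip_dir (fun x => (fC.2 (evec R j)).1 x) (hL j) z t)).
  by rewrite ler_wpM2l.
pose y1 := y + h 0 0 *: evec R 0; pose y2 := y1 + h 0 1 *: evec R 1.
pose y3 := y2 + h 0 2%:R *: evec R 2%:R.
have y3E : y3 = x.
  rewrite /y3 /y2 /y1 -!addrA [X in y + X](_ : _ = h); first by rewrite /h addrC subrK.
  by rewrite addrA -row_sum_evec.
have -> : f x = f y3 by rewrite y3E.
have e1 : `|f y1 - f y| <= L * `|h| by apply: st; exact: le_coord.
have e2 : `|f y2 - f y1| <= L * `|h| by apply: st; exact: le_coord.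
have e3 : `|f y3 - f y2| <= L * `|h| by apply: st; exact: le_coord.
have -> : f y3 - f y = (f y3 - f y2) + (f y2 - f y1) + (f y1 - f y) by ring.
by rewrite -mulrA; exact: norm_add3_le.
Qed.

Lemma deriv_le_lip (R : realType) (V : normedModType R) (f : V -> R) x v (K : R) :
  derivable f x v -> (forall h : R, `|f (x + h *: v) - f x| <= K * `|h|) ->
  `|'D_v f x| <= K.
Proof.
move=> fd hK.
have h : `|n.+1%:R * (f (x + n.+1%:R^-1 *: v) - f x)| @[n --> \oo] --> `|'D_v f x|.
  by apply: cvg_norm; exact: diff_quot_cvg.
have -> : `|'D_v f x| = lim (`|n.+1%:R * (f (x + n.+1%:R^-1 *: v) - f x)| @[n --> \oo]).
  by apply/esym/cvg_lim.
apply: limr_le; first by apply/cvg_ex; exists (`|'D_v f x|).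
near=> n; rewrite normrM (le_trans (ler_wpM2l _ (hK _)))//.
by rewrite mulrCA -normrM divff// normr1 mulr1.
Unshelve. all: by end_near. Qed.

Lemma dist4_le (R : realType) (a b a' b' K e : R) : `|a - b| <= K ->
  `|b - b'| <= e / 2 -> `|a - a'| <= e / 2 -> `|a' - b'| <= K + e.
Proof.
rewrite !ler_norml => /andP[? ?] /andP[? ?] /andP[? ?]; apply/andP; split; lra.
Qed.

(** The H^3 bound holds at almost every time only. A difference quotient at an
arbitrary time is a limit of difference quotients at good times, because of the
uniform continuity in time, and inherits their bound. *)
Lemma solution_lipschitz (R : realType) (T : R) (v : R -> 'rV[R]_3 -> R) : 0 < T ->
  LinftyH3 T v -> (forall t, t \in `[0, T] -> C1 (v t)) ->
  unif_time_cont (fun t => v (clamp T t)) ->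
  exists2 L : R, 0 <= L & forall t j x, `|'D_(evec R j) (v (clamp T t)) x| <= L.
Proof.
move=> T0 [M hM] vC uv; have [C C0 hC] := @sobolev_grad R.
exists (C * `|M|); first by rewrite mulr_ge0// ltW.
move=> t j x; have tT := clamp_in t (ltW T0).
apply: deriv_le_lip; first by case: ((vC _ tT).2 (evec R j)).
move=> h; apply/ler_addgt0Pr => e e0.
have e2 : 0 < e / 2 by rewrite divr_gt0.
have [d d0 hd] := uv (clamp T t) _ e2.
have [r [rT rd [Hr Nr]]] := ae_dense T0 hM tT d0.
have vr := vC _ rT.
have NM : (Hnorm 3 (v r) <= `|M|%:E)%E by rewrite (le_trans Nr)// lee_fin ler_norm.
have hg := hC _ _ vr Hr NM.
have hl := lip_dir (fun x => (vr.2 (evec R j)).1 x) (hg j) x h.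
have := hd r rd (x + h *: evec R j); have := hd r rd x.
rewrite (clamp_id rT) (clamp_id tT) => h1 h2.
exact: (dist4_le hl h1 h2).
Qed.

Lemma measurable_powRK (R : realType) d (X : measurableType d) (P : X -> R) (a : R) :
  0 < a -> (forall x, 0 <= P x) -> measurable_fun setT (fun x => P x `^ a) ->
  measurable_fun setT P.
Proof.
move=> a0 P0 mP; rewrite (_ : P = (fun x => (P x `^ a) `^ a^-1)).
  exact: (measurableT_comp (measurable_powR a^-1) mP).
by apply/funext => x; rewrite -powRrM divff ?gt_eqF// powRr1.
Qed.

Lemma powR_le_root (R : realType) (a p M : R) : 0 < a -> 0 <= p -> p `^ a <= M ->
  p <= M `^ a^-1.
Proof.
move=> a0 p0 pM; rewrite -[p](_ : (p `^ a) `^ a^-1 = p).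
  apply: ge0_ler_powR; rewrite ?nnegrE ?powR_ge0 ?invr_ge0 ?(ltW a0)//.
  by apply: le_trans pM; exact: powR_ge0.
by rewrite -powRrM divff ?gt_eqF// powRr1.
Qed.

(** A density known through a continuous power of it can be integrated against
continuous functions with compact support. *)
Lemma integrable4_density (R : realType) (P : R * 'rV[R]_3 -> R) (a : R)
    (K : set (R * 'rV[R]_3)) (g : R * 'rV[R]_3 -> R) :
  0 < a -> (forall z, 0 <= P z) -> continuous (fun z => P z `^ a) ->
  compact K -> continuous g -> (forall z, ~ K z -> g z = 0) ->
  (leb_tx R).-integrable setT (EFin \o ((fun z => P z * g z) \o @vec4 R)).
Proof.
move=> a0 P0 cP cK cg g0.
have [C C0 hC] := cont_supp_bounded cK cg g0.
have : compact ((fun z => P z `^ a) @` K).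
  by apply: continuous_compact => //; exact: continuous_subspaceT.
move=> /compact_bounded[M' [_ hM']]; pose M := `|M'| + 1.
have hM z : K z -> P z `^ a <= M.
  move=> Kz; rewrite (le_trans (ler_norm _))//.
  by apply: (hM' M _ (P z `^ a)); [rewrite /M ltr_pwDr// ler_norm|exists z].
have [N hN] := compact_norm_bound cK.
apply: (integrable4_bounded (C := M `^ a^-1 * C) (M := N)).
- apply: measurable_funM; last exact: measurable_vec4.
  apply: (measurable_powRK (X := E4 R) (P := P \o @vec4 R) a0) => [z|]; first exact: P0.
  exact: (measurable_vec4 cP).
- move=> z; have [Kz|/g0->] := pselect (K z); last first.
    by rewrite mulr0 normr0 mulr_ge0 ?powR_ge0.
  by rewrite normrM ger0_norm// ler_pM// powR_le_root// hM.
- by move=> z /hN/g0 ->; rewrite mulr0.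
Qed.

(** * Test functions moving along a straight line *)

Lemma is_derive_time (R : realType) (z v : R * 'rV[R]_3) : is_derive z v fst v.1.
Proof. exact: is_derive_lin. Qed.

(** The position relative to the point that starts at [x0] with velocity [c]. *)
Definition frame (R : realType) (x0 c : 'rV[R]_3) (z : R * 'rV[R]_3) : 'rV[R]_3 :=
  z.2 - (x0 + z.1 *: c).

Lemma is_derive_frame (R : realType) (x0 c : 'rV[R]_3) (i : 'I_3) (z v : R * 'rV[R]_3) :
  is_derive z v (fun z => frame x0 c z 0 i) (v.2 0 i - v.1 * c 0 i).
Proof.
have hl : is_derive z v (fun z : R * 'rV[R]_3 => z.2 0 i - z.1 * c 0 i) (v.2 0 i - v.1 * c 0 i).
  by apply: (@is_derive_lin _ _ (fun z : R * 'rV[R]_3 => z.2 0 i - z.1 * c 0 i)) => a [ut ux] [wt wx];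
    rewrite (_ : a *: (ut, ux) + (wt, wx) = (a * ut + wt, a *: ux + wx))//= !mxE; ring.
have h := is_deriveD_fun hl (is_derive_cst (- x0 0 i : R) z v).
rewrite (_ : (fun z => _) = fun z : R * 'rV[R]_3 => (z.2 0 i - z.1 * c 0 i) + - x0 0 i).
  by apply: (is_derive_eq h); rewrite addr0.
by apply/funext => w; rewrite /frame !mxE; ring.
Qed.

Lemma smooth_time (R : realType) : smooth (fun z : R * 'rV[R]_3 => z.1).
Proof. by apply: smooth_lin => // z; exact: cvg_fst. Qed.

Lemma smooth_frame (R : realType) (x0 c : 'rV[R]_3) (i : 'I_3) :
  smooth (fun z => frame x0 c z 0 i).
Proof.
have hl : smooth (fun z : R * 'rV[R]_3 => z.2 0 i).
  apply: smooth_lin => [a x y|z]; first by rewrite !mxE.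
  apply: (@continuous_comp _ _ _ snd (fun x : 'rV[R]_3 => x 0 i)).
    exact: cvg_snd.
  exact: coord_continuous.
rewrite (_ : (fun z => _) = fun z : R * 'rV[R]_3 => z.2 0 i - (x0 0 i + z.1 * c 0 i)).
  apply: smoothB => //; apply: smoothD; first exact: smooth_cst.
  by apply: smoothM; [exact: smooth_time|exact: smooth_cst].
by apply/funext => w; rewrite /frame !mxE.
Qed.

Lemma is_derive_sqn_frame (R : realType) (x0 c : 'rV[R]_3) (z v : R * 'rV[R]_3) :
  is_derive z v (fun z => sqn (frame x0 c z))
    (2 * \sum_(i < 3) frame x0 c z 0 i * (v.2 0 i - v.1 * c 0 i)).
Proof.
have hs : is_derive z v (fun z => sqn (frame x0 c z))
   (\sum_(i < 3) ((v.2 0 i - v.1 * c 0 i) * frame x0 c z 0 i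
      + frame x0 c z 0 i * (v.2 0 i - v.1 * c 0 i))).
  rewrite (_ : (fun z => _) =
      \sum_(i < 3) (fun z : R * 'rV[R]_3 => frame x0 c z 0 i * frame x0 c z 0 i)); last first.
    by apply/funext => w; rewrite fct_sumE.
  apply: is_derive_sum => i; apply: is_deriveM_fun; exact: is_derive_frame.
apply: (is_derive_eq hs); rewrite mulr_sumr; apply: eq_bigr => i _; ring.
Qed.

Lemma smooth_sqn_frame (R : realType) (x0 c : 'rV[R]_3) :
  smooth (fun z => sqn (frame x0 c z)).
Proof. by apply: smooth_sum => i; apply: smoothM; exact: smooth_frame. Qed.

Lemma smooth_expR (R : realType) (V : normedModType R) (f : V -> R) :
  smooth f -> smooth (fun x => expR (f x)).
Proof.
by apply: (@smooth_comp _ _ unit (fun _ => @expR R) id setT f tt) => // i s _;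
  exact: is_derive_expR.
Qed.

Lemma compact_tube (R : realType) (a b M : R) :
  compact (`[a, b]%classic `*` [set y : 'rV[R]_3 | `|y| <= M]).
Proof. by apply: compact_setX; [exact: segment_compact|exact: compact_ball3]. Qed.

Lemma frame_norm (R : realType) (x0 c : 'rV[R]_3) (T M : R) (z : R * 'rV[R]_3) :
  0 <= z.1 <= T -> `|x0| + T * `|c| + M < `|z.2| -> M < `|frame x0 c z|.
Proof.
move=> /andP[t0 tT] h; rewrite /frame -(ltrD2l (`|x0| + T * `|c|)) (lt_le_trans h)//.
rewrite -[X in `|X| <= _](subrK (x0 + z.1 *: c)) addrC (le_trans (ler_normD _ _))// lerD2r.
rewrite (le_trans (ler_normD _ _))// lerD2l normrZ ger0_norm// ler_wpM2r//.
Qed.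

(** * Persistence of vacuum *)

Lemma int4_le (R : realType) (f g : R * 'rV[R]_3 -> R) :
  (leb_tx R).-integrable setT (EFin \o (f \o @vec4 R)) ->
  (leb_tx R).-integrable setT (EFin \o (g \o @vec4 R)) ->
  (forall z, f z <= g z) -> int4 f <= int4 g.
Proof. by move=> hf hg fg; apply: le_Rintegral => // z _; exact: fg. Qed.

Lemma int4B (R : realType) (f g : R * 'rV[R]_3 -> R) :
  (leb_tx R).-integrable setT (EFin \o (f \o @vec4 R)) ->
  (leb_tx R).-integrable setT (EFin \o (g \o @vec4 R)) ->
  int4 (fun z => f z - g z) = int4 f - int4 g.
Proof. by move=> hf hg; rewrite /int4 -RintegralB. Qed.

Lemma ae_imp d (X : measurableType d) (R : realType) (mu : {measure set X -> \bar R})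
    (P Q : X -> Prop) :
  (forall x, P x -> Q x) -> {ae mu, forall x, P x} -> {ae mu, forall x, Q x}.
Proof. by move=> h; apply: filterS. Qed.

Lemma int4_eq0_ae (R : realType) (f : R * 'rV[R]_3 -> R) :
  (leb_tx R).-integrable setT (EFin \o (f \o @vec4 R)) ->
  (forall z, 0 <= f z) -> int4 f <= 0 ->
  {ae leb_tx R, forall z, f (vec4 z) = 0}.
Proof.
move=> hf f0 I0.
have mf : measurable_fun (setT : set (E4 R)) (EFin \o (f \o @vec4 R)) by have /integrableP[] := hf.
have e0 : (\int[leb_tx R]_z `|(EFin \o (f \o @vec4 R)) z| = 0)%E.
  have -> : (\int[leb_tx R]_z `|(EFin \o (f \o @vec4 R)) z| =
      \int[leb_tx R]_z (f (vec4 z))%:E)%E.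
    by apply: eq_integral => z _; rewrite gee0_abs//= lee_fin.
  have fin := integrable_fin_num measurableT hf.
  rewrite -(fineK fin); congr EFin; apply/eqP; rewrite eq_le; apply/andP; split; first exact: I0.
  by apply: Rintegral_ge0 => z _; exact: f0.
have := (ae_eq_integral_abs (leb_tx R) measurableT mf).1 e0.
by apply: filterS => z /(_ I) /= [].
Qed.

Lemma leb_tx_box (R : realType) (b : R) (x0 : 'rV[R]_3) (M c : R) : 0 < b -> 0 < M ->
  let S := `[0%R, b]%classic `*` cballx x0 M : set (E4 R) in
  (leb_tx R).-integrable setT (EFin \o (fun z : E4 R => c * \1_S z)) /\
  Rintegral (leb_tx R) setT (fun z : E4 R => c * \1_S z) = c * (b * (8 * M ^+ 3)).
Proof.
move=> b0 M0 S; have mB := measurable_cballx x0 M; have hB := leb3_cballx x0 M0.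
have mI : measurable (`[0, b]%classic : set (E1 R)) by exact: measurable_itv.
have hI : @lebesgue_measure R `[0%R, b]%classic = b%:E.
  by rewrite lebesgue_measure_itv/= lte_fin b0 -EFinB subr0.
have mS : measurable S by exact: measurableX.
have hS : leb_tx R S = (b * (8 * M ^+ 3))%:E.
  rewrite /S [LHS](@product_measure1E _ _ _ _ _ (@lebesgue_measure R) (leb3 R))//.
  by rewrite [X in (_ * X)%E]hB [X in (X * _)%E]hI -EFinM.
have ii : (leb_tx R).-integrable setT (EFin \o (\1_S : E4 R -> R)).
  apply: (@integrable_bounded _ _ _ (leb_tx R) S 1) => //.
  - by rewrite [ltLHS]hS ltry.
  - by move=> p; rewrite indicE; case: (_ \in _); rewrite ?normr1 ?normr0.
  - by move=> p np; rewrite indicE memNset.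
split; first by have := integrableZl measurableT c ii; apply.
rewrite RintegralZl//; congr (_ * _).
rewrite /Rintegral integral_indic// setIT.
by rewrite [X in fine X]hS.
Qed.

Definition etime (R : realType) : R * 'rV[R]_3 := (1, 0).
Definition espace (R : realType) (j : 'I_3) : R * 'rV[R]_3 := (0, evec R j).

(** The square of the distance to the moving centre, rescaled so that the tube
of level [r ^+ 2] shrinks like exp(-K t). *)
Definition tubeq (R : realType) (K : R) (x0 c : 'rV[R]_3) (z : R * 'rV[R]_3) : R :=
  expR (2 * K * z.1) * sqn (frame x0 c z).

Lemma smooth_tubeq (R : realType) (K : R) (x0 c : 'rV[R]_3) : smooth (tubeq K x0 c).
Proof.
apply: smoothM; last exact: smooth_sqn_frame.
by apply: smooth_expR; apply: smoothM; [exact: smooth_cst|exact: smooth_time].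
Qed.

Lemma is_derive_tubeq (R : realType) (K : R) (x0 c : 'rV[R]_3) (z v : R * 'rV[R]_3) :
  is_derive z v (tubeq K x0 c) (2 * expR (2 * K * z.1) *
    (v.1 * K * sqn (frame x0 c z) +
     \sum_(i < 3) frame x0 c z 0 i * (v.2 0 i - v.1 * c 0 i))).
Proof.
have h1 : is_derive z v (fun z : R * 'rV[R]_3 => 2 * K * z.1) (0 * z.1 + 2 * K * v.1).
  exact: is_deriveM_fun (is_derive_cst (2 * K : R) z v) (is_derive_time z v).
have h2 := is_derive_comp1 (f := fun z : R * 'rV[R]_3 => 2 * K * z.1)
  (is_derive_expR (2 * K * z.1)) h1.
have h3 := is_deriveM_fun h2 (is_derive_sqn_frame x0 c z v).
by apply: (is_derive_eq h3); ring.
Qed.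

(** Equal to 1 for s <= r^2/4 and to 0 for s >= r^2, with a monotone transition. *)
Definition tube_cutoff (R : realType) (r s : R) : R := step ((r ^+ 2 - s) * (4 / (3 * r ^+ 2))).

Definition dtube_cutoff (R : realType) (r s : R) : R :=
  dstep ((r ^+ 2 - s) * (4 / (3 * r ^+ 2))) * - (4 / (3 * r ^+ 2)).

Lemma is_derive_tube_cutoff (R : realType) (r s : R) :
  is_derive s 1 (tube_cutoff r) (dtube_cutoff r s).
Proof.
have h : is_derive s 1 (fun t : R => (r ^+ 2 - t) * (4 / (3 * r ^+ 2))) (- (4 / (3 * r ^+ 2))).
  have h := is_deriveM_fun (is_deriveB_fun (is_derive_cst (r ^+ 2 : R) s 1) (is_derive_id s 1))
    (is_derive_cst (4 / (3 * r ^+ 2) : R) s 1).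
  by apply: (is_derive_eq h); rewrite /cst; ring.
exact: (is_derive_comp1 (f := fun t : R => (r ^+ 2 - t) * (4 / (3 * r ^+ 2))) (is_derive_step _) h).
Qed.

Lemma tube_cutoff_in (R : realType) (r s : R) : 0 < r -> s <= r ^+ 2 / 4 -> tube_cutoff r s = 1.
Proof.
move=> r0 sr; apply: step1; have r2 : 0 < r ^+ 2 by rewrite exprn_gt0.
rewrite mulrA ler_pdivlMr ?mulr_gt0//; lra.
Qed.

Lemma tube_cutoff_out (R : realType) (r s : R) : 0 < r -> r ^+ 2 <= s -> tube_cutoff r s = 0.
Proof.
move=> r0 sr; apply: step0; have r2 : 0 < r ^+ 2 by rewrite exprn_gt0.
by rewrite mulr_le0_ge0 ?subr_le0// divr_ge0// mulr_ge0// ltW.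
Qed.

Lemma dtube_cutoff_le0 (R : realType) (r s : R) : 0 < r -> dtube_cutoff r s <= 0.
Proof.
move=> r0; have r2 : 0 < r ^+ 2 by rewrite exprn_gt0.
by rewrite /dtube_cutoff mulrN oppr_le0 mulr_ge0 ?dstep_ge0// divr_ge0// mulr_ge0// ltW.
Qed.

Lemma dtube_cutoff_off (R : realType) (r s : R) : 0 < r ->
  ~~ (r ^+ 2 / 4 <= s <= r ^+ 2) -> dtube_cutoff r s = 0.
Proof.
move=> r0 h; have r2 : 0 < r ^+ 2 by rewrite exprn_gt0.
rewrite /dtube_cutoff dstep_out ?mul0r//; apply: contra h => /andP[h1 h2].
have k0 : 0 < 4 / (3 * r ^+ 2) by rewrite divr_gt0// mulr_gt0.
rewrite (pmulr_lgt0 _ k0) subr_gt0 in h1.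
rewrite mulrA ltr_pdivrMr ?mulr_gt0// in h2.
by apply/andP; split; lra.
Qed.

Lemma sum3 (R : realType) (f : 'I_3 -> R) : \sum_(i < 3) f i = f 0 + f 1 + f 2%:R.
Proof.
rewrite !big_ord_recr big_ord0 /= add0r.
by congr (f _ + f _ + f _); exact/val_inj.
Qed.

Lemma box_arith (R : realType) (eps A N D X : R) : A = D * (2 * X) -> 0 < N -> 0 <= A ->
  eps / (A + 1) * (N * D) * (2 / N * X) = eps * (A / (A + 1)).
Proof.
move=> -> N0 A0; field; rewrite (gt_eqF N0) andbT /=.
by rewrite gt_eqF// ltr_wpDl.
Qed.

(** The test function is a time ramp from 0 to 1 between 1/N and 2/N, times a strictly
decreasing function of time that vanishes from tau on, times the cutoff of the
tube. The material derivative of the last factor is nonpositive by [hw]. So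
what the decay in time takes away from the mass is at most what the ramp lets
in, which tends to 0 with 1/N because the density is small near the initial
vacuum at small times. *)
Section VacuumTube.
Variables (R : realType) (a T K r tau : R) (P : R * 'rV[R]_3 -> R)
  (U : 'I_3 -> R * 'rV[R]_3 -> R) (x0 c : 'rV[R]_3).
Hypotheses (a0 : 0 < a) (P0 : forall z, 0 <= P z)
  (cP : continuous (fun z => P z `^ a)) (cU : forall j, continuous (U j))
  (hCE : forall phi, test_function (slab T) phi ->
    int4 (fun z => P z * ('D_(etime R) phi z +
      \sum_(j < 3) U j z * 'D_(espace R j) phi z)) = 0)
  (tauT : tau < T) (r0 : 0 < r) (K0 : 0 <= K)
  (hP0 : forall e : R, 0 < e -> exists2 d : R, 0 < d &
    forall z : R * 'rV[R]_3, 0 <= z.1 < d -> `|z.2 - x0| <= 2 * r -> P z <= e)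
  (hw : forall z, 0 <= z.1 <= tau -> r ^+ 2 / 4 <= tubeq K x0 c z <= r ^+ 2 ->
    0 <= K * sqn (frame x0 c z) + \sum_(i < 3) frame x0 c z 0 i * (U i z - c 0 i)).

Let ramp N (z : R * 'rV[R]_3) := step (N * z.1 - 1).
Let decay (z : R * 'rV[R]_3) := flat 1 (tau - z.1).
Let ddecay (z : R * 'rV[R]_3) := dflat (tau - z.1).
Let tube (z : R * 'rV[R]_3) := tube_cutoff r (tubeq K x0 c z).
Let phi N z := ramp N z * (decay z * tube z).
Let gain N z := N * dstep (N * z.1 - 1) * (decay z * tube z).
Let loss N z := ramp N z * (ddecay z * tube z).
Let supp N := `[N^-1, tau]%classic `*` [set y : 'rV[R]_3 | `|y| <= `|x0| + T * `|c| + r].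

Let smooth_ramp N : smooth (ramp N).
Proof.
apply: smooth_step; apply: smoothB; last exact: smooth_cst.
by apply: smoothM; [exact: smooth_cst|exact: smooth_time].
Qed.

Let smooth_decay p : smooth (fun z : R * 'rV[R]_3 => flat p (tau - z.1)).
Proof. by apply: smooth_flat; apply: smoothB; [exact: smooth_cst|exact: smooth_time]. Qed.

Let smooth_tube : smooth tube.
Proof.
apply: smooth_step; apply: smoothM; last exact: smooth_cst.
by apply: smoothB; [exact: smooth_cst|exact: smooth_tubeq].
Qed.

Let smooth_phi N : smooth (phi N).
Proof. exact: (smoothM (smooth_ramp N) (smoothM (smooth_decay 1) smooth_tube)). Qed.

Let tube_off (z : R * 'rV[R]_3) : 0 <= z.1 <= T -> `|x0| + T * `|c| + r < `|z.2| -> tube z = 0.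
Proof.
move=> z1 z2; apply: tube_cutoff_out => //.
have h := frame_norm z1 z2; rewrite /tubeq -[leLHS]mul1r.
apply: ler_pM => //; first by rewrite sqr_ge0.
  by rewrite -expR0 ler_expR mulr_ge0 ?mulr_ge0//; case/andP : z1.
by apply: le_trans (norm_sqn _); rewrite lerXn2r ?nnegrE// ltW.
Qed.

Let supp_off N z : 0 < N -> ~ supp N z ->
  [\/ z.1 < N^-1, tau < z.1 | [/\ N^-1 <= z.1, z.1 <= tau & tube z = 0]].
Proof.
move=> N0 nS; have [h1|h1] := ltP z.1 N^-1; first by constructor 1.
have [h2|h2] := ltP tau z.1; first by constructor 2.
constructor 3; split => //; apply: tube_off.
  by rewrite (le_trans _ h1) ?invr_ge0 ?(ltW N0)//= (le_trans h2)// ltW.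
rewrite ltNge; apply/negP => h3; apply: nS; split => //=.
by rewrite in_itv/= h1 h2.
Qed.

Let ramp_off N (z : R * 'rV[R]_3) : 0 < N -> z.1 < N^-1 -> N * z.1 - 1 <= 0.
Proof. by move=> N0 h; rewrite subr_le0 -ler_pdivlMl// mulr1 ltW. Qed.

Let phi_off N z : 0 < N -> ~ supp N z -> phi N z = 0.
Proof.
move=> N0 /(supp_off N0)[h|h|[_ _ h]]; rewrite /phi.
- by rewrite /ramp step0 ?mul0r// ramp_off.
- by rewrite /decay flat_npos ?mul0r ?mulr0// subr_le0 ltW.
- by rewrite h !mulr0.
Qed.

Let gain_off N z : 0 < N -> ~ supp N z -> gain N z = 0.
Proof.
move=> N0 /(supp_off N0)[h|h|[_ _ h]]; rewrite /gain.
- rewrite dstep_out ?mulr0 ?mul0r//; rewrite negb_and -leNgt ramp_off//.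
- by rewrite /decay flat_npos ?mul0r ?mulr0// subr_le0 ltW.
- by rewrite h !mulr0.
Qed.

Let loss_off N z : 0 < N -> ~ supp N z -> loss N z = 0.
Proof.
move=> N0 /(supp_off N0)[h|h|[_ _ h]]; rewrite /loss.
- by rewrite /ramp step0 ?mul0r// ramp_off.
- by rewrite /ddecay /dflat flat_npos ?mul0r ?mulr0// subr_le0 ltW.
- by rewrite h !mulr0.
Qed.

Let compact_supp N : compact (supp N).
Proof. exact: compact_tube. Qed.

Let test_phi N : 0 < N -> test_function (slab T) (phi N).
Proof.
move=> N0; split=> //; exists (supp N); split=> [//||z]; last exact: phi_off.
move=> z [/= ]; rewrite in_itv/= => /andP[h1 h2] _.
by rewrite /slab/= (lt_le_trans _ h1) ?invr_gt0//= (le_lt_trans h2).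
Qed.

Let derive_phi N z v : 'D_v (phi N) z = v.1 * (gain N z - loss N z) +
  ramp N z * (decay z * (dtube_cutoff r (tubeq K x0 c z) *
  (2 * expR (2 * K * z.1) * (v.1 * K * sqn (frame x0 c z) +
     \sum_(i < 3) frame x0 c z 0 i * (v.2 0 i - v.1 * c 0 i))))).
Proof.
have h1 : is_derive z v (fun z : R * 'rV[R]_3 => N * z.1 - 1) (N * v.1).
  have h := is_deriveB_fun (is_deriveM_fun (is_derive_cst (N : R) z v) (is_derive_time z v))
    (is_derive_cst (1 : R) z v).
  by apply: (is_derive_eq h); rewrite /cst; ring.
have h2 := is_derive_comp1 (f := fun z : R * 'rV[R]_3 => N * z.1 - 1) (is_derive_step _) h1.
have h3 : is_derive z v (fun z : R * 'rV[R]_3 => tau - z.1) (- v.1).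
  have h := is_deriveB_fun (is_derive_cst (tau : R) z v) (is_derive_time z v).
  by apply: (is_derive_eq h); rewrite sub0r.
have h4 := is_derive_comp1 (f := fun z : R * 'rV[R]_3 => tau - z.1) (is_derive_flat1 _) h3.
have h5 := is_derive_comp1 (f := tubeq K x0 c) (is_derive_tube_cutoff r _)
  (is_derive_tubeq K x0 c z v).
have := @derive_val _ _ _ _ _ _ _ (is_deriveM_fun h2 (is_deriveM_fun h4 h5)).
rewrite -/(phi N) => ->; rewrite /gain /loss /ramp /decay /ddecay /tube.
by ring.
Qed.

(* Fluid crosses the boundary of the shrinking tube outwards only. *)
Let transport_phi N z : 0 < N ->
  'D_(etime R) (phi N) z + \sum_(j < 3) U j z * 'D_(espace R j) (phi N) z <=
  gain N z - loss N z.
Proof.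
move=> N0; rewrite derive_phi /= mul1r -addrA gerDl.
set A := ramp N z; set B := decay z; set D := dtube_cutoff r _; set E := expR _.
have hin j : \sum_(i < 3) frame x0 c z 0 i * (evec R j 0 i - 0 * c 0 i) = frame x0 c z 0 j.
  rewrite (bigD1 j)//= big1 ?addr0 /evec ?mxE ?eqxx/= ?mul0r ?subr0 ?mulr1//.
  by move=> i ij; rewrite !mxE eqxx/= (negbTE ij) mul0r subr0 mulr0.
have e j : 'D_(espace R j) (phi N) z = A * (B * (D * (2 * E * frame x0 c z 0 j))).
  by rewrite derive_phi /= hin !mul0r !add0r.
have sE : \sum_(j < 3) U j z * 'D_(espace R j) (phi N) z =
    \sum_(j < 3) U j z * (A * (B * (D * (2 * E * frame x0 c z 0 j)))).
  by apply: eq_bigr => j _; rewrite e.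
rewrite sE.
have -> : A * (B * (D * (2 * E * (1 * K * sqn (frame x0 c z) +
      \sum_(i < 3) frame x0 c z 0 i * ((0 : 'rV[R]_3) 0 i - 1 * c 0 i))))) +
    \sum_(j < 3) U j z * (A * (B * (D * (2 * E * frame x0 c z 0 j)))) =
    A * B * (D * (2 * E)) * (K * sqn (frame x0 c z) +
      \sum_(i < 3) frame x0 c z 0 i * (U i z - c 0 i)).
  rewrite !sum3 !mxE; ring.
have A0 : 0 <= A by exact: step_ge0.
have B0 : 0 <= B by exact: flat1_ge0.
have E0 : 0 <= E by exact: expR_ge0.
have D0 : D <= 0 by exact: dtube_cutoff_le0.
have [zin|zout] := boolP (0 <= z.1 <= tau).
  have [zr|zr] := boolP (r ^+ 2 / 4 <= tubeq K x0 c z <= r ^+ 2).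
    apply: mulr_le0_ge0; last exact: hw.
    apply: mulr_ge0_le0; first exact: mulr_ge0.
    by apply: mulr_le0_ge0 => //; exact: mulr_ge0.
  by rewrite /D dtube_cutoff_off// !mul0r mulr0 mul0r.
move: zout; rewrite negb_and -!ltNge => /orP[z0|zt].
  rewrite /A /ramp step0 ?mul0r// ramp_off// (lt_trans z0)// invr_gt0//.
by rewrite /B /decay flat_npos ?mulr0 ?mul0r// subr_le0 ltW.
Qed.

Let smooth_gain N : smooth (gain N).
Proof.
have sr : smooth (fun z : R * 'rV[R]_3 => N * z.1 - 1).
  apply: smoothB; last exact: smooth_cst.
  by apply: smoothM; [exact: smooth_cst|exact: smooth_time].
apply: smoothM; last exact: (smoothM (smooth_decay 1) smooth_tube).
apply: smoothM; first exact: smooth_cst.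
pose H (n : nat) : R -> R := iter n (fun g => 'D_(1 : R) g) (@step R).
have := @smooth_comp _ _ nat H S setT _ 1%N _ _ sr; apply => // n s _.
suff : smooth (H n) by move=> /smooth_C1 h; exact: (C1_is_derive h s 1).
elim: n => [|n IH] /=; first exact: (smooth_step (@smooth_id R)).
exact: smooth_derive.
Qed.

Let smooth_loss N : smooth (loss N).
Proof. exact: (smoothM (smooth_ramp N) (smoothM (smooth_decay _) smooth_tube)). Qed.

Let loss_ge0 N z : 0 <= loss N z.
Proof.
by apply: mulr_ge0; [exact: step_ge0|apply: mulr_ge0; [exact: dflat_ge0|exact: step_ge0]].
Qed.

Let loss_le_gain N : 0 < N ->
  int4 (fun z => P z * loss N z) <= int4 (fun z => P z * gain N z).
Proof.
move=> N0.
have iP g : continuous g -> (forall z, ~ supp N z -> g z = 0) ->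
    (leb_tx R).-integrable setT (EFin \o ((fun z => P z * g z) \o @vec4 R)).
  exact: (integrable4_density a0 P0 cP (@compact_supp N)).
have il := iP _ (smooth_continuous (smooth_loss N)) (fun z => loss_off N0).
have ig := iP _ (smooth_continuous (smooth_gain N)) (fun z => gain_off N0).
have dphi0 v z : ~ supp N z -> 'D_v (phi N) z = 0.
  move=> h; have := derive_off_compact v (@compact_supp N) (fun z => phi_off N0) h.
  by move=> /@derive_val.
have it := iP (fun z => 'D_(etime R) (phi N) z + \sum_(j < 3) U j z * 'D_(espace R j) (phi N) z).
rewrite -subr_ge0 -int4B// -(hCE (test_phi N0)).
apply: int4_le.
- apply: it => [|z hz]; last first.
    by rewrite dphi0// add0r big1// => j _; rewrite dphi0// mulr0.
  have cd v : continuous ('D_v (phi N)) by exact: smooth_continuous (smooth_derive v (smooth_phi N)).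
  apply: continuous_add; first exact: cd.
  have -> : (fun z => \sum_(j < 3) U j z * 'D_(espace R j) (phi N) z) = (fun z =>
      U 0 z * 'D_(espace R 0) (phi N) z + U 1 z * 'D_(espace R 1) (phi N) z +
      U 2%:R z * 'D_(espace R 2%:R) (phi N) z).
    by apply/funext => z; rewrite sum3.
  apply: continuous_add; first apply: continuous_add;
    by apply: continuous_mul; [exact: cU|exact: cd].
- by have := integrableB measurableT ig il; apply.
- by move=> z; rewrite -mulrBr ler_wpM2l// transport_phi.
Qed.

Lemma vacuum_tube e : 0 < e ->
  {ae leb_tx R, forall z, e < z.1 < tau -> tubeq K x0 c (vec4 z) <= r ^+ 2 / 4 ->
    P (vec4 z) = 0}.
Proof.
move=> e0; pose N0 := 2 / e; have N00 : 0 < N0 by rewrite divr_gt0.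
have iP N g : continuous g -> (forall z, ~ supp N z -> g z = 0) ->
    (leb_tx R).-integrable setT (EFin \o ((fun z => P z * g z) \o @vec4 R)).
  exact: (integrable4_density a0 P0 cP (@compact_supp N)).
have il N (N_gt0 : 0 < N) := iP N _ (smooth_continuous (smooth_loss N)) (fun z => loss_off N_gt0).
have ig N (N_gt0 : 0 < N) := iP N _ (smooth_continuous (smooth_gain N)) (fun z => gain_off N_gt0).
have [D1 D10 hD1] := @dstep_bounded R.
have small : int4 (fun z => P z * loss N0 z) <= 0.
  (* The ramp is active between the times 1/N and 2/N, over the cube of radius 2r
     around x0, where the density is below eps/(A + 1); its slope is at most N D1. *)
  pose A := D1 * (2 * (8 * (2 * r) ^+ 3)).
  have A0 : 0 <= A by rewrite !mulr_ge0 ?exprn_ge0 ?mulr_ge0// ltW.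
  apply/ler_addgt0Pr => eps eps0; rewrite add0r.
  have e1 : 0 < eps / (A + 1) by rewrite divr_gt0// ltr_wpDl.
  have [d d0 hd] := hP0 e1.
  pose d' := Num.min d (r / (`|c| + 1)).
  have d'0 : 0 < d' by rewrite lt_min d0 divr_gt0// ltr_wpDl.
  pose N := Num.max N0 (4 / d').
  have N_gt0 : 0 < N by rewrite lt_max N00.
  have N2 : 2 / N < d'.
    rewrite ltr_pdivrMr// -ltr_pdivrMl//.
    by rewrite lt_max; apply/orP; right; rewrite mulrC ltr_pM2r ?invr_gt0//; lra.
  apply: (@le_trans _ _ (int4 (fun z => P z * gain N z))).
    apply: (le_trans _ (loss_le_gain N_gt0)); apply: int4_le; [exact: il|exact: il|].
    move=> z; apply: ler_wpM2l => //; rewrite /loss.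
    apply: ler_wpM2r; first by apply: mulr_ge0; [exact: dflat_ge0|exact: step_ge0].
    have [z0|z0] := leP z.1 0.
      by rewrite /ramp !step0// subr_le0 (@le_trans _ _ 0)// mulr_ge0_le0// ltW.
    by apply: step_homo; rewrite lerB// ler_wpM2r ?(ltW z0)// le_max lexx.
  have N20 : 0 < 2 / N by rewrite divr_gt0.
  have r20 : 0 < 2 * r by rewrite mulr_gt0.
  have [iS eS] := leb_tx_box x0 (eps / (A + 1) * (N * D1)) N20 r20.
  apply: (@le_trans _ _ (eps / (A + 1) * (N * D1) * (2 / N * (8 * (2 * r) ^+ 3)))); last first.
    have -> : eps / (A + 1) * (N * D1) * (2 / N * (8 * (2 * r) ^+ 3)) = eps * (A / (A + 1)).
      exact: box_arith.
    rewrite -[leRHS]mulr1 ler_wpM2l ?(ltW eps0)// ler_pdivrMr ?ltr_wpDl// mul1r.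
    by rewrite lerDl.
  rewrite -eS; apply: le_Rintegral => //; first exact: ig.
  move=> z _ /=.
  have rhs0 : 0 <= eps / (A + 1) * (N * D1).
    by apply: mulr_ge0; [exact: ltW|apply: mulr_ge0; exact: ltW].
  have [h|/(gain_off N_gt0) ->] := pselect (supp N (vec4 z)); last first.
    by rewrite mulr0 mulr_ge0.
  have [zN|zN] := boolP (0 < N * (vec4 z).1 - 1 < 1); last first.
    by rewrite /gain dstep_out// mulr0 mul0r mulr0 mulr_ge0.
  have [|tz] := eqVneq (tube (vec4 z)) 0.
    by rewrite /gain => ->; rewrite !mulr0 mulr_ge0.
  case: h => /=; rewrite in_itv/= => /andP[h1 h2] _.
  have z1 : 0 <= z.1 by rewrite (le_trans _ h1)// invr_ge0 ltW.
  have z2 : z.1 < 2 / N.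
    by rewrite ltr_pdivlMr// mulrC; move: zN => /andP[_] /=; lra.
  have fr : `|frame x0 c (vec4 z)| <= r.
    rewrite leNgt; apply/negP => hr; move/eqP: tz; apply; apply: tube_cutoff_out => //.
    rewrite /tubeq -[leLHS]mul1r; apply: ler_pM => //; first exact: sqr_ge0.
      by rewrite -expR0 ler_expR mulr_ge0 ?mulr_ge0.
    by apply: le_trans (norm_sqn _); rewrite lerXn2r ?nnegrE ?(ltW r0)// ltW.
  have zx : `|vec3 z.2 - x0| <= 2 * r.
    have -> : vec3 z.2 - x0 = frame x0 c (vec4 z) + z.1 *: c.
      by rewrite /frame /= opprD addrA subrK.
    rewrite (le_trans (ler_normD _ _))// [2 * r]mulr_natl mulr2n lerD//.
    rewrite normrZ ger0_norm//.
    have : z.1 <= r / (`|c| + 1).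
      by rewrite (le_trans (ltW z2))// (le_trans (ltW N2))// ge_min lexx orbT.
    rewrite ler_pdivlMr ?ltr_wpDl//; nra.
  rewrite indicE mem_set ?mulr1; last first.
    by split => //=; rewrite in_itv/= z1 ltW.
  apply: ler_pM => //.
  - apply: mulr_ge0; first by apply: mulr_ge0; [exact: ltW|exact: dstep_ge0].
    by apply: mulr_ge0; [exact: flat1_ge0|exact: step_ge0].
  - apply: hd => //=; rewrite z1 (lt_le_trans (lt_trans z2 N2))// ge_min lexx.
    by [].
  - rewrite /gain -[leRHS]mulr1; apply: ler_pM.
    + by apply: mulr_ge0; [exact: ltW|exact: dstep_ge0].
    + by apply: mulr_ge0; [exact: flat1_ge0|exact: step_ge0].
    + by apply: ler_wpM2l; [exact: ltW|exact: hD1].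
    + rewrite -[leRHS]mulr1; apply: ler_pM; first exact: flat1_ge0.
      * exact: step_ge0.
      * exact: flat1_le1.
      * exact: step_le1.
have h0 := int4_eq0_ae (il N0 N00) (fun z => mulr_ge0 (P0 z) (loss_ge0 N0 z)) small.
apply: (ae_imp _ h0) => z Pz /andP[ez zt] zr.
move/eqP : Pz; rewrite mulf_eq0 => /orP[/eqP//|].
rewrite /loss /ramp step1 ?mul1r; last first.
  rewrite /N0 /=; have : 2 <= 2 / e * z.1 by rewrite mulrAC ler_pdivlMr// ler_wpM2l// ltW.
  lra.
rewrite /tube tube_cutoff_in// mulr1 /ddecay /= gt_eqF// dflat_gt0// subr_gt0//.
Qed.

End VacuumTube.

(** * Integration by parts and integration in a moving frame *)

Lemma measurable_derive4 (R : realType) (F : R * 'rV[R]_3 -> R) v :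
  continuous F -> (forall z, derivable F z v) ->
  measurable_fun (setT : set (E4 R)) ('D_v F \o @vec4 R).
Proof.
move=> cF dF.
have cs (n : nat) : continuous (fun z : R * 'rV[R]_3 => F (z + n.+1%:R^-1 *: v)).
  move=> z; apply: (@continuous_comp _ _ _ (fun z => z + n.+1%:R^-1 *: v) F); last exact: cF.
  by apply: cvgD; [exact: cvg_id|exact: cvg_cst].
apply: (@measurable_fun_cvg _ _ _ setT (fun n (z : E4 R) =>
    n.+1%:R * (F (vec4 z + n.+1%:R^-1 *: v) - F (vec4 z)))).
  move=> n; apply: measurable_funM; first exact: measurable_cst.
  by apply: measurable_funB; [exact: (measurable_vec4 (cs n))|exact: measurable_vec4].
by move=> z _; exact: (diff_quot_cvg (dF (vec4 z))).
Qed.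

Lemma integrable4_Mcont (R : realType) (H g : R * 'rV[R]_3 -> R) (C : R)
    (K : set (R * 'rV[R]_3)) :
  measurable_fun (setT : set (E4 R)) (H \o @vec4 R) -> (forall z, `|H z| <= C) ->
  compact K -> continuous g -> (forall z, ~ K z -> g z = 0) ->
  (leb_tx R).-integrable setT (EFin \o ((fun z => H z * g z) \o @vec4 R)).
Proof.
move=> mH HC cK cg g0.
have [D D0 hD] := cont_supp_bounded cK cg g0.
have [N hN] := compact_norm_bound cK.
apply: (integrable4_bounded (C := C * D) (M := N)).
- by apply: measurable_funM => //; exact: measurable_vec4.
- by move=> z; rewrite normrM; apply: ler_pM.
- by move=> z /hN/g0 ->; rewrite mulr0.
Qed.

Lemma int4_parts (R : realType) (F phi : R * 'rV[R]_3 -> R) v (C : R) :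
  continuous F -> (forall z, derivable F z v) -> (forall z, `|'D_v F z| <= C) ->
  test_function setT phi ->
  int4 (fun z => F z * 'D_v phi z + 'D_v F z * phi z) = 0.
Proof.
move=> cF dF hC [sphi [K [cK _ phi0]]].
have pc := smooth_continuous sphi; have dpc := smooth_continuous (smooth_derive v sphi).
have dphi0 z : ~ K z -> 'D_v phi z = 0.
  by move=> nK; have := derive_off_compact v cK phi0 nK; move=> /@derive_val.
pose G z := F z * phi z.
have Gd z : is_derive z v G ('D_v F z * phi z + F z * 'D_v phi z).
  by apply: is_deriveM_fun; [exact: derivableP|exact: C1_is_derive (smooth_C1 sphi) _ _].
have dG z : 'D_v G z = 'D_v F z * phi z + F z * 'D_v phi z.
  by have /@derive_val := Gd z.
have [C1 C10 h1] := cont_supp_bounded cK pc phi0.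
have [C2 C20 h2] := cont_supp_bounded cK (continuous_mul cF dpc)
  (fun z nK => eq_trans (congr1 _ (dphi0 z nK)) (mulr0 _)).
have [C3 C30 h3] := cont_supp_bounded cK (continuous_mul cF pc)
  (fun z nK => eq_trans (congr1 _ (phi0 z nK)) (mulr0 _)).
have [M hM] := compact_norm_bound cK.
have C0 : 0 <= C by apply: le_trans (hC 0).
have [_ h] : (leb_tx R).-integrable setT (EFin \o ('D_v G \o @vec4 R)) /\ int4 ('D_v G) = 0.
  apply: (@int4_derive0 _ G v (C3 + (C * C1 + C2)) M).
  - exact: (measurable_vec4 (continuous_mul cF pc)).
  - by move=> z; have [] := Gd z.
  - by move=> z; rewrite (le_trans (h3 z))// lerDl addr_ge0// mulr_ge0.
  - move=> z; rewrite dG (le_trans (ler_normD _ _))//.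
    rewrite (@le_trans _ _ (C * C1 + C2))// ?lerDr//; apply: lerD; last exact: h2.
    by rewrite normrM; apply: ler_pM.
  - by move=> z /hM nK; rewrite /G phi0// mulr0.
rewrite -[RHS]h; apply: eq_Rintegral => z _ /=.
by rewrite dG addrC.
Qed.

Lemma int4D (R : realType) (f g : R * 'rV[R]_3 -> R) :
  (leb_tx R).-integrable setT (EFin \o (f \o @vec4 R)) ->
  (leb_tx R).-integrable setT (EFin \o (g \o @vec4 R)) ->
  int4 (fun z => f z + g z) = int4 f + int4 g.
Proof. by move=> hf hg; rewrite /int4 -RintegralD. Qed.

Lemma integrable4D (R : realType) (f g : R * 'rV[R]_3 -> R) :
  (leb_tx R).-integrable setT (EFin \o (f \o @vec4 R)) ->
  (leb_tx R).-integrable setT (EFin \o (g \o @vec4 R)) ->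
  (leb_tx R).-integrable setT (EFin \o ((fun z => f z + g z) \o @vec4 R)).
Proof. by move=> hf hg; have := integrableD measurableT hf hg; apply. Qed.

Lemma integrable4B (R : realType) (f g : R * 'rV[R]_3 -> R) :
  (leb_tx R).-integrable setT (EFin \o (f \o @vec4 R)) ->
  (leb_tx R).-integrable setT (EFin \o (g \o @vec4 R)) ->
  (leb_tx R).-integrable setT (EFin \o ((fun z => f z - g z) \o @vec4 R)).
Proof. by move=> hf hg; have := integrableB measurableT hf hg; apply. Qed.

Lemma int4Zl (R : realType) (c : R) (f : R * 'rV[R]_3 -> R) :
  (leb_tx R).-integrable setT (EFin \o (f \o @vec4 R)) ->
  int4 (fun z => c * f z) = c * int4 f.
Proof. by move=> hf; rewrite /int4 -RintegralZl. Qed.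

Lemma integrable4Zl (R : realType) (c : R) (f : R * 'rV[R]_3 -> R) :
  (leb_tx R).-integrable setT (EFin \o (f \o @vec4 R)) ->
  (leb_tx R).-integrable setT (EFin \o ((fun z => c * f z) \o @vec4 R)).
Proof. by move=> hf; have := integrableZl measurableT c hf; apply. Qed.

Lemma int4_norm_le (R : realType) (f g : R * 'rV[R]_3 -> R) :
  (leb_tx R).-integrable setT (EFin \o (f \o @vec4 R)) ->
  (leb_tx R).-integrable setT (EFin \o (g \o @vec4 R)) ->
  (forall z, `|f z| <= g z) -> `|int4 f| <= int4 g.
Proof.
move=> hf hg fg; apply: (le_trans (le_normr_Rintegral measurableT hf)).
apply: le_Rintegral => //; last by move=> z _; exact: fg.
have /integrableP[mf ff] := hf.
have mf' : measurable_fun setT (f \o @vec4 R) by exact/measurable_EFinP.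
have mnf : measurable_fun setT (fun z => `|f (vec4 z)|) by exact: measurableT_comp.
apply/integrableP; split; first exact/measurable_EFinP.
apply: le_lt_trans ff; apply: ge0_le_integral => //=.
- by apply/measurable_EFinP; exact: measurableT_comp.
- by apply/measurable_EFinP.
- by move=> z _; rewrite lee_fin normr_id.
Qed.

(** Fubini's theorem followed, at each time, by a translation in space. *)
Lemma int4_frame (R : realType) (f : R -> R) (k : 'rV[R]_3 -> R) (x0 c : 'rV[R]_3) :
  continuous f -> continuous k -> (forall t, 0 <= f t) -> (forall x, 0 <= k x) ->
  (@lebesgue_measure R).-integrable setT (EFin \o f) ->
  (leb3 R).-integrable setT (EFin \o (k \o @vec3 R)) ->
  int4 (fun z => f z.1 * k (frame x0 c z)) =
  Rintegral (@lebesgue_measure R) setT f * int3 k.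
Proof.
move=> cf ck f0 k0 jf ik.
pose F (z : E4 R) := (f z.1 * k (frame x0 c (vec4 z)))%:E.
have cF : continuous (fun z : R * 'rV[R]_3 => f z.1 * k (frame x0 c z)).
  apply: continuous_mul.
    by move=> z; apply: (@continuous_comp _ _ _ fst f); [exact: cvg_fst|exact: cf].
  move=> z; apply: (@continuous_comp _ _ _ (frame x0 c) k); last exact: ck.
  apply: cvgB; first exact: cvg_snd.
  by apply: cvgD; [exact: cvg_cst|apply: cvgZr_tmp; exact: cvg_fst].
have mF : measurable_fun setT F by apply/measurable_EFinP; exact: (measurable_vec4 cF).
have F0 z : (0 <= F z)%E by rewrite lee_fin mulr_ge0.
have inner t : (\int[leb3 R]_p F (t, p) = (f t)%:E * \int[leb3 R]_p (k (vec3 p))%:E)%E.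
  rewrite -ge0_integralZl//; last 3 first.
  - by apply/measurable_EFinP; exact: (measurable_vec3 ck).
  - by move=> p _; rewrite lee_fin.
  - by rewrite lee_fin.
  rewrite -(@ge0_integral_mpres _ _ _ (leb3 R) _ (fun p : E3 R => ((f t)%:E * (k (vec3 p))%:E)%E)
    (mpres_shift3 (unvec (- (x0 + t *: c))))).
  - by apply: eq_integral => p _; rewrite /F /= vec3D vec3_unvec EFinM.
  - apply: emeasurable_funM; first exact: measurable_cst.
    by apply/measurable_EFinP; exact: (measurable_vec3 ck).
  - by move=> p; rewrite -EFinM lee_fin mulr_ge0.
have mfe : measurable_fun (setT : set (E1 R)) (fun t => (f t)%:E).
  by apply/measurable_EFinP; exact: continuous_measurable_fun.
rewrite /int4 /Rintegral -[X in fine X]/(\int[leb_tx R]_z F z)%E.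
have -> : (\int[leb_tx R]_z F z = \int[@lebesgue_measure R]_t ((f t)%:E * (int3 k)%:E))%E.
  rewrite [LHS](@fubini_tonelli1 _ _ _ _ _ (@lebesgue_measure R) (leb3 R) F mF F0).
  apply: eq_integral => t _; rewrite /fubini_F inner; congr (_ * _)%E.
  by rewrite /int3 /Rintegral fineK//; exact: integrable_fin_num.
rewrite ge0_integralZr//; last 2 first.
- by move=> t _; rewrite lee_fin.
- by rewrite lee_fin; apply: Rintegral_ge0 => p _; exact: k0.
by rewrite fineM//; exact: integrable_fin_num.
Qed.

(** * Averages over a thin moving tube *)

(** The derivative of a smooth step of width [h] that starts at time [s]: an
approximate Dirac mass of integral 1. *)
Definition pulse (R : realType) (s h t : R) : R := h^-1 * dstep ((t - s) / h).

Lemma is_derive_rstep (R : realType) (s h t : R) :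
  is_derive t 1 (fun t => step ((t - s) / h)) (pulse s h t).
Proof.
have h1 : is_derive t (1 : R) (fun t : R => (t - s) / h) h^-1.
  have := is_deriveM_fun (is_deriveB_fun (is_derive_id t (1 : R)) (is_derive_cst s t 1))
    (is_derive_cst h^-1 t 1).
  by move=> H; apply: (is_derive_eq H); rewrite subr0 mul1r mulr0 addr0.
have := is_derive_comp1 (f := fun t : R => (t - s) / h) (is_derive_step _) h1.
by move=> H; apply: (is_derive_eq H); rewrite /pulse mulrC.
Qed.

Lemma pulse_ge0 (R : realType) (s h t : R) : 0 < h -> 0 <= pulse s h t.
Proof. by move=> h0; apply: mulr_ge0; [rewrite invr_ge0 ltW|exact: dstep_ge0]. Qed.

Lemma pulse_out (R : realType) (s h t : R) : 0 < h -> ~~ (s < t < s + h) -> pulse s h t = 0.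
Proof.
move=> h0 H; rewrite /pulse dstep_out ?mulr0//; apply: contra H => /andP[].
by rewrite pmulr_lgt0 ?invr_gt0// subr_gt0 ltr_pdivrMr// mul1r ltrBlDl => -> ->.
Qed.

Lemma continuous_pulse (R : realType) (s h : R) : continuous (pulse s h).
Proof.
apply: continuous_mul; first by move=> x; exact: cvg_cst.
move=> x; apply: (@continuous_comp _ _ _ (fun t : R => (t - s) / h) (@dstep R)).
  apply: cvgM; last exact: cvg_cst.
  by apply: cvgB; [exact: cvg_id|exact: cvg_cst].
exact: continuous_dstep.
Qed.

Lemma integral_pulse (R : realType) (s h : R) : 0 < h ->
  (@lebesgue_measure R).-integrable setT (EFin \o pulse s h) /\
  Rintegral (@lebesgue_measure R) setT (pulse s h) = 1.
Proof.
move=> h0; have sh : s < s + h by rewrite ltrDl.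
have iT : (\int[@lebesgue_measure R]_t (pulse s h t)%:E = 1)%E.
  have := ftc_segment sh (is_derive_rstep s h) (@continuous_pulse _ s h).
  have -> : (s + h - s) / h = 1 by rewrite addrC addKr divff// gt_eqF.
  rewrite subrr mul0r step1// step0// subr0 => <-.
  rewrite [RHS]integral_mkcond; apply: eq_integral => t _.
  rewrite patchE; case: ifPn => // H; congr EFin; apply: pulse_out => //.
  by apply: contra H => /andP[h1 h2]; rewrite inE/= in_itv/= !ltW.
split; last by rewrite /Rintegral iT.
apply/integrableP; split.
  by apply/measurable_EFinP; apply: continuous_measurable_fun; exact: continuous_pulse.
apply: (@le_lt_trans _ _ 1%E); last exact: ltry.
rewrite -iT le_eqVlt; apply/orP; left; apply/eqP; apply: eq_integral => t _.
by rewrite /= ger0_norm// pulse_ge0.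
Qed.

Lemma continuous_frame (R : realType) (x0 c : 'rV[R]_3) : continuous (frame x0 c).
Proof.
move=> z; apply: cvgB; first exact: cvg_snd.
by apply: cvgD; [exact: cvg_cst|apply: cvgZr_tmp; exact: cvg_fst].
Qed.

Lemma continuous_time_fun (R : realType) (f : R -> R) : continuous f ->
  continuous (fun z : R * 'rV[R]_3 => f z.1).
Proof.
by move=> cf z; apply: (@continuous_comp _ _ _ fst f); [exact: cvg_fst|exact: cf].
Qed.

Section bump.
Variables (R : realType) (e : R).
Hypothesis e0 : 0 < e.

Definition bump (x : 'rV[R]_3) : R := cutoff (e ^- 2 * sqn x).

Lemma smooth_bump_comp (V : normedModType R) (g : V -> R) : smooth g ->
  smooth (fun v => cutoff (e ^- 2 * g v)).
Proof.
move=> sg; apply: smooth_step; apply: smoothM; last exact: smooth_cst.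
apply: smoothB; first exact: smooth_cst.
by apply: smoothM; first exact: smooth_cst.
Qed.

Lemma continuous_bump : continuous bump.
Proof.
apply: smooth_continuous; apply: smooth_bump_comp.
have := smooth_sqnB (0 : 'rV[R]_3); congr smooth; apply/funext => x; by rewrite subr0.
Qed.

Lemma bump_ge0 x : 0 <= bump x. Proof. exact: cutoff_ge0. Qed.

Lemma bump_out x : (2 * e) ^+ 2 <= sqn x -> bump x = 0.
Proof.
move=> h; apply: cutoff_out; rewrite ler_pdivlMl ?exprn_gt0//.
by rewrite mulrC -[4%:R](_ : 2 ^+ 2 = _) -?exprMn// expr2 -natrM.
Qed.

Lemma bump_supp x : bump x != 0 -> `|x| <= 2 * e /\ sqn x <= (2 * e) ^+ 2.
Proof.
move=> h; have h1 : sqn x < (2 * e) ^+ 2.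
  by rewrite ltNge; apply: contra h => /bump_out ->.
split; last exact: ltW.
rewrite -(@ler_pXn2r _ 2) ?nnegrE ?mulr_ge0 ?(ltW e0)//.
by rewrite (le_trans (norm_sqn x))// ltW.
Qed.

Lemma integrable_bump : (leb3 R).-integrable setT (EFin \o (bump \o @vec3 R)).
Proof.
apply: (integrable3 (@compact_ball3 R (2 * e))); first exact: continuous_bump.
move=> x /= nx; by apply/eqP/negPn/negP => /bump_supp[].
Qed.

Lemma int3_bump_gt0 : 0 < int3 bump.
Proof.
pose M := e / 2; have M0 : 0 < M by rewrite divr_gt0.
have [i1 i2] := leb3_indic (0 : 'rV[R]_3) 1 M0.
apply: (@lt_le_trans _ _ (1 * (8 * M ^+ 3))); first by rewrite mul1r mulr_gt0// exprn_gt0.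
rewrite -i2; apply: le_Rintegral => //; first exact: integrable_bump.
move=> p _; rewrite mul1r indicE; case: (boolP (p \in _)) => h; last exact: bump_ge0.
rewrite /= /bump cutoff_in// ler_pdivrMl ?exprn_gt0// mulr1.
rewrite (le_trans (sqn_norm _))//.
have hp : `|vec3 p| <= M by move: h; rewrite inE /cballx/= ?subr0.
have : `|vec3 p| ^+ 2 <= M ^+ 2 by rewrite lerXn2r ?nnegrE// ltW.
have : 3 * M ^+ 2 <= e ^+ 2 by rewrite /M expr_div_n; have := sqr_ge0 e; lra.
move=> h1 h2; apply: le_trans h1; by rewrite ler_wpM2l.
Qed.

End bump.

(** The weight is nonnegative and its integral is the product of the integral 1 of
the pulse and of that of the bump, by [int4_frame]. *)
Lemma bump_average (R : realType) (x0 c : 'rV[R]_3) (e s h G0 e1 : R)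
    (F : R * 'rV[R]_3 -> R) :
  0 < e -> 0 < h -> continuous F ->
  (forall z, s <= z.1 <= s + h -> `|frame x0 c z| <= 2 * e -> `|F z - G0| <= e1) ->
  (leb_tx R).-integrable setT
    (EFin \o ((fun z => F z * (pulse s h z.1 * bump e (frame x0 c z))) \o @vec4 R)) /\
  `|int4 (fun z => F z * (pulse s h z.1 * bump e (frame x0 c z))) - G0 * int3 (bump e)|
    <= e1 * int3 (bump e).
Proof.
move=> e0 h0 cF hF; pose g z := pulse s h z.1 * bump e (frame x0 c z).
have cg : continuous g.
  apply: continuous_mul; first exact: continuous_time_fun (@continuous_pulse _ _ _).
  move=> z; apply: (@continuous_comp _ _ _ (frame x0 c) (bump e)).
    exact: continuous_frame.
  exact: continuous_bump.
have g0 z : 0 <= g z by apply: mulr_ge0; [exact: pulse_ge0|exact: bump_ge0].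
have gs z : g z != 0 -> s <= z.1 <= s + h /\ `|frame x0 c z| <= 2 * e.
  rewrite mulf_eq0 negb_or => /andP[h1 /(bump_supp e0)[h2 _]]; split=> //.
  apply/negPn/negP => H; move/negP: h1; apply; apply/eqP/pulse_out => //.
  by apply: contra H => /andP[? ?]; rewrite !ltW.
pose T0 := `|s| + `|h|.
pose K := (`[- T0, T0]%classic `*` [set y : 'rV[R]_3 | `|y| <= 2 * e + `|x0| + T0 * `|c|]).
have cK : compact K by exact: compact_tube.
have gK z : ~ K z -> g z = 0.
  move=> nK; apply/eqP/negPn/negP => /gs[/andP[s1 s2] fr]; apply: nK.
  have zT : `|z.1| <= T0.
    rewrite ler_norml; have := ler_norm s; have := ler_norm h; have := ler_norm (- s).
    have := normr_ge0 h.
    rewrite normrN /T0 => ? ? ? ?; apply/andP; split; lra.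
  split; first by rewrite /= in_itv/= -ler_norml.
  rewrite /= (_ : z.2 = frame x0 c z + (x0 + z.1 *: c)); last by rewrite /frame subrK.
  rewrite (le_trans (ler_normD _ _))// -addrA lerD// (le_trans (ler_normD _ _))// lerD2l.
  by rewrite normrZ ler_wpM2r.
have int_of (H : R * 'rV[R]_3 -> R) : continuous H ->
    (leb_tx R).-integrable setT (EFin \o ((fun z => H z * g z) \o @vec4 R)).
  move=> cH; apply: (integrable4 cK (continuous_mul cH cg)) => z /gK ->.
  by rewrite mulr0.
split; first exact: int_of.
have [ip vp] := integral_pulse s h0.
have gE : int4 g = int3 (bump e).
  rewrite /g int4_frame ?vp ?mul1r//.
  - exact: continuous_pulse.
  - exact: continuous_bump.
  - by move=> t; exact: pulse_ge0.
  - exact: bump_ge0.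
  - exact: integrable_bump.
have ig : (leb_tx R).-integrable setT (EFin \o (g \o @vec4 R)).
  by apply: (integrable4 cK cg) => z /gK.
rewrite -gE -!(int4Zl _ ig).
have iF := int_of _ cF; have iG := integrable4Zl G0 ig.
have -> : int4 (fun z => F z * g z) - int4 (fun z => G0 * g z) =
    int4 (fun z => F z * g z - G0 * g z) by rewrite /int4 -RintegralB.
apply: int4_norm_le; first exact: integrable4B.
  exact: integrable4Zl.
move=> z; rewrite -mulrBl normrM (ger0_norm (g0 z)).
have [->|/gs[h1 h2]] := eqVneq (g z) 0; first by rewrite !mulr0.
by apply: ler_wpM2r => //; exact: hF.
Qed.

(** * The velocity along a straight line in vacuum *)

Lemma int4_sum3 (R : realType) (F : 'I_3 -> R * 'rV[R]_3 -> R) :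
  (forall j, (leb_tx R).-integrable setT (EFin \o (F j \o @vec4 R))) ->
  (leb_tx R).-integrable setT (EFin \o ((fun z => \sum_(j < 3) F j z) \o @vec4 R)) /\
  int4 (fun z => \sum_(j < 3) F j z) = \sum_(j < 3) int4 (F j).
Proof.
move=> hF; rewrite (_ : (fun z => _) = fun z => F 0 z + F 1 z + F 2%:R z); last first.
  by apply/funext => z; rewrite sum3.
have i1 := integrable4D (hF 0) (hF 1); split; first exact: integrable4D i1 (hF _).
by rewrite sum3 (int4D i1 (hF _)) int4D.
Qed.

Lemma continuous_pairing (U V W : topologicalType) (f : U -> V) (g : U -> W) :
  continuous f -> continuous g -> continuous (fun u => (f u, g u)).
Proof. by move=> cf cg u; apply: cvg_pair; [exact: cf|exact: cg]. Qed.

Lemma continuous_line (R : realType) (x0 c : 'rV[R]_3) :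
  continuous (fun t : R => (t, x0 + t *: c)).
Proof.
apply: (@continuous_pairing R R 'rV[R]_3 id (fun t => x0 + t *: c)).
  by move=> t; exact: cvg_id.
by move=> t; apply: cvgD; [exact: cvg_cst|apply: cvgZr_tmp; exact: cvg_id].
Qed.

Lemma window_arith (R : realType) (m A1 A2 A3 A4 e S : R) : 0 < m ->
  `|A1 - A3 * m| <= e * m -> `|A2 - A4 * m| <= e * m -> `|A1 - A2| <= S ->
  `|A4 - A3| * m <= 2 * e * m + S.
Proof.
move=> m0; rewrite -[X in _ * X <= _](ger0_norm (ltW m0)) -normrM mulrBl.
rewrite -[2 * e * m]mulrA.
move: (A3 * m) (A4 * m) (e * m) => B3 B4 E.
rewrite !ler_norml => /andP[? ?] /andP[? ?] /andP[? ?]; apply/andP; split; lra.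
Qed.

Section key.
Variables (R : realType) (T tau r L : R) (U : 'I_3 -> R * 'rV[R]_3 -> R)
  (x0 c : 'rV[R]_3).
Hypotheses (r0 : 0 < r) (L0 : 0 <= L) (tauT : tau < T)
  (cU : forall j, continuous (U j))
  (dU : forall i j z, derivable (U i) z (espace R j))
  (dUL : forall i j z, `|'D_(espace R j) (U i) z| <= L)
  (lipU : forall i t x y, `|U i (t, x) - U i (t, y)| <= 3 * L * `|x - y|)
  (hTr : forall i phi, test_function (slab T) phi ->
    (exists2 e, 0 < e & forall z, phi z != 0 ->
       e < z.1 < tau /\ sqn (frame x0 c z) <= r ^+ 2) ->
    int4 (fun z => U i z * 'D_(etime R) phi z) =
    int4 (fun z => (\sum_(j < 3) U j z * 'D_(espace R j) (U i) z) * phi z)).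

Let F i t := U i (t, x0 + t *: c) - c 0 i.

(** The test function is eta(t) bump(x - x0 - t c), where eta rises during
[a, a + h] and falls during [b - h, b]. Its time derivative produces, up to
transport terms, the difference of the averages of U_i near b and near a. *)
Section window.
Variables (i : 'I_3) (a b h e mu : R).
Hypotheses (a0 : 0 < a) (btau : b < tau) (h0 : 0 < h) (ab : a <= b - h)
  (e0 : 0 < e) (er : 2 * e <= r) (mu0 : 0 <= mu)
  (hmu : forall t, a <= t <= b -> \sum_(j < 3) `|F j t| <= mu).

Let eta t := step ((t - a) / h) - step ((t - (b - h)) / h).
Let phi (z : R * 'rV[R]_3) := eta z.1 * bump e (frame x0 c z).
Let p t := pulse a h t - pulse (b - h) h t.
Let slope z := cutoff1 (e ^- 2 * sqn (frame x0 c z)) * (e ^- 2 * 2).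
Let K := (`[a, b]%classic `*` [set y : 'rV[R]_3 | `|y| <= 2 * e + `|x0| + b * `|c|]).

Let eta_ge0 t : 0 <= eta t.
Proof.
rewrite subr_ge0; apply: step_homo; rewrite ler_wpM2r ?invr_ge0 ?(ltW h0)//.
by rewrite lerD2l lerN2.
Qed.

Let eta_le1 t : eta t <= 1.
Proof. by rewrite lerBlDr (le_trans (step_le1 _))// lerDl step_ge0. Qed.

Let eta_out t : ~~ (a <= t <= b) -> eta t = 0.
Proof.
rewrite negb_and -!ltNge => /orP[h1|h1]; rewrite /eta.
  rewrite !step0 ?subrr// pmulr_lle0 ?invr_gt0// subr_le0 ltW//.
  exact: lt_le_trans ab.
have e1 : 1 <= (t - a) / h.
  by rewrite ler_pdivlMr// mul1r lerBrDl (le_trans _ (ltW h1))// -lerBrDr.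
have e2 : 1 <= (t - (b - h)) / h.
  by rewrite ler_pdivlMr// mul1r lerBrDl subrK ltW.
by rewrite (step1 e1) (step1 e2) subrr.
Qed.

Let continuous_eta : continuous eta.
Proof. by move=> t; apply: (is_derive1_cont (is_deriveB_fun (is_derive_rstep a h t) (is_derive_rstep _ h t))). Qed.

Let phi_supp z : phi z != 0 ->
  [/\ a <= z.1 <= b, `|frame x0 c z| <= 2 * e & sqn (frame x0 c z) <= (2 * e) ^+ 2].
Proof.
rewrite mulf_eq0 negb_or => /andP[h1 /(bump_supp e0)[h2 h3]]; split=> //.
by apply/negPn/negP => H; move/negP: h1; apply; apply/eqP/eta_out.
Qed.

Let cK : compact K. Proof. exact: compact_tube. Qed.

Let phiK z : ~ K z -> phi z = 0.
Proof.
move=> nK; apply/eqP/negPn/negP => /phi_supp[zab fr _]; apply: nK.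
split; first by rewrite /= in_itv.
have [z1 z2] := andP zab.
rewrite /= (_ : z.2 = frame x0 c z + (x0 + z.1 *: c)); last by rewrite /frame subrK.
rewrite (le_trans (ler_normD _ _))// -addrA lerD// (le_trans (ler_normD _ _))// lerD2l.
by rewrite normrZ ler_wpM2r// ger0_norm// (le_trans (ltW a0)).
Qed.

Let smooth_phi : smooth phi.
Proof.
apply: smoothM; last by apply: smooth_bump_comp; exact: smooth_sqn_frame.
by apply: smoothB; apply: smooth_step; apply: smoothM; try exact: smooth_cst;
  apply: smoothB; [exact: smooth_time|exact: smooth_cst|exact: smooth_time|exact: smooth_cst].
Qed.

Let slabK : K `<=` slab T.
Proof.
move=> z [] /=; rewrite in_itv/= => /andP[h1 h2] _.
by rewrite /slab/= (lt_le_trans a0 h1) (le_lt_trans h2)// (lt_trans btau).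
Qed.

Let test_phi : test_function (slab T) phi.
Proof. by split => //; exists K; split => // x; exact: phiK. Qed.

Let test_phiT : test_function setT phi.
Proof. by split => //; exists K; split => // x; exact: phiK. Qed.

Let is_derive_phi z v : is_derive z v phi
  (p z.1 * v.1 * bump e (frame x0 c z) +
   eta z.1 * (slope z * \sum_(i < 3) frame x0 c z 0 i * (v.2 0 i - v.1 * c 0 i))).
Proof.
have h1 : is_derive z v (fun z : R * 'rV[R]_3 => eta z.1) (p z.1 * v.1).
  apply: (is_derive_comp1 (f := fun z : R * 'rV[R]_3 => z.1) _ (is_derive_time z v)).
  exact: is_deriveB_fun (is_derive_rstep a h z.1) (is_derive_rstep _ h z.1).
have h2 : is_derive z v (fun z => e ^- 2 * sqn (frame x0 c z))
    (e ^- 2 * (2 * \sum_(i < 3) frame x0 c z 0 i * (v.2 0 i - v.1 * c 0 i))).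
  have H := is_deriveM_fun (is_derive_cst (e ^- 2) z v) (is_derive_sqn_frame x0 c z v).
  by apply: (is_derive_eq H); rewrite mul0r add0r.
have h3 := is_derive_comp1 (is_derive_cutoff0 _) h2.
apply: (is_derive_eq (is_deriveM_fun h1 h3)); rewrite /slope.
by congr (_ + _); rewrite !mulrA.
Qed.

Let Dphi_space j z : 'D_(espace R j) phi z = eta z.1 * (slope z * frame x0 c z 0 j).
Proof.
have /@derive_val -> := is_derive_phi z (espace R j).
rewrite mulr0 mul0r add0r; congr (_ * (_ * _)); rewrite (bigD1 j)//= big1 ?addr0.
  by rewrite /evec !mxE !eqxx /= mul0r subr0 mulr1.
by move=> k kj; rewrite /evec !mxE eqxx (negPf kj) /= mul0r subr0 mulr0.
Qed.

(* The bump moves with velocity c, hence the convective term. *)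
Let Dphi_time z : 'D_(etime R) phi z =
  p z.1 * bump e (frame x0 c z) - \sum_(j < 3) c 0 j * 'D_(espace R j) phi z.
Proof.
have /@derive_val -> := is_derive_phi z (etime R).
rewrite mulr1; congr (_ + _); rewrite -sumrN !mulr_sumr; apply: eq_bigr => j _.
by rewrite Dphi_space !mxE mul1r; ring.
Qed.

Let measurable_dU k j : measurable_fun (setT : set (E4 R)) ('D_(espace R j) (U k) \o @vec4 R).
Proof. by apply: measurable_derive4 => // z; exact: dU. Qed.

Let pphi := smooth_continuous smooth_phi.

Let Dphi_off v z : ~ K z -> 'D_v phi z = 0.
Proof.
by move=> nK; have := derive_off_compact v cK (fun x => @phiK x) nK; move=> /@derive_val.
Qed.

Let int_dU k j (g : R * 'rV[R]_3 -> R) : continuous g ->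
  (leb_tx R).-integrable setT
    (EFin \o ((fun z => 'D_(espace R j) (U k) z * (g z * phi z)) \o @vec4 R)).
Proof.
move=> cg; apply: (integrable4_Mcont (C := L) (K := K)) => //.
- exact: continuous_mul.
- by move=> z /phiK ->; rewrite mulr0.
Qed.

Let int_UD k j : (leb_tx R).-integrable setT
  (EFin \o ((fun z => U k z * 'D_(espace R j) phi z) \o @vec4 R)).
Proof.
have cd := smooth_continuous (smooth_derive (espace R j) smooth_phi).
apply: (integrable4 cK (continuous_mul (cU (j := k)) cd)) => z /(Dphi_off _) ->.
by rewrite mulr0.
Qed.

Let parts j : int4 (fun z => U i z * 'D_(espace R j) phi z) =
  - int4 (fun z => 'D_(espace R j) (U i) z * (1 * phi z)).
Proof.
have H := @int4_parts R (U i) phi (espace R j) L (@cU i) (@dU i j) (@dUL i j) test_phiT.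
apply/eqP; rewrite -addr_eq0 -int4D; [|exact: int_UD|by apply: int_dU => z; exact: cvg_cst].
rewrite -[X in _ == X]H; apply/eqP; congr int4; apply/funext => z; by rewrite mul1r.
Qed.

(* Moving the convective term onto U_i turns U_j into U_j - c_j, which is small
   near the line. *)
Let balance : int4 (fun z => U i z * (p z.1 * bump e (frame x0 c z))) =
  int4 (fun z => \sum_(j < 3) 'D_(espace R j) (U i) z * ((U j z - c 0 j) * phi z)).
Proof.
have i1 j : (leb_tx R).-integrable setT
    (EFin \o ((fun z => 'D_(espace R j) (U i) z * (U j z * phi z)) \o @vec4 R)).
  exact: int_dU.
have i2 j : (leb_tx R).-integrable setT
    (EFin \o ((fun z => 'D_(espace R j) (U i) z * (1 * phi z)) \o @vec4 R)).
  by apply: int_dU => z; exact: cvg_cst.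
have i3 j := integrable4Zl (c 0 j) (int_UD i j).
have [J1 E1'] := int4_sum3 i3.
have [J2 E2'] := int4_sum3 i1.
have cd := smooth_continuous (smooth_derive (etime R) smooth_phi).
have J0 : (leb_tx R).-integrable setT
    (EFin \o ((fun z => U i z * 'D_(etime R) phi z) \o @vec4 R)).
  apply: (integrable4 cK (continuous_mul (cU (j := i)) cd)) => z /(Dphi_off _) ->.
  by rewrite mulr0.
have step1' : int4 (fun z => U i z * (p z.1 * bump e (frame x0 c z))) =
   int4 (fun z => U i z * 'D_(etime R) phi z) +
   int4 (fun z => \sum_(j < 3) c 0 j * (U i z * 'D_(espace R j) phi z)).
  rewrite -(int4D J0 J1); congr int4; apply/funext => z.
  rewrite Dphi_time mulrBr mulr_sumr -addrA addrC -[LHS]add0r; congr (_ + _).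
  rewrite addrC; apply/esym/eqP; rewrite subr_eq0; apply/eqP; apply: eq_bigr => j _; ring.
rewrite step1' E1' hTr//; last first.
  exists (a / 2); first by rewrite divr_gt0.
  move=> z /phi_supp[/andP[z1 z2] _ z3]; split.
    rewrite (le_lt_trans z2)// andbT (lt_le_trans _ z1)// ltr_pdivrMr// mulr_natr mulr2n ltrDl//.
  by rewrite (le_trans z3)// lerXn2r ?nnegrE ?mulr_ge0 ?(ltW e0)// ltW.
have -> : \sum_(j < 3) int4 (fun z => c 0 j * (U i z * 'D_(espace R j) phi z)) =
    - \sum_(j < 3) int4 (fun z => c 0 j * ('D_(espace R j) (U i) z * (1 * phi z))).
  rewrite -sumrN; apply: eq_bigr => j _.
  by rewrite (int4Zl _ (int_UD i j)) (int4Zl _ (i2 j)) parts mulrN.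
have i4 j := integrable4Zl (c 0 j) (i2 j).
have [J3 E3'] := int4_sum3 i4.
rewrite -E3'.
have -> : int4 (fun z => (\sum_(j < 3) U j z * 'D_(espace R j) (U i) z) * phi z) =
    int4 (fun z => \sum_(j < 3) 'D_(espace R j) (U i) z * (U j z * phi z)).
  congr int4; apply/funext => z; rewrite mulr_suml.
  by apply: eq_bigr => j _; rewrite -mulrA mulrCA.
rewrite -(int4B J2 J3); congr int4; apply/funext => z.
by rewrite -sumrB; apply: eq_bigr => j _; rewrite mul1r mulrBl mulrBr [c 0 j * _]mulrCA.
Qed.

Let tube_near j (t : R) z : t = z.1 -> `|frame x0 c z| <= 2 * e ->
  `|U j z - U j (t, x0 + t *: c)| <= 6 * L * e.
Proof.
move=> ->; case: z => t1 y /= fr; apply: (le_trans (lipU _ _ _ _)).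
rewrite -[y - _]/(frame x0 c (t1, y)).
have h1 : 3 * L * `|frame x0 c (t1, y)| <= 3 * L * (2 * e).
  by rewrite ler_wpM2l// mulr_ge0.
by apply: (le_trans h1); rewrite le_eqVlt; apply/orP; left; apply/eqP; ring.
Qed.

Let m := int3 (bump e).

Let integral_eta : (@lebesgue_measure R).-integrable setT (EFin \o eta) /\
  Rintegral (@lebesgue_measure R) setT eta <= b - a.
Proof.
have hab : a < b by rewrite (le_lt_trans ab)// ltrBlDr ltrDl.
have ii : (@lebesgue_measure R).-integrable setT (EFin \o (fun t => \1_(`[a, b]%classic) t : R)).
  exact: (integrable_indic_itv a b true false).
have ie t : eta t <= \1_(`[a, b]%classic) t.
  rewrite indicE; case: (boolP (t \in _)) => h1; first exact: eta_le1.
  by rewrite eta_out//; apply: contra h1; rewrite inE/= in_itv.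
have mi : measurable_fun setT eta by apply: continuous_measurable_fun; exact: continuous_eta.
have je : (@lebesgue_measure R).-integrable setT (EFin \o eta).
  apply: (le_integrable measurableT _ _ ii); first exact/measurable_EFinP.
  by move=> t _; rewrite /= lee_fin !ger0_norm.
split=> //; apply: le_trans (le_Rintegral _ je ii (fun t _ => ie t)) _ => //.
rewrite /Rintegral integral_indic// setIT.
by rewrite /= lebesgue_measure_itv/= lte_fin hab -EFinD.
Qed.

Let int4_phi : int4 phi <= (b - a) * m.
Proof.
have [h1 h2] := integral_eta.
rewrite /phi int4_frame//; first last.
- exact: integrable_bump.
- exact: bump_ge0.
- exact: continuous_bump.
by apply: ler_wpM2r => //; exact/ltW/int3_bump_gt0.
Qed.

Let source_le : `|int4 (fun z => \sum_(j < 3) 'D_(espace R j) (U i) z * ((U j z - c 0 j) * phi z))|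
  <= (mu + 18 * L * e) * L * ((b - a) * m).
Proof.
have cw j : continuous (fun z => U j z - c 0 j).
  by move=> z; apply: cvgB; [exact: cU|exact: cvg_cst].
have [J _] := int4_sum3 (fun j => int_dU i j (cw j)).
have phi0 z : 0 <= phi z by apply: mulr_ge0; [exact: eta_ge0|exact: bump_ge0].
have iphi : (leb_tx R).-integrable setT (EFin \o (phi \o @vec4 R)).
  by apply: (integrable4 cK pphi) => z /phiK.
have C0 : 0 <= (mu + 18 * L * e) * L.
  by apply: mulr_ge0 => //; apply: addr_ge0 => //; apply: mulr_ge0; [exact: mulr_ge0|exact: ltW].
apply: (@le_trans _ _ (int4 (fun z => (mu + 18 * L * e) * L * phi z))); last first.
  by rewrite int4Zl// ler_wpM2l.
apply: int4_norm_le => //; first exact: integrable4Zl.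
move=> z; have [p0|/phi_supp[zab fr _]] := eqVneq (phi z) 0.
  by rewrite p0 mulr0 big1 ?normr0// => j _; rewrite !mulr0.
apply: (le_trans (ler_norm_sum _ _ _)).
apply: (@le_trans _ _ (\sum_(j < 3) (`|F j z.1| + 6 * L * e) * L * phi z)).
  apply: ler_sum => j _; rewrite 2!normrM (ger0_norm (phi0 z)) mulrA; apply: ler_wpM2r => //.
  rewrite mulrC; apply: ler_pM => //.
  have := tube_near j (erefl z.1) fr => h1.
  rewrite (_ : U j z - c 0 j = F j z.1 + (U j z - U j (z.1, x0 + z.1 *: c))).
    by rewrite (le_trans (ler_normD _ _))// lerD2l.
  by rewrite /F; ring.
rewrite -!mulr_suml; apply: ler_wpM2r => //; apply: ler_wpM2r => //.
rewrite big_split/=; apply: lerD; first exact: hmu.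
by rewrite sum3; lra.
Qed.

Lemma window_estimate (e1 : R) :
  (forall t, a <= t <= a + h -> `|F i t - F i a| <= e1) ->
  (forall t, b - h <= t <= b -> `|F i t - F i b| <= e1) ->
  `|F i b - F i a| <= 2 * (e1 + 6 * L * e) + (mu + 18 * L * e) * L * (b - a).
Proof.
move=> ha hb; have m0 : 0 < m by exact: int3_bump_gt0.
have near_s s z : `|F i z.1 - F i s| <= e1 -> `|frame x0 c z| <= 2 * e ->
    `|U i z - U i (s, x0 + s *: c)| <= e1 + 6 * L * e.
  move=> h1 fr; have h2 := tube_near i (erefl z.1) fr.
  rewrite (_ : U i z - U i (s, x0 + s *: c) = (F i z.1 - F i s) + (U i z - U i (z.1, x0 + z.1 *: c))).
    by rewrite (le_trans (ler_normD _ _))// lerD.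
  by rewrite /F; ring.
have [Ia Aa] := @bump_average R x0 c e a h (U i (a, x0 + a *: c)) (e1 + 6 * L * e) (U i)
  e0 h0 (cU (j := i)) (fun z h1 h2 => near_s a z (ha _ h1) h2).
have hb' (z : R * 'rV[R]_3) : b - h <= z.1 <= b - h + h -> `|F i z.1 - F i b| <= e1.
  by rewrite subrK; exact: hb.
have [Ib Ab] := @bump_average R x0 c e (b - h) h (U i (b, x0 + b *: c)) (e1 + 6 * L * e) (U i)
  e0 h0 (cU (j := i)) (fun z h1 h2 => near_s b z (hb' _ h1) h2).
have B := balance.
have E : int4 (fun z => U i z * (p z.1 * bump e (frame x0 c z))) =
    int4 (fun z => U i z * (pulse a h z.1 * bump e (frame x0 c z))) -
    int4 (fun z => U i z * (pulse (b - h) h z.1 * bump e (frame x0 c z))).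
  rewrite -(int4B Ia Ib); congr int4; apply/funext => z.
  by rewrite /p mulrBl mulrBr.
have S := source_le; rewrite -B E in S.
have -> : F i b - F i a = U i (b, x0 + b *: c) - U i (a, x0 + a *: c) by rewrite /F; ring.
have W := window_arith m0 Aa Ab S.
rewrite -(ler_pM2r m0); apply: (le_trans W).
by rewrite le_eqVlt; apply/orP; left; apply/eqP; ring.
Qed.

End window.

Let continuous_F i : continuous (F i).
Proof.
move=> t; apply: cvgB; last exact: cvg_cst.
apply: (@continuous_comp _ _ _ (fun t : R => (t, x0 + t *: c)) (U i)); last exact: cU.
exact: continuous_line.
Qed.

(** In the limit of a thin tube and of short pulses, the momentum balance in
the tube bounds the variation of the velocity relative to the straight line. *)
Lemma transport_estimate i (a b mu : R) : 0 < a -> a < b -> b < tau -> 0 <= mu ->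
  (forall t, a <= t <= b -> \sum_(j < 3) `|F j t| <= mu) ->
  `|F i b - F i a| <= mu * L * (b - a).
Proof.
move=> a0 ab btau mu0 hmu; apply/ler_addgt0Pr => e e0.
have ba0 : 0 <= b - a by rewrite subr_ge0 ltW.
pose D := 12 * L + 18 * L * L * (b - a).
have D0 : 0 <= D.
  by apply: addr_ge0; [exact: mulr_ge0|apply: mulr_ge0 => //; apply: mulr_ge0 => //; exact: mulr_ge0].
have e40 : 0 < e / 4 by rewrite divr_gt0.
have [da da0 hda] := @continuous_eps R R^o (F i) a _ (@continuous_F i) e40.
have [db db0 hdb] := @continuous_eps R R^o (F i) b _ (@continuous_F i) e40.
pose h := Num.min (Num.min da db / 2) (b - a).
have hda' : h < da.
  rewrite /h gt_min; apply/orP; left; rewrite ltr_pdivrMr// gt_min; apply/orP; left.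
  by rewrite ltr_pMr// ltr1n.
have hdb' : h < db.
  rewrite /h gt_min; apply/orP; left; rewrite ltr_pdivrMr// gt_min; apply/orP; right.
  by rewrite ltr_pMr// ltr1n.
have hab : h <= b - a by rewrite /h ge_min lexx orbT.
have h0 : 0 < h by rewrite /h lt_min divr_gt0 ?lt_min ?da0// subr_gt0.
pose d := Num.min (r / 2) (e / (2 * (D + 1))).
have D10 : 0 < D + 1 by rewrite ltr_pwDr.
have d0 : 0 < d by rewrite /d lt_min !divr_gt0// mulr_gt0.
have dr : 2 * d <= r by rewrite mulrC -ler_pdivlMr// /d ge_min lexx.
have dD : D * d <= e / 2.
  apply: (@le_trans _ _ (D * (e / (2 * (D + 1))))).
    by apply: ler_wpM2l => //; rewrite /d ge_min lexx orbT.
  have -> : D * (e / (2 * (D + 1))) = D / (D + 1) * (e / 2).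
    by field; rewrite gt_eqF.
  apply: ler_piMl; first by rewrite divr_ge0// ltW.
  by rewrite ler_pdivrMr// mul1r lerDl.
have W := @window_estimate i a b h d mu a0 btau h0 _ d0 dr mu0 hmu (e / 4).
apply: (le_trans (W _ _ _)).
- by rewrite lerBrDr -lerBrDl.
- move=> t /andP[t1 t2]; rewrite distrC; apply: hda; rewrite ger0_norm ?subr_ge0//.
  by rewrite (le_lt_trans _ hda')// lerBlDl.
- move=> t /andP[t1 t2]; rewrite distrC; apply: hdb; rewrite distrC ger0_norm ?subr_ge0//.
  by rewrite (le_lt_trans _ hdb')// lerBlDr -lerBlDl.
rewrite (_ : _ + _ = mu * L * (b - a) + (e / 2 + D * d)); last by rewrite /D; field.
by rewrite lerD2l [leRHS](splitr e) lerD2l.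
Qed.

End key.

(** * Propagation of the rest state along the straight line *)

Lemma continuous_ext_zero (R : realType) (g : R -> R) (s : R) : continuous g -> 0 < s ->
  (forall t, 0 <= t < s -> g t = 0) -> g s = 0.
Proof.
move=> cg s0 hg; apply/eqP; rewrite -normr_le0; apply/ler_addgt0Pr => e e0; rewrite add0r.
have [d d0 hd] := @continuous_eps R R^o g s _ cg e0.
pose t := Num.max 0 (s - d / 2).
have ts : t < s by rewrite /t gt_max s0/= ltrBlDr ltrDl divr_gt0.
have t0 : 0 <= t by rewrite /t le_max lexx.
suff H : `|g s - g t| <= e by move: H; rewrite (hg t) ?t0// subr0.
apply: hd; rewrite distrC gtr0_norm ?subr_gt0// ltrBlDr -ltrBlDl /t lt_max; apply/orP; right.
by rewrite ltrD2l ltrN2 ltr_pdivrMr// ltr_pMr// ltr1n.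
Qed.

Lemma bootstrap_arith (R : realType) (L mu d e x y b a : R) : 0 <= L -> 0 <= mu -> a <= b ->
  0 <= a -> b - a <= d -> 6 * L * d <= 1 -> y <= x + 3 * (mu * L * (b - a)) -> x <= e ->
  y <= e + mu / 2.
Proof.
move=> L0 mu0 ab a0 bd Ld yx xe.
have h1 : mu * (6 * L * (b - a)) <= mu * 1.
  apply: ler_wpM2l => //; apply: le_trans Ld; apply: ler_wpM2l => //; exact: mulr_ge0.
have h2 : 3 * (mu * L * (b - a)) = mu * (6 * L * (b - a)) / 2 by field.
move: h1 yx xe; rewrite h2; lra.
Qed.

Section bootstrap.
Variables (R : realType) (T m L : R) (f : 'I_3 -> R -> R).
Hypotheses (L0 : 0 <= L) (m0 : 0 < m) (cf : forall i, continuous (f i))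
  (f0 : forall i, f i 0 = 0)
  (hkey : forall tau, 0 < tau -> tau < T ->
    (forall t, 0 <= t <= tau -> \sum_(j < 3) `|f j t| <= m) ->
    forall i a b mu, 0 < a -> a < b -> b < tau -> 0 <= mu ->
      (forall t, a <= t <= b -> \sum_(j < 3) `|f j t| <= mu) ->
      `|f i b - f i a| <= mu * L * (b - a)).

Let g t := \sum_(j < 3) `|f j t|.

Let cg : continuous g.
Proof.
have -> : g = fun t => `|f 0 t| + `|f 1 t| + `|f 2%:R t|.
  by apply/funext => t; rewrite /g sum3.
move=> t; apply: cvgD; first apply: cvgD; apply: cvg_norm; exact: cf.
Qed.

Let g0 : g 0 = 0.
Proof. by rewrite /g big1// => j _; rewrite f0 normr0. Qed.

Let g_ge0 t : 0 <= g t. Proof. by rewrite /g sumr_ge0. Qed.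

(* Continuity keeps g below the threshold m for a while after s, which makes the
   key estimate available there. *)
Let extend s t1 : 0 <= s -> s < t1 -> t1 < T -> (forall t, 0 <= t <= s -> g t = 0) ->
  exists2 s', s < s' <= t1 & forall t, 0 <= t <= s' -> g t = 0.
Proof.
move=> s0 st1 t1T hs.
have [d1 d10 hd1] := @continuous_eps R R^o g s _ cg m0.
pose D := 6 * L + 1.
have D0 : 0 < D by rewrite ltr_wpDl// mulr_ge0.
pose d := Num.min (Num.min (d1 / 2) (t1 - s)) D^-1.
have d0 : 0 < d by rewrite /d !lt_min divr_gt0// subr_gt0 st1 invr_gt0.
have dd1 : d < d1.
  rewrite /d !gt_min; apply/orP; left; apply/orP; left.
  by rewrite ltr_pdivrMr// ltr_pMr// ltr1n.
have dt1 : d <= t1 - s by rewrite /d !ge_min lexx orbT.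
have Ld : 6 * L * d <= 1.
  apply: (@le_trans _ _ (D * d)); first by rewrite ler_wpM2r// ?(ltW d0)// lerDl.
  by rewrite -(divff (lt0r_neq0 D0)); apply: ler_wpM2l; [exact: ltW|rewrite /d !ge_min lexx !orbT].
pose tau := s + d; pose s' := s + d / 2.
have dh : d / 2 < d by rewrite ltr_pdivrMr// ltr_pMr// ltr1n.
have dh0 : 0 < d / 2 by rewrite divr_gt0.
have s'tau : s' < tau by rewrite /s' /tau ltrD2l.
have gs : g s = 0 by rewrite hs// s0 lexx.
have gm t : 0 <= t <= tau -> g t <= m.
  move=> /andP[t0 tt]; have [ts|ts] := leP t s; first by rewrite hs ?t0// ltW.
  suff H : `|g s - g t| <= m by move: H; rewrite gs sub0r normrN ger0_norm.
  apply: hd1; rewrite gtr0_norm ?subr_gt0// (le_lt_trans _ dd1)// lerBlDl//.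
have tauT : tau < T.
  by rewrite (le_lt_trans _ t1T)// /tau addrC -lerBrDr.
have tau0 : 0 < tau by rewrite /tau ltr_wpDl.
have key := hkey tau0 tauT gm.
have [b bss hb] := @EVT_max R g s s' (ltW (ltr_pwDr dh0 (lexx s)))
  (continuous_subspaceT cg).
(* On [s, s'] the maximum g b of g satisfies g b <= g b / 2, up to g a for a close
   to s. The key estimate is only available for a > 0, whence a > s instead of
   a = s. *)
have mu0 : g b <= 0.
  have [bs|bs] := leP b s.
    rewrite (_ : b = s) ?gs//; apply/le_anti; rewrite bs /=.
    by move: bss; rewrite in_itv/= => /andP[].
  move: bss; rewrite in_itv/= => /andP[_ bs'].
  suff H e : 0 < e -> g b <= e + g b / 2.
    apply/ler_addgt0Pr => e e0; rewrite add0r.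
    have e20 : 0 < e / 2 by rewrite divr_gt0.
    have := H _ e20; lra.
  move=> e0; have [d2 d20 hd2] := @continuous_eps R R^o g s _ cg e0.
  pose a := Num.min (s + d2 / 2) ((s + b) / 2).
  have sa : s < a by rewrite /a lt_min ltrDl divr_gt0//= midf_lt.
  have ab : a < b by rewrite /a gt_min (midf_lt bs) orbT.
  have ga : g a <= e.
    suff H : `|g s - g a| <= e by move: H; rewrite gs sub0r normrN ger0_norm.
    apply: hd2; rewrite gtr0_norm ?subr_gt0// ltrBlDl /a gt_min; apply/orP; left.
    by rewrite ltrD2l ltr_pdivrMr// ltr_pMr// ltr1n.
  have hmu t : a <= t <= b -> \sum_(j < 3) `|f j t| <= g b.
    move=> /andP[h1 h2]; apply: hb; rewrite in_itv/= (le_trans (ltW sa))//=.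
    exact: le_trans bs'.
  have kk i := key i a b (g b) (le_lt_trans s0 sa) ab (le_lt_trans bs' s'tau) (g_ge0 b) hmu.
  apply: (@bootstrap_arith R L (g b) d e (g a) (g b) b a) => //.
  - exact: ltW.
  - by rewrite (le_trans s0)// ltW.
  - rewrite (@le_trans _ _ (s' - s))//; first by rewrite lerB// ltW.
    by rewrite /s' addrC addKr ltW.
  apply: (@le_trans _ _ (\sum_(j < 3) (`|f j a| + g b * L * (b - a)))).
    rewrite /g; apply: ler_sum => j _; rewrite -lerBlDl (le_trans _ (kk j))//.
    by rewrite lerB_dist.
  rewrite big_split/= lerD2l sum3; lra.
exists s'; first by rewrite ltrDl dh0/= /s' addrC -lerBrDr (le_trans (ltW dh)).
move=> t /andP[t0 ts']; have [ts|ts] := leP t s; first by rewrite hs ?t0.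
apply/le_anti; rewrite g_ge0 andbT (le_trans _ mu0)//; apply: hb.
by rewrite in_itv/= ts' ltW.
Qed.

(** Let s be the supremum of the times up to which all f_i vanish. By continuity
they vanish at s, and [extend] would go beyond s if s < t. *)
Lemma bootstrap t : 0 <= t < T -> forall i, f i t = 0.
Proof.
move=> /andP[t0 tT].
suff gt0 : g t = 0.
  move=> i; apply/eqP; rewrite -normr_eq0; apply/eqP/le_anti; rewrite normr_ge0 andbT.
  by rewrite -gt0 /g (bigD1 i)//= lerDl sumr_ge0.
pose A := [set s | 0 <= s <= t /\ forall r, 0 <= r <= s -> g r = 0].
have A0 : A 0.
  by split; [rewrite lexx t0|move=> r r0; rewrite (_ : r = 0)//; apply/le_anti; rewrite andbC].
have uA : ubound A t by move=> s [/andP[]].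
have hA : has_sup A by split; [exists 0|exists t].
pose s := sup A.
have s0 : 0 <= s by apply: ub_le_sup => //; exists t.
have st : s <= t by apply: ge_sup => //; exists 0.
have below r : 0 <= r < s -> g r = 0.
  move=> /andP[r0 rs]; have sr0 : 0 < s - r by rewrite subr_gt0.
  have [s' [_ hs'] rs'] := sup_adherent sr0 hA.
  by apply: hs'; rewrite r0 ltW//; move: rs'; rewrite -/s opprB addrC subrK.
have gs : g s = 0.
  move: s0; rewrite le_eqVlt => /orP[/eqP <-//|s0].
  exact: continuous_ext_zero below.
have hs r : 0 <= r <= s -> g r = 0.
  move=> /andP[r0]; rewrite le_eqVlt => /orP[/eqP ->//|rs]; apply: below; by rewrite r0.
move: st; rewrite le_eqVlt => /orP[/eqP <-//|st].
have [s' /andP[ss' s't] hs'] := extend s0 st tT hs.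
have : s' <= s.
  apply: ub_le_sup; first by exists t.
  by split => //; rewrite s't (le_trans s0)// ltW.
by rewrite leNgt ss'.
Qed.

End bootstrap.

(** The threshold [mm] is a third of the final radius r/(2E) of the core of the
tube. *)
Lemma tube_lower (R : realType) (r E q mm : R) : 0 < r -> 1 <= E ->
  r ^+ 2 / 4 <= E ^+ 2 * q -> mm = r / (6 * E) -> (3 * mm) ^+ 2 <= q.
Proof.
move=> r0 E1 h ->; have E0 : 0 < E by rewrite (lt_le_trans ltr01).
rewrite (_ : 3 * (r / (6 * E)) = r / 2 / E); last by field; rewrite gt_eqF.
rewrite expr_div_n ler_pdivrMr ?exprn_gt0// [q * _]mulrC (le_trans _ h)// expr_div_n.
by rewrite -[leLHS]mulr1; move: (r ^+ 2) => s; lra.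
Qed.

Lemma inward_drift (R : realType) (L mm q N : R) (x w : 'I_3 -> R) : 0 <= L -> 0 <= N ->
  0 <= mm -> N ^+ 2 <= q -> (3 * mm) ^+ 2 <= q -> (forall i, `|x i| <= N) ->
  (forall i, `|w i| <= 3 * L * N + mm) ->
  0 <= (9 * L + 1) * q + \sum_(i < 3) x i * w i.
Proof.
move=> L0 N0 m0 Nq mq xN wN.
have q0 : 0 <= q by apply: le_trans Nq; exact: sqr_ge0.
have h i : - (N * (3 * L * N + mm)) <= x i * w i.
  rewrite lerNl -mulNr (le_trans (ler_norm _))// normrM normrN.
  by apply: ler_pM.
have h3 : N * (3 * mm) <= q.
  rewrite -(@ler_pXn2r _ 2) ?nnegrE ?mulr_ge0// exprMn expr2.
  by apply: ler_pM; rewrite ?sqr_ge0.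
have h4 : 9 * L * N ^+ 2 <= 9 * L * q by rewrite ler_wpM2l// mulr_ge0.
have := h 0; have := h 1; have := h 2%:R; rewrite sum3.
have -> : N * (3 * L * N + mm) = (9 * L * N ^+ 2 + N * (3 * mm)) / 3 by field.
move: h3 h4; rewrite [(9 * L + 1) * q]mulrDl mul1r.
move: (x 0 * _) (x 1 * _) (x 2%:R * _) (9 * L * N ^+ 2) (9 * L * q) (N * (3 * mm)) => X Y Z A B C; lra.
Qed.

(** [vacuum_tube] and [transport_estimate] are applied on [0, tau] as long as the
deviation of the velocity from c stays below m. The inequality
z.w >= -(9L + 1)|z|^2 has to hold in the shell r^2/4 <= exp(2Kt)|z|^2 <= r^2,
where |z| >= r/2 exp(-KT): hence the choice of m. The transport estimate uses
test functions within distance r1 of the line, inside the core of the tube. *)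
Lemma rest_along_line (R : realType) (T a L r : R) (P : R * 'rV[R]_3 -> R)
    (U : 'I_3 -> R * 'rV[R]_3 -> R) (x0 c : 'rV[R]_3) :
  0 < a -> (forall z, 0 <= P z) -> continuous (fun z => P z `^ a) ->
  (forall j, continuous (U j)) -> 0 <= L -> 0 < r ->
  (forall i j z, derivable (U i) z (espace R j)) ->
  (forall i j z, `|'D_(espace R j) (U i) z| <= L) ->
  (forall i t x y, `|U i (t, x) - U i (t, y)| <= 3 * L * `|x - y|) ->
  (forall phi, test_function (slab T) phi ->
    int4 (fun z => P z * ('D_(etime R) phi z +
      \sum_(j < 3) U j z * 'D_(espace R j) phi z)) = 0) ->
  (forall i phi, test_function (slab T) phi ->
    {ae leb_tx R, forall z, phi (vec4 z) != 0 -> P (vec4 z) = 0} ->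
    int4 (fun z => U i z * 'D_(etime R) phi z) =
    int4 (fun z => (\sum_(j < 3) U j z * 'D_(espace R j) (U i) z) * phi z)) ->
  (forall e, 0 < e -> exists2 d, 0 < d &
    forall z, 0 <= z.1 < d -> `|z.2 - x0| <= 2 * r -> P z <= e) ->
  (forall i, U i (0, x0) = c 0 i) ->
  forall t, 0 <= t < T -> forall i, U i (t, x0 + t *: c) = c 0 i.
Proof.
move=> a0 P0 cP cU L0 r0 dU dUL lipU hCE hTr hP0 hU0 t tT i.
have T0 : 0 < T by case/andP: tT; exact: le_lt_trans.
pose F i t := U i (t, x0 + t *: c) - c 0 i.
pose K := 9 * L + 1.
have K0 : 0 <= K by rewrite addr_ge0// mulr_ge0.
pose E := expR (K * T).
have E1 : 1 <= E by rewrite -expR0 ler_expR mulr_ge0// ltW.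
have E0 : 0 < E by exact: expR_gt0.
pose m := r / (6 * E).
have m0 : 0 < m by rewrite divr_gt0// mulr_gt0.
pose r1 := r / (2 * E).
have r10 : 0 < r1 by rewrite divr_gt0// mulr_gt0.
have tubeE z : 0 <= z.1 <= T -> tubeq K x0 c z <= E ^+ 2 * sqn (frame x0 c z).
  move=> /andP[z0 zT]; rewrite /tubeq ler_wpM2r ?sqn_ge0// /E -expRM_natl ler_expR.
  by rewrite -mulrA ler_wpM2l// ler_wpM2l.
apply/eqP; rewrite -subr_eq0 -/(F i t); apply/eqP.
apply: (@bootstrap R T m L F L0 m0) => //.
- move=> k s; apply: cvgB; last exact: cvg_cst.
  apply: (@continuous_comp _ _ _ (fun t : R => (t, x0 + t *: c)) (U k)); last exact: cU.
  exact: continuous_line.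
- by move=> k; rewrite /F scale0r addr0 hU0 subrr.
move=> tau tau0 tauT hm k p q mu.
have hw z : 0 <= z.1 <= tau -> r ^+ 2 / 4 <= tubeq K x0 c z <= r ^+ 2 ->
    0 <= K * sqn (frame x0 c z) + \sum_(i < 3) frame x0 c z 0 i * (U i z - c 0 i).
  move=> /andP[z0 zt] /andP[h1 _].
  have h2 : (3 * m) ^+ 2 <= sqn (frame x0 c z).
    apply: (@tube_lower R r E _ m r0 E1 _ erefl); apply: (le_trans h1); apply: tubeE.
    by rewrite z0/= (le_trans zt)// ltW.
  apply: (@inward_drift R L m _ `|frame x0 c z|) => //.
  - exact: ltW.
  - exact: norm_sqn.
  - by move=> j; exact: le_coord.
  move=> j; rewrite (_ : U j z - c 0 j = (U j z - U j (z.1, x0 + z.1 *: c)) + F j z.1); last first.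
    by rewrite /F; ring.
  rewrite (le_trans (ler_normD _ _))//; apply: lerD.
    by rewrite [X in U j X]surjective_pairing; exact: lipU.
  apply: (@le_trans _ _ (\sum_(j < 3) `|F j z.1|)); last by apply: hm; rewrite z0.
  by rewrite (bigD1 j)//= lerDl sumr_ge0.
apply: (@transport_estimate R T tau r1 L U x0 c r10 L0 tauT cU dU dUL lipU).
move=> j phi tphi [e e0 hphi]; apply: hTr => //.
have V := vacuum_tube a0 P0 cP cU hCE tauT r0 K0 hP0 hw e0.
apply: ae_imp V => z hz /hphi[h1 h2]; apply: hz => //.
have zT : 0 <= (vec4 z).1 <= T.
  by case/andP: h1 => h3 h4; rewrite (le_trans (ltW e0) (ltW h3)) (le_trans (ltW h4))// ltW.
apply: (le_trans (tubeE _ zT)); apply: (@le_trans _ _ (E ^+ 2 * r1 ^+ 2)).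
  by rewrite ler_wpM2l// sqr_ge0.
by rewrite le_eqVlt; apply/orP; left; apply/eqP; rewrite /r1; field; rewrite gt_eqF.
Qed.

(** * The straight-line flow and its hyperbolic degeneracy *)

Lemma expansion_line (R : realType) (f : 'rV[R]_3 -> R) (v x : 'rV[R]_3) (h C s : R) :
  C1 f -> (forall t : R, `|t| <= `|h| -> `|'D_v f (x + t *: v) - s| <= C) ->
  `|f (x + h *: v) - f x - h * s| <= C * `|h|.
Proof.
move=> fC.
have pos (y w : 'rV[R]_3) (k r : R) : 0 < k ->
    (forall t : R, 0 <= t <= k -> `|'D_w f (y + t *: w) - r| <= C) ->
    `|f (y + k *: w) - f y - k * r| <= C * k.
  move=> k0 hC.
  have d (t : R) : is_derive t 1 (fun s : R => f (y + s *: w)) ('D_w f (y + t *: w)).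
    by apply: is_derive_line; exact: C1_is_derive.
  have [|c] := @MVT _ (fun s : R => f (y + s *: w)) (fun t => 'D_w f (y + t *: w)) 0 k k0
      (fun t _ => d t).
    by apply: continuous_subspaceT => t; apply: is_derive1_cont; exact: d.
  rewrite in_itv/= scale0r addr0 subr0 => /andP[c0 ck] ->.
  rewrite [k * r]mulrC -mulrBl normrM (gtr0_norm k0) ler_wpM2r//; first exact: ltW.
  by apply: hC; rewrite !ltW.
move=> hC; have [h0|h0|->] := ltrgtP h 0; last 2 first.
- rewrite (gtr0_norm h0); apply: pos => // t /andP[t0 th]; apply: hC.
  by rewrite (gtr0_norm h0) ger0_norm.
- by rewrite scale0r addr0 mul0r subr0 subrr normr0 mulr0.
have nh0 : 0 < - h by rewrite oppr_gt0.
have := @pos (x + h *: v) v (- h) s nh0 _.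
have -> : x + h *: v + - h *: v = x by rewrite scaleNr addrK.
rewrite (ltr0_norm h0) => H; rewrite -normrN opprB (_ : h * s - _ = f x - f (x + h *: v) - - h * s); last by ring.
apply: H => t /andP[t0 th].
have -> : x + h *: v + t *: v = x + (h + t) *: v by rewrite scalerDl addrA.
by apply: hC; rewrite (ltr0_norm h0) ler_norml; apply/andP; split; lra.
Qed.

(** Three moves along the axes, each controlled by the mean value theorem and the
continuity of one partial derivative. *)
Lemma C1_expansion (R : realType) (f : 'rV[R]_3 -> R) (x : 'rV[R]_3) (e : R) :
  C1 f -> 0 < e -> exists2 d : R, 0 < d & forall w : 'rV[R]_3, `|w| < d ->
    `|f (x + w) - f x - \sum_(j < 3) w 0 j * 'D_(evec R j) f x| <= 3 * (e * `|w|).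
Proof.
move=> fC e0.
have near_j j : exists2 d : R, 0 < d & forall y, `|y - x| < d ->
    `|'D_(evec R j) f y - 'D_(evec R j) f x| <= e.
  have [d d0 hd] := continuous_eps x (fC.2 (evec R j)).2 e0.
  by exists d => // y hy; rewrite distrC; exact: hd.
have [d0 d00 h0] := near_j 0; have [d1 d10 h1] := near_j 1.
have [d2 d20 h2] := near_j 2%:R.
pose d := Num.min d0 (Num.min d1 d2).
have dd : 0 < d by rewrite /d !lt_min d00 d10.
exists (d / 3) => [|w hw]; first by rewrite divr_gt0.
pose y1 := x + w 0 0 *: evec R 0; pose y2 := y1 + w 0 1 *: evec R 1.
have wE : x + w = y2 + w 0 2%:R *: evec R 2%:R.
  by rewrite /y2 /y1 -!addrA {1}[w]row_sum_evec -addrA.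
have near_x (a b c : R) : `|a| <= `|w| -> `|b| <= `|w| -> `|c| <= `|w| ->
    `|x + a *: evec R 0 + b *: evec R 1 + c *: evec R 2%:R - x| < d.
  move=> ha hb hc.
  have -> : x + a *: evec R 0 + b *: evec R 1 + c *: evec R 2%:R - x =
      a *: evec R 0 + b *: evec R 1 + c *: evec R 2%:R by apply/rowP => k; rewrite !mxE; ring.
  have n1 i : `|evec R i| <= 1.
    by apply: norm_le_coord => // k; rewrite mxE; case: (_ && _); rewrite ?normr1 ?normr0.
  have st (k : R) i : `|k| <= `|w| -> `|k *: evec R i| <= `|w|.
    by move=> hk; rewrite normrZ (le_trans _ hk)// ler_piMr.
  have hwd : 3 * `|w| < d by rewrite mulrC -ltr_pdivlMr.
  apply: le_lt_trans hwd; rewrite (le_trans (ler_normD _ _))//.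
  rewrite (_ : 3 * `|w| = `|w| + `|w| + `|w|); last by ring.
  apply: lerD; last exact: st.
  by rewrite (le_trans (ler_normD _ _))//; apply: lerD; exact: st.
have step_j j (y : 'rV[R]_3) (dj : R) : 0 < dj -> d <= dj ->
    (forall y, `|y - x| < dj -> `|'D_(evec R j) f y - 'D_(evec R j) f x| <= e) ->
    (forall t : R, `|t| <= `|w 0 j| -> `|y + t *: evec R j - x| < d) ->
    `|f (y + w 0 j *: evec R j) - f y - w 0 j * 'D_(evec R j) f x| <= e * `|w|.
  move=> dj0 ddj hj hy.
  apply: (@le_trans _ _ (e * `|w 0 j|)); last by rewrite ler_wpM2l ?le_coord// ltW.
  by apply: expansion_line => // t /hy h; apply: hj; exact: lt_le_trans ddj.
have w0 : `|0 : R| <= `|w| by rewrite normr0.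
have s0 : `|f y1 - f x - w 0 0 * 'D_(evec R 0) f x| <= e * `|w|.
  apply: (@step_j 0 x d0) => //; first by rewrite /d ge_min lexx.
  move=> t ht; have := near_x t 0 0 (le_trans ht (le_coord _ _)) w0 w0.
  by rewrite !scale0r !addr0.
have s1 : `|f y2 - f y1 - w 0 1 * 'D_(evec R 1) f x| <= e * `|w|.
  apply: (@step_j 1 y1 d1) => //; first by rewrite /d !ge_min lexx orbT.
  move=> t ht; have := near_x (w 0 0) t 0 (le_coord _ _) (le_trans ht (le_coord _ _)) w0.
  by rewrite !scale0r !addr0.
have s2 : `|f (x + w) - f y2 - w 0 2%:R * 'D_(evec R 2%:R) f x| <= e * `|w|.
  rewrite wE; apply: (@step_j 2%:R y2 d2) => //; first by rewrite /d !ge_min lexx !orbT.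
  move=> t ht; exact: near_x (le_coord _ _) (le_coord _ _) (le_trans ht (le_coord _ _)).
rewrite sum3 (_ : _ - _ = (f (x + w) - f y2 - w 0 2%:R * 'D_(evec R 2%:R) f x) +
  (f y2 - f y1 - w 0 1 * 'D_(evec R 1) f x) + (f y1 - f x - w 0 0 * 'D_(evec R 0) f x)); last by ring.
exact: norm_add3_le.
Qed.

Lemma ord3_cases (i : 'I_3) : [\/ i = 0, i = 1 | i = 2%:R].
Proof.
by case: i => -[|[|[|//]]] p; [constructor 1|constructor 2|constructor 3]; exact/val_inj.
Qed.

(** [eigenvalue] is defined by row vectors multiplied on the left; a matrix and its
transpose have the same eigenvalues. *)
Lemma eigenvalue_col (R : realType) (G : 'M[R]_3) (lam : R) : eigenvalue G lam ->
  exists2 v : 'rV[R]_3, v != 0 & forall i, \sum_(j < 3) v 0 j * G i j = lam * v 0 i.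
Proof.
move=> ev; have : eigenvalue G^T lam.
  rewrite /eigenvalue /eigenspace kermx_eq0 row_free_unit.
  rewrite (_ : G^T - lam%:M = (G - lam%:M)^T); last by rewrite linearB /= tr_scalar_mx.
  by rewrite unitmx_tr -row_free_unit -kermx_eq0.
move=> /eigenvalueP[v vG v0]; exists v => // i.
have /matrixP/(_ 0 i) := vG; rewrite !mxE => <-.
by apply: eq_bigr => j _; rewrite mxE.
Qed.

Lemma collapse_arith (R : realType) (lam ts C e w D : R) : lam < 0 -> ts = - lam^-1 ->
  0 <= C -> 0 < w -> e * (6 * (1 + C * ts)) = - lam ->
  - lam * w <= D + 3 * (e * w) -> D <= C * (ts * (3 * (e * w))) -> False.
Proof.
move=> l0 tsE C0 w0 eE h1 h2.
have h3 : - lam * w <= e * (6 * (1 + C * ts)) * w / 2.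
  apply: (le_trans h1); apply: (@le_trans _ _ (C * (ts * (3 * (e * w))) + 3 * (e * w))).
    by rewrite lerD2r.
  by rewrite le_eqVlt; apply/orP; left; apply/eqP; field.
have : 0 < - lam * w by rewrite mulr_gt0// oppr_gt0.
move: h3; rewrite eE; lra.
Qed.

(** The flow map x + t u0(x) loses rank at the time -1/lam in the direction of an
eigenvector, whereas the values of u0 vary at first order in that direction, so
they cannot be transported by a Lipschitz field. *)
Lemma flow_collapse (R : realType) (u0 U : 'rV[R]_3 -> 'rV[R]_3) (x0 : 'rV[R]_3)
    (V : set 'rV[R]_3) (lam C : R) :
  open V -> V x0 -> (forall i, C1 (fun x => u0 x 0 i)) ->
  eigenvalue (grad u0 x0) lam -> lam < 0 -> 0 <= C ->
  (forall i x y, `|U x 0 i - U y 0 i| <= C * `|x - y|) ->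
  (forall x, V x -> forall i, U (x + (- lam^-1) *: u0 x) 0 i = u0 x 0 i) -> False.
Proof.
move=> oV Vx0 uC ev l0 C0 lipU hU; pose ts := - lam^-1.
have ts0 : 0 < ts by rewrite oppr_gt0 invr_lt0.
have [v v0 hv] := eigenvalue_col ev.
have D0 : 0 < 6 * (1 + C * ts) by rewrite mulr_gt0// ltr_pwDl// mulr_ge0// ltW.
pose e := - lam / (6 * (1 + C * ts)).
have e0 : 0 < e by rewrite divr_gt0// oppr_gt0.
have eE : e * (6 * (1 + C * ts)) = - lam by rewrite /e divfK// gt_eqF.
have [da da0 ha] := C1_expansion x0 (uC 0) e0.
have [db db0 hb] := C1_expansion x0 (uC 1) e0.
have [dc dc0 hc] := C1_expansion x0 (uC 2%:R) e0.
have [dV /= dV0 hV] : exists2 d : R, 0 < d & forall y, `|y - x0| < d -> V y.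
  have /nbhs_normP[d /= dd hd] : nbhs x0 V by exact: open_nbhs_nbhs.
  by exists d => // y hy; apply: hd; rewrite /= distrC.
pose d := Num.min (Num.min da db) (Num.min dc dV).
have d0 : 0 < d by rewrite /d !lt_min da0 db0 dc0.
have nv0 : 0 < `|v| by rewrite normr_gt0.
pose h := d / (2 * `|v|).
have h0 : 0 < h by rewrite divr_gt0// mulr_gt0.
pose w := h *: v.
have wd : `|w| < d.
  rewrite normrZ gtr0_norm// /h (_ : d / (2 * `|v|) * `|v| = d / 2).
    by rewrite ltr_pdivrMr// ltr_pMr// ltr1n.
  by field; rewrite gt_eqF.
have w0 : 0 < `|w| by rewrite normrZ mulr_gt0// normr_gt0 gt_eqF.
have exp i : `|u0 (x0 + w) 0 i - u0 x0 0 i - lam * w 0 i| <= 3 * (e * `|w|).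
  have E f : (forall w : 'rV[R]_3, `|w| < f -> `|u0 (x0 + w) 0 i - u0 x0 0 i -
      \sum_(j < 3) w 0 j * 'D_(evec R j) (fun x => u0 x 0 i) x0| <= 3 * (e * `|w|)) ->
      d <= f -> `|u0 (x0 + w) 0 i - u0 x0 0 i - lam * w 0 i| <= 3 * (e * `|w|).
    move=> hf df; have := hf w (lt_le_trans wd df).
    congr (`|_ - _| <= _); rewrite /w mxE mulrCA -hv mulr_sumr; apply: eq_bigr => j _.
    by rewrite !mxE mulrA.
  move: E; have [->|->|->] := ord3_cases i => E.
  - by apply: E ha _; rewrite /d !ge_min lexx.
  - by apply: E hb _; rewrite /d !ge_min lexx !orbT.
  - by apply: E hc _; rewrite /d !ge_min lexx !orbT.
pose Du := u0 (x0 + w) - u0 x0.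
have Vw : V (x0 + w).
  by apply: hV; rewrite addrC addKr (lt_le_trans wd)// /d !ge_min lexx !orbT.
pose rest := Du - lam *: w.
(* The first-order parts w and ts lam w = -w of the displacement cancel, which
   leaves ts rest below. *)
have nrest : `|rest| <= 3 * (e * `|w|).
  apply: norm_le_coord; first by rewrite mulr_ge0// mulr_ge0// ltW.
  by move=> i; have := exp i; rewrite !mxE.
have shift_ : (x0 + w + ts *: u0 (x0 + w)) - (x0 + ts *: u0 x0) = ts *: rest.
  rewrite /rest /Du; apply/rowP => k; rewrite !mxE /ts.
  have l1 : lam != 0 by rewrite lt_eqF.
  by field.
have nDu : `|Du| <= C * (ts * (3 * (e * `|w|))).
  apply: norm_le_coord; first by rewrite mulr_ge0// mulr_ge0 ?(ltW ts0)// mulr_ge0// mulr_ge0// ltW.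
  move=> i; rewrite !mxE -(hU _ Vw i) -(hU _ Vx0 i) (le_trans (lipU _ _ _))//.
  by rewrite -/ts shift_ ler_wpM2l// normrZ gtr0_norm// ler_wpM2l// ltW.
apply: (@collapse_arith R lam ts C e `|w| `|Du| l0 erefl C0 w0 eE _ nDu).
rewrite -(ltr0_norm l0) -normrZ (_ : lam *: w = Du - rest); last by rewrite /rest opprB addrC subrK.
by rewrite (le_trans (ler_normB _ _))// lerD2l.
Qed.

(** * From regular solutions to the straight-line flow *)

Lemma derive_slice (R : realType) (F : R * 'rV[R]_3 -> R) (v : 'rV[R]_3) z :
  (derivable F z (0, v) <-> derivable (fun x => F (z.1, x)) z.2 v) /\
  'D_((0, v) : R * 'rV[R]_3) F z = 'D_v (fun x => F (z.1, x)) z.2.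
Proof.
have e : (fun h : R => h^-1 *: ((F \o shift z) (h *: ((0, v) : R * 'rV[R]_3)) - F z)) =
    (fun h : R => h^-1 *: (((fun x => F (z.1, x)) \o shift z.2) (h *: v) - F (z.1, z.2))).
  apply/funext => h /=; congr (_ *: (_ - _)); last by rewrite -surjective_pairing.
  by congr F; case: z => t x; rewrite /= -[LHS]/(h * 0 + t, h *: v + x) mulr0 add0r.
by split; [rewrite /derivable e|rewrite /derive e].
Qed.

(** The compact support of a test function lies in a box, whose preimage in the
triple product is visibly measurable. *)
Lemma slab_box (R : realType) (T : R) (K : set (R * 'rV[R]_3)) : compact K -> K `<=` slab T ->
  exists a b M : R, [/\ 0 < a, b < T & forall z, K z -> a <= z.1 <= b /\ `|z.2| <= M].
Proof.
move=> cK KT; have [M hM] := compact_norm_bound cK.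
have [[z0 Kz0]|K0] := pselect (K !=set0); last first.
  exists 1, (T - 1), 0; split=> // [|z Kz]; first by rewrite ltrBlDr ltrDl.
  by exfalso; apply: K0; exists z.
have cf : {within K, continuous (fst : R * 'rV[R]_3 -> R)}.
  by apply: continuous_subspaceT => z; exact: cvg_fst.
have K0 : K !=set0 by exists z0.
have [za Ka ha] := compact_EVT_min K0 cK cf.
have [zb Kb hb] := compact_EVT_max K0 cK cf.
rewrite inE in Ka; rewrite inE in Kb.
exists za.1, zb.1, M; split; [by case/andP: (KT _ Ka)|by case/andP: (KT _ Kb)|].
move=> z Kz; split; first by rewrite ha ?hb// inE.
have : `|z| <= M by rewrite leNgt; apply/negP => /hM; apply.
by rewrite prod_normE ge_max => /andP[].
Qed.

Lemma int_tx_int4 (R : realType) (T : R) (F : R -> 'rV[R]_3 -> R) (G : R * 'rV[R]_3 -> R) :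
  (forall z, ~ slab T z -> G z = 0) ->
  (forall t x, 0 < t < T -> F t x = G (t, x)) ->
  int_tx T F = int4 G.
Proof.
move=> G0 FG; rewrite /int4.
rewrite -(@Rintegral_support _ _ _ (leb_tx R) (`]0, T[ `*` setT)); last first.
  move=> z hz /=; apply: G0 => h; apply: hz; split => //=; by rewrite in_itv.
apply: eq_Rintegral => z; rewrite inE => -[/=]; rewrite in_itv/= => zT _.
exact: FG.
Qed.

Lemma ae_imp2 d (X : measurableType d) (R : realType) (mu : {measure set X -> \bar R})
    (P Q S : X -> Prop) : (forall x, P x -> Q x -> S x) ->
  {ae mu, forall x, P x} -> {ae mu, forall x, Q x} -> {ae mu, forall x, S x}.
Proof.
move=> PQS hP hQ; apply: (negligibleS _ (negligibleU hP hQ)) => x /= nS.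
have [Px|nP] := pselect (P x); last by left.
by right => Qx; apply: nS; exact: PQS.
Qed.

Section regular.
Variables (R : realType) (A alpha beta gamma delta : R)
  (rho0 : 'rV[R]_3 -> R) (u0 : 'rV[R]_3 -> 'rV[R]_3) (T : R)
  (rho : R -> 'rV[R]_3 -> R) (u : R -> 'rV[R]_3 -> 'rV[R]_3).
Hypotheses (T0 : 0 < T) (hdelta : 1 < delta)
  (S : regular_solution A alpha beta gamma delta rho0 u0 T rho u).

Let a := (delta - 1) / 2.
Let P (z : R * 'rV[R]_3) := rho (clamp T z.1) z.2.
Let U (i : 'I_3) (z : R * 'rV[R]_3) := u (clamp T z.1) z.2 0 i.

Let a0 : 0 < a. Proof. by rewrite divr_gt0// subr_gt0. Qed.

Let inT t : clamp T t \in `[0, T]. Proof. exact: clamp_in (ltW T0). Qed.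

Let unif_rho : unif_time_cont (fun t x => rho (clamp T t) x `^ a).
Proof.
apply: (CtH_unif (F := fun t x => rho t x `^ a) (ltW T0) _ (rs_delta S)); first by lra.
by move=> t tT; case: (rs_rep_delta S tT).
Qed.

Let unif_u i : unif_time_cont (fun t x => u (clamp T t) x 0 i).
Proof.
apply: (CtH_unif (s := 2) (F := fun t x => u t x 0 i) (ltW T0)) => //.
  by apply: (rs_u_Hs S); rewrite lexx ltr_nat.
by move=> t tT; case: (rs_rep_u S i tT).
Qed.

Let cP : continuous (fun z => P z `^ a).
Proof.
apply: (@joint_continuous R _ (fun t x => rho (clamp T t) x `^ a)); last exact: unif_rho.
by move=> t; case: (rs_rep_delta S (inT t)).
Qed.

Let cU i : continuous (U i).
Proof.
apply: (@joint_continuous R _ (fun t x => u (clamp T t) x 0 i)); last exact: unif_u.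
by move=> t; case: (rs_rep_u S i (inT t)).
Qed.

Let P_ge0 z : 0 <= P z. Proof. exact: (rs_rho_ge0 S). Qed.

Let dU i j z : derivable (U i) z (espace R j).
Proof.
apply/(derive_slice (U i) (evec R j) z).1.
by have [] := (rs_rep_u S i (inT z.1)).2 (evec R j).
Qed.

Let DU i j z : 'D_(espace R j) (U i) z = grad (u (clamp T z.1)) z.2 i j.
Proof. by rewrite (derive_slice (U i) (evec R j) z).2 mxE. Qed.

Let lipschitz_const : exists2 L : R, 0 <= L &
  forall i j z, `|'D_(espace R j) (U i) z| <= L.
Proof.
have H i : exists2 L : R, 0 <= L & forall j z, `|'D_(espace R j) (U i) z| <= L.
  have [L L0 hL] := solution_lipschitz T0 (rs_u_Linfty S i)
    (fun t tT => rs_rep_u S i tT) (@unif_u i).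
  by exists L => // j z; rewrite (derive_slice (U i) (evec R j) z).2; exact: hL.
have [L0 L00 h0] := H 0; have [L1 L10 h1] := H 1; have [L2 L20 h2] := H 2%:R.
exists (L0 + L1 + L2) => [|i j z]; first by rewrite !addr_ge0.
have [->|->|->] := ord3_cases i.
- by rewrite (le_trans (h0 _ _))// -addrA lerDl addr_ge0.
- by rewrite (le_trans (h1 _ _))// addrAC lerDr addr_ge0.
- by rewrite (le_trans (h2 _ _))// lerDr addr_ge0.
Qed.

Let phi_off (phi : R * 'rV[R]_3 -> R) v z : test_function (slab T) phi -> ~ slab T z ->
  phi z = 0 /\ 'D_v phi z = 0.
Proof.
move=> [sphi [K [cK KT phi0]]] nz; have nK : ~ K z by move=> /KT.
split; first exact: phi0.
by have := derive_off_compact v cK phi0 nK; move=> /@derive_val.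
Qed.

Let mass phi : test_function (slab T) phi ->
  int4 (fun z => P z * ('D_(etime R) phi z + \sum_(j < 3) U j z * 'D_(espace R j) phi z)) = 0.
Proof.
move=> tphi; rewrite -[RHS](rs_continuity S tphi); apply/esym; apply: int_tx_int4.
  move=> z nz; rewrite (phi_off (etime R) tphi nz).2 big1 ?addr0 ?mulr0// => j _.
  by rewrite (phi_off (espace R j) tphi nz).2 mulr0.
move=> t x tT; rewrite /P /U /= clamp_id ?in_itv/=; last by case/andP: tT => ? ?; rewrite !ltW.
rewrite mulrDr mulr_sumr; congr (_ + _); apply: eq_bigr => j _; by rewrite mulrA.
Qed.

(* On the support of phi the density vanishes almost everywhere, so the
   distribution u_t is the function -u.grad u there. *)
Let transport i phi : test_function (slab T) phi ->
  {ae leb_tx R, forall z, phi (vec4 z) != 0 -> P (vec4 z) = 0} ->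
  int4 (fun z => U i z * 'D_(etime R) phi z) =
  int4 (fun z => (\sum_(j < 3) U j z * 'D_(espace R j) (U i) z) * phi z).
Proof.
move=> tphi vac; have [ut [hut aeut]] := rs_vacuum S.
have [iut wut] := hut i.
have [sphi [K [cK KT phi0]]] := tphi.
have [b [b' [M [b0 bT hK]]]] := slab_box cK KT.
pose B := (`[b, b']%classic `*` [set y : 'rV[R]_3 | `|y| <= M]).
have cB : compact B by exact: compact_tube.
have BT : B `<=` slab T.
  move=> z [] /=; rewrite in_itv/= => /andP[h1 h2] _.
  by rewrite /slab/= (lt_le_trans b0 h1) (le_lt_trans h2 bT).
have phiB z : ~ B z -> phi z = 0.
  by move=> nB; apply: phi0 => /hK[h1 h2]; apply: nB; split => //=; rewrite in_itv.
pose B4 := [set z : E4 R | B (z.1, vec3 z.2)].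
have B4E : B4 = `[b, b']%classic `*` cball3 M by apply/seteqP; split => z.
have mB4 : measurable B4.
  by rewrite B4E; apply: measurableX; [exact: measurable_itv|exact: measurable_cball3].
have mut : measurable_fun B4 (fun z : E4 R => ut z.1 (vec3 z.2) 0 i).
  by have /integrableP[/measurable_EFinP] := iut B cB BT.
have inside t : 0 < t < T -> clamp T t = t.
  by move=> /andP[h1 h2]; apply: clamp_id; rewrite in_itv/= !ltW.
have lhs : int_tx T (fun t x => u t x 0 i * Dt phi t x) =
    int4 (fun z => U i z * 'D_(etime R) phi z).
  apply: int_tx_int4 => [z nz|t x tT]; first by rewrite (phi_off (etime R) tphi nz).2 mulr0.
  by rewrite /U /= inside.
rewrite -lhs wut//.
rewrite (@int_tx_int4 R T _ (fun z => ut z.1 z.2 0 i * phi z))//; last first.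
  by move=> z nz; rewrite (phi_off (etime R) tphi nz).1 mulr0.
pose G z := - (\sum_(j < 3) U j z * 'D_(espace R j) (U i) z) * phi z.
have mDU j : measurable_fun (setT : set (E4 R)) ('D_(espace R j) (U i) \o @vec4 R).
  by apply: measurable_derive4 => // z; exact: dU.
have mphi : measurable_fun (setT : set (E4 R)) (phi \o @vec4 R).
  exact: measurable_vec4 (smooth_continuous sphi).
have mG : measurable_fun (setT : set (E4 R)) (G \o @vec4 R).
  rewrite (_ : _ \o _ = fun z => - (U 0 (vec4 z) * 'D_(espace R 0) (U i) (vec4 z)
     + U 1 (vec4 z) * 'D_(espace R 1) (U i) (vec4 z)
     + U 2%:R (vec4 z) * 'D_(espace R 2%:R) (U i) (vec4 z)) * phi (vec4 z)); last first.
    by apply/funext => z; rewrite /G /= sum3.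
  have mt j : measurable_fun (setT : set (E4 R))
      (fun z => U j (vec4 z) * 'D_(espace R j) (U i) (vec4 z)).
    by apply: measurable_funM; [exact: (measurable_vec4 (@cU j))|exact: mDU].
  apply: measurable_funM => //; apply: measurableT_comp => //.
  by apply: measurable_funD => //; exact: measurable_funD.
have -> : int4 (fun z => (\sum_(j < 3) U j z * 'D_(espace R j) (U i) z) * phi z) = - int4 G.
  have GE : G = fun z => - 1 * ((\sum_(j < 3) U j z * 'D_(espace R j) (U i) z) * phi z).
    by apply/funext => z; rewrite /G !mulNr mul1r.
  have [L L0 hL] := lipschitz_const.
  have ij j : (leb_tx R).-integrable setT
      (EFin \o ((fun z => 'D_(espace R j) (U i) z * (U j z * phi z)) \o @vec4 R)).
    apply: (integrable4_Mcont (C := L) (K := K)) => //.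
      exact: continuous_mul (@cU j) (smooth_continuous sphi).
    by move=> z /phi0 ->; rewrite mulr0.
  have [iS _] := int4_sum3 ij.
  rewrite GE int4Zl ?mulNr ?mul1r ?opprK//.
  rewrite (_ : (fun z => _) = fun z => \sum_(j < 3) 'D_(espace R j) (U i) z * (U j z * phi z))//.
  apply/funext => z; rewrite mulr_suml; apply: eq_bigr => j _; by rewrite -mulrA mulrCA.
congr (- _); rewrite /int4 -!(@Rintegral_support _ _ _ (leb_tx R) B4); last 2 first.
- by move=> z nB /=; rewrite /G phiB ?mulr0//.
- by move=> z nB /=; rewrite phiB ?mulr0//.
rewrite /Rintegral; congr fine; apply: ae_eq_integral => //.
- apply/measurable_EFinP; apply: measurable_funM => //.
  exact: measurable_funS mphi.
- by apply/measurable_EFinP; exact: measurable_funS mG.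
apply: (ae_imp2 _ vac aeut) => z vz uz Bz; congr EFin.
have zT : 0 < z.1 < T by exact: (BT _ Bz).
rewrite /G /=; have [->|pz] := eqVneq (phi (vec4 z)) 0; first by rewrite !mulr0.
congr (_ * _); have Pz := vz pz; rewrite /P /= inside// in Pz.
have := uz zT Pz i; move/eqP; rewrite addr_eq0 => /eqP ->.
congr (- _); apply: eq_bigr => j _; by rewrite DU /U /= inside.
Qed.

(** [rest_along_line] applies: near a point of V the density vanishes initially,
hence is uniformly small at small times by continuity in time. *)
Lemma regular_rest (V : set 'rV[R]_3) (x : 'rV[R]_3) (t : R) : open V ->
  (forall x, V x -> rho0 x = 0) -> V x -> 0 <= t < T ->
  forall i, u t (x + t *: u0 x) 0 i = u0 x 0 i.
Proof.
move=> oV V0 Vx tT i; have [L L0 hL] := lipschitz_const.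
have [d /= d0 hd] : exists2 d : R, 0 < d & forall y, `|y - x| < d -> V y.
  have /nbhs_normP[d /= dd hd] : nbhs x V by exact: open_nbhs_nbhs.
  by exists d => // y hy; apply: hd; rewrite /= distrC.
have c0 : clamp T 0 = 0 by apply: clamp_id; rewrite in_itv/= lexx ltW.
have tE : clamp T t = t by apply: clamp_id; rewrite in_itv/=; case/andP: tT => -> /ltW ->.
have := @rest_along_line R T a L (d / 4) P U x (u0 x) a0 P_ge0 cP cU L0 _ dU hL _ mass transport.
rewrite (_ : u t (x + t *: u0 x) 0 i = U i (t, x + t *: u0 x)); last by rewrite /U /= tE.
apply => //.
- by rewrite divr_gt0.
- move=> k s y z.
  apply: (lip_of_partials (f := fun y => u (clamp T s) y 0 k)).
    exact: (rs_rep_u S k (inT s)).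
  by move=> j w; have := hL k j (s, w); rewrite (derive_slice (U k) (evec R j) (s, w)).2.
- move=> e e0.
  have ea0 : 0 < e `^ a by rewrite powR_gt0.
  have [dt dt0 hdt] := unif_rho 0 ea0.
  exists dt => // z /andP[z0 zd] zx.
  have Vz : V z.2.
    by apply: hd; rewrite (le_lt_trans zx)//; lra.
  have := hdt z.1; rewrite subr0 ger0_norm// => /(_ zd z.2).
  rewrite c0 (rs_initial_rho S) (V0 _ Vz) powR0 ?gt_eqF// subr0 ger0_norm ?powR_ge0//.
  move=> /(powR_le_root a0 (P_ge0 z)).
  by rewrite -powRrM divff ?gt_eqF// powRr1// ltW.
- by move=> k; rewrite /U /= c0 (rs_initial_u S).
Qed.

Lemma regular_lipschitz : exists2 C : R, 0 <= C & forall t, t \in `[0, T] -> forall i x y,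
  `|u t x 0 i - u t y 0 i| <= C * `|x - y|.
Proof.
have [L L0 hL] := lipschitz_const; exists (3 * L); first by rewrite mulr_ge0.
move=> t tT i x y.
apply: (lip_of_partials (f := fun y => u t y 0 i)); first exact: (rs_rep_u S i tT).
move=> j w; have := hL i j (t, w); rewrite (derive_slice (U i) (evec R j) (t, w)).2.
by rewrite /U /= clamp_id.
Qed.

End regular.

Theorem theorem1p3 (R : realType) (A alpha beta gamma delta : R)
  (hA : 0 < A) (halpha : 0 < alpha) (hbeta : 0 <= 2 * alpha + 3 * beta)
  (hgamma : 1 < gamma) (hdelta : 1 < delta)
  (rho0 : 'rV[R]_3 -> R) (u0 : 'rV[R]_3 -> 'rV[R]_3)
  (hrho0 : forall x, 0 <= rho0 x)
  (hrho0_gamma : H3 (fun x => rho0 x `^ ((gamma - 1) / 2)))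
  (hrho0_delta : H3 (fun x => rho0 x `^ ((delta - 1) / 2)))
  (hu0 : forall i : 'I_3, H3 (fun x => u0 x 0 i))
  (V : set 'rV[R]_3) (hV : hyperbolic_singularity_set rho0 u0 V) :
  (max_existence_time A alpha beta gamma delta rho0 u0 < +oo)%E.
Proof.
have [oV [x0 Vx0] V0 spec] := hV.
have [lam l0 ev] := spec _ Vx0.
apply: (@le_lt_trans _ _ (- lam^-1)%:E); last exact: ltry.
have ts0 : 0 < - lam^-1 by rewrite oppr_gt0 invr_lt0.
apply: ge_ereal_sup => _ [T [T0 [rho [u S]]] <-]; rewrite lee_fin leNgt; apply/negP => tsT.
have tsin : - lam^-1 \in `[0, T] by rewrite in_itv/= !ltW.
have [C C0 lip] := regular_lipschitz T0 S.
have uC i : C1 (fun x => u0 x 0 i) by case: (hu0 i).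
apply: (flow_collapse oV Vx0 uC ev l0 C0 (lip _ tsin)) => x Vx i.
apply: (regular_rest T0 hdelta S oV V0 Vx); by rewrite (ltW ts0).
Qed.
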